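(* Let $1\le q<\infty$ and let $\mu$ be a finite positive Borel measure on $[0,1)$. Let $Y_q\in\{D^q_{q-1},H^q,HL(q)\}$. Then the following statements are equivalent. (1) $\mathcal{H}_\mu$ is bounded from $H^\infty$ to $Y_q$. (2) $\mathcal{H}_\mu$ is compact from $H^\infty$ to $Y_q$. (3) The measure $\mu$ satisfies $\{(n+1)^{1-\frac{2}{q}}\mu_n\}_{n=0}^\infty\in\ell^q$.
   Context: Let $\mathbb{D}=\{z\in\mathbb{C}:|z|<1\}$ and let $H(\mathbb{D})$ be the space of all analytic functions on $\mathbb{D}$. $H^\infty$ is the space of $f\in H(\mathbb{D})$ with $\|f\|_\infty=\sup_{z\in\mathbb{D}}|f(z)|<\infty$. For $f\in H(\mathbb{D})$, $\widehat{f}(n)$ denotes its $n$-th Taylor coefficient at $0$. For a finite positive Borel measure $\mu$ on $[0,1)$ and an integer $n\ge 0$, put $\mu_n=\int_{[0,1)}t^n\,d\mu(t)$. For $f(z)=\sum_{n=0}^\infty a_nz^n\in H(\mathbb{D})$, the generalized Hilbert operator is $$\mathcal{H}_\mu(f)(z)=\sum_{n=0}^\infty\left(\sum_{k=0}^\infty\mu_{n+k}a_k\right)z^n,\quad z\in\mathbb{D},$$ whenever the right-hand side makes sense and defines an analytic function in $\mathbb{D}$. For $0<q<\infty$: - The Hardy space $H^q$ consists of all $f\in H(\mathbb{D})$ with $\|f\|_q=\sup_{0\le r<1}\left(\frac{1}{2\pi}\int_0^{2\pi}|f(re^{i\theta})|^q\,d\theta\right)^{1/q}<\infty$. - The Dirichlet-type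 space $D^q_{q-1}$ consists of all $h\in H(\mathbb{D})$ with $\|h\|_{D^q_{q-1}}^q=|h(0)|^q+\int_{\mathbb{D}}|h'(z)|^q(1-|z|)^{q-1}\,dA(z)<\infty$, where $dA$ is area measure on $\mathbb{D}$. - The Hardy–Littlewood space $HL(q)$ consists of all $h\in H(\mathbb{D})$ with $\|h\|_{HL(q)}^q=\sum_{n=0}^\infty(n+1)^{q-2}|\widehat{h}(n)|^q<\infty$. *)

(* Defs.v *)
From HB Require Import structures.
From mathcomp Require Import all_boot all_order all_algebra.
From mathcomp Require Import complex.
From mathcomp Require Import all_classical all_reals all_analysis.

Set Implicit Arguments.
Unset Strict Implicit.
Unset Printing Implicit Defensive.

Import Order.TTheory GRing.Theory Num.Theory.
Import numFieldNormedType.Exports.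
Import ComplexField.Normc.

Local Open Scope classical_set_scope.
Local Open Scope ring_scope.
Local Open Scope complex_scope.

(* The regular module [R[i]^o] carries the topology of the modulus; derivatives
   and limits below are taken over the field [R[i]], hence are complex ones.
   [normc] is the real-valued modulus. Elements of H(D) are represented by total
   functions whose values outside the disk are irrelevant. *)

Section HilbertOperator.
Variable R : realType.
Local Notation C := (R[i]^o).

Definition disk : set C := [set z | normc z < 1].

Definition analytic (f : C -> C) : Prop :=
  forall z : C, disk z -> derivable f z 1.

Definition taylor_coef (f : C -> C) (n : nat) : C :=
  derive1n n f 0 / (n`!)%:R.

Definition hinfty_norm (f : C -> C) : \bar R :=
  ereal_sup [set (normc (f z))%:E | z in disk].

Definition in_hinfty (f : C -> C) : Prop :=
  analytic f /\ (hinfty_norm f < +oo)%E.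

(* q-th power of the integral mean of [h] over the circle of radius [r] *)
Definition integral_mean (q : R) (h : C -> C) (r : R) : \bar R :=
  (((2 * pi)^-1)%R%:E *
    \int[lebesgue_measure]_(t in `[0%R, (2 * pi)%R])
      ((normc (h ((r * cos t) +i* (r * sin t))) `^ q)%R)%:E)%E.

Definition hardy_norm (q : R) (h : C -> C) : \bar R :=
  ereal_sup [set poweR (integral_mean q h r) q^-1 | r in `[0, 1[].

Definition dirichlet_norm (q : R) (h : C -> C) : \bar R :=
  poweR
    ((normc (h 0) `^ q)%R%:E +
     \int[lebesgue_measure \x lebesgue_measure]_(p in
         [set p : R * R | disk (p.1 +i* p.2)%C])
       (normc (derive1 h (p.1 +i* p.2)%C) `^ q *
        (1 - normc (p.1 +i* p.2)%C) `^ (q - 1))%R%:E)%E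
    q^-1.

Definition hardy_littlewood_norm (q : R) (h : C -> C) : \bar R :=
  poweR
    (\sum_(0 <= n <oo)
       (n.+1%:R `^ (q - 2) * normc (taylor_coef h n) `^ q)%R%:E)%E
    q^-1.

Inductive target_space := DirichletType | Hardy | HardyLittlewood.

Definition target_norm (Y : target_space) (q : R) : (C -> C) -> \bar R :=
  match Y with
  | DirichletType => dirichlet_norm q
  | Hardy => hardy_norm q
  | HardyLittlewood => hardy_littlewood_norm q
  end.

Definition in_target (Y : target_space) (q : R) (h : C -> C) : Prop :=
  analytic h /\ (target_norm Y q h < +oo)%E.

Definition in_ell (q : R) (u : nat -> R) : Prop :=
  (\sum_(0 <= n <oo) (`|u n| `^ q)%R%:E < +oo)%E.

Section Operator.
Variable mu : {finite_measure set (measurableTypeR R) -> \bar R}.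

Definition moment (n : nat) : R := (\int[mu]_(t in `[0%R, 1%R[) (t ^+ n))%R.

(* Both the inner and the outer series are limits of partial sums; the inner
   one need not converge absolutely. *)
Definition hilbert_inner (f : C -> C) (n : nat) : nat -> C :=
  series (fun k => (moment (n + k))%:C * taylor_coef f k).

Definition hilbert_coef (f : C -> C) (n : nat) : C :=
  lim (hilbert_inner f n @ \oo).

Definition hilbert_outer (f : C -> C) (z : C) : nat -> C :=
  series (fun n => hilbert_coef f n * z ^+ n).

Definition hilbert (f : C -> C) (z : C) : C := lim (hilbert_outer f z @ \oo).

Definition hilbert_defined (f : C -> C) : Prop :=
  [/\ forall n, cvg (hilbert_inner f n @ \oo),
      forall z, disk z -> cvg (hilbert_outer f z @ \oo)
    & analytic (hilbert f)].

Definition hilbert_maps_into (Y : target_space) (q : R) : Prop :=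
  forall f, in_hinfty f -> hilbert_defined f /\ in_target Y q (hilbert f).

Definition hilbert_bounded (Y : target_space) (q : R) : Prop :=
  hilbert_maps_into Y q /\
  exists M : R, forall f, in_hinfty f ->
    (target_norm Y q (hilbert f) <= M%:E * hinfty_norm f)%E.

Definition hilbert_compact (Y : target_space) (q : R) : Prop :=
  hilbert_maps_into Y q /\
  forall (f : nat -> C -> C) (M : R),
    (forall n, in_hinfty (f n) /\ (hinfty_norm (f n) <= M%:E)%E) ->
    exists phi : nat -> nat, exists g : C -> C,
      [/\ {homo phi : m n / (m < n)%N},
          in_target Y q g
        & (fun n => target_norm Y q (fun z => hilbert (f (phi n)) z - g z))
            @ \oo --> 0%E].

End Operator.
End HilbertOperator.

(* Main.v *)
Require Import Defs.
From mathcomp Require Import all_boot all_order all_algebra.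
From mathcomp Require Import complex ring lra.
From mathcomp Require Import all_classical all_reals all_analysis.
From mathcomp Require Import measurable_realfun.

Import Order.TTheory GRing.Theory Num.Theory.
Import numFieldNormedType.Exports.
Import ComplexField.Normc.

Local Open Scope classical_set_scope.
Local Open Scope ring_scope.

Set Implicit Arguments.
Unset Strict Implicit.
Unset Printing Implicit Defensive.

(** The third statement says that sum_n (n+1)^(q-2) mu_n^q is finite. Finiteness of
    this sum makes the operator bounded and compact, and conversely the image of
    the single function 1 already forces the sum to be finite.

    Sufficiency. For a bounded analytic [f] the operator is an integral,
      H f (z) = int f(t) / (1 - t z) dmu(t),
    a Cauchy transform on the radius [0, 1). The inner series defining it may
    converge only conditionally, and the point is to exchange it with the integral.
    By Landau's theorem ([landau_partial_sum]) the partial sums of the Taylor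
    coefficients of [f] grow at most like 2 M sum_(k<n) 1/(k+1); by Abel summation
    the Taylor partial sums at [t] are dominated by 2 M sum_k t^k/(k+1), whose
    integral 2 M sum_k mu_k/(k+1) is finite under the summability condition
    ([harmonic_moment_bound]). Dominated convergence does the rest
    ([hilbert_inner_cvg], [hilbertE]). Landau's theorem and the Taylor expansion
    rest on the mean value property over circles, which comes from Goursat's
    theorem for rectangles in logarithmic coordinates ([goursat_rect],
    [circle_mean_value]).

    Let W_n = int t^n |f| dmu, a nonincreasing sequence. If |1 - z| is about
    2^-m, then 1/|1 - t z| is at most a multiple of sum_(k<2^m) t^k, so |H f (z)|
    is at most a multiple of A_m = sum_(k<2^m) W_k, and |(H f)'(z)| of 2^m A_m.
    Cutting circles and the disk into layers according to |1 - z| bounds the q-th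
    power of the Hardy and of the Dirichlet norm by a multiple of
    sum_m 2^-m A_m^q. A dyadic form of Hardy's inequality ([dyadic_hardy]) bounds
    this by sum_n (n+1)^(q-2) W_n^q, the same quantity that dominates the
    Hardy-Littlewood norm ([target_norm_le]). Since W_n <= sup |f| mu_n, the
    operator is bounded.

    For compactness, a bounded sequence of functions has a subsequence with
    convergent Taylor coefficients ([coordinatewise_subsequence]). The differences
    from the limit function tend to 0 at every point of the radius while their
    moments stay dominated by multiples of mu_n, so their weighted sums, hence the
    norms of their images, tend to 0 ([energy_vanishes],
    [hilbert_compact_of_energy]).

    Necessity. The image g of the function 1 has the moments mu_n as coefficients,
    which settles the Hardy-Littlewood space. For the other two, |g| or |g'| is
    bounded below by a single moment, on an arc of length about 2^-m respectively
    on a box of side about 2^-m near 1 ([hilbert_one_lower],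
    [hilbert_one_derive1_lower]); disjoint arcs or boxes add up to the dyadic form
    sum_m 2^(m(q-1)) mu_(2^m)^q of the sum, up to a shift of the index
    ([energy_of_maps_into]). *)

(** * Moduli, limits and derivatives of complex numbers *)

Section ComplexModulus.
Variable R : realType.
Local Notation C := (R[i]^o).
Implicit Types (x y z : C) (r : R).

Lemma normcE z : `|z : R[i]| = (normc z)%:C%C.
Proof. by []. Qed.

Lemma normc_ge0 z : 0 <= normc z.
Proof. by case: z => a b; exact: sqrtr_ge0. Qed.

Lemma normcD x y : normc (x + y) <= normc x + normc y.
Proof.
have := ler_normD (x : R[i]) (y : R[i]).
by rewrite !normcE -rmorphD/= lecR.
Qed.

Lemma normcN z : normc (- z) = normc z.
Proof. by case: z => a b; rewrite /= !sqrrN. Qed.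

Lemma normcB x y : normc (x - y) = normc (y - x).
Proof. by rewrite -normcN opprB. Qed.

Lemma normcBD x y : normc (x - y) <= normc x + normc y.
Proof. by rewrite (le_trans (normcD _ _))// normcN. Qed.

Lemma normcBl x y : normc x - normc y <= normc (x - y).
Proof. by have := normcD (x - y) y; rewrite subrK lerBlDr. Qed.

Lemma normcR r : normc r%:C%C = `|r|.
Proof. by rewrite /= expr0n addr0 sqrtr_sqr. Qed.

Lemma normcX z n : normc (z ^+ n) = normc z ^+ n.
Proof. by elim: n => [|n ih]; rewrite ?expr0 ?normc1// !exprS normcM ih. Qed.

Lemma normc_eq0 z : (normc z == 0) = (z == 0).
Proof.
by apply/eqP/eqP => [|->]; [exact: eq0_normc|rewrite normc0].
Qed.

Lemma normc_gt0 z : (0 < normc z) = (z != 0).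
Proof. by rewrite lt0r normc_eq0 normc_ge0 andbT. Qed.

Lemma normc_nat n : normc (n%:R : C) = n%:R.
Proof.
have -> : (n%:R : C) = (n%:R)%:C%C by rewrite rmorph_nat.
by rewrite normcR ger0_norm.
Qed.

Lemma normRe_le z : `|complex.Re z| <= normc z.
Proof.
by case: z => a b /=; rewrite -[`|a|]sqrtr_sqr ler_wsqrtr// lerDl sqr_ge0.
Qed.

Lemma normIm_le z : `|complex.Im z| <= normc z.
Proof.
by case: z => a b /=; rewrite -[`|b|]sqrtr_sqr ler_wsqrtr// lerDr sqr_ge0.
Qed.

Lemma normc_leD z : normc z <= `|complex.Re z| + `|complex.Im z|.
Proof.
case: z => a b /=.
rewrite -(@ler_pXn2r _ 2)// ?nnegrE ?addr_ge0// ?sqrtr_ge0//.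
rewrite sqr_sqrtr ?addr_ge0 ?sqr_ge0//.
rewrite sqrrD !real_normK ?num_real// lerD2r lerDl.
by rewrite mulrn_wge0// mulr_ge0.
Qed.

Lemma ReD x y : complex.Re (x + y) = complex.Re x + complex.Re y.
Proof. by case: x => a b; case: y. Qed.
Lemma ImD x y : complex.Im (x + y) = complex.Im x + complex.Im y.
Proof. by case: x => a b; case: y. Qed.
Lemma ReN x : complex.Re (- x) = - complex.Re x.
Proof. by case: x. Qed.
Lemma ImN x : complex.Im (- x) = - complex.Im x.
Proof. by case: x. Qed.
Lemma ReM x y : complex.Re (x * y) =
  complex.Re x * complex.Re y - complex.Im x * complex.Im y.
Proof. by case: x => a b; case: y. Qed.
Lemma ImM x y : complex.Im (x * y) =
  complex.Re x * complex.Im y + complex.Im x * complex.Re y.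
Proof. by case: x => a b; case: y. Qed.
Lemma Re_real r : complex.Re (r%:C%C : C) = r. Proof. by []. Qed.
Lemma Im_real r : complex.Im (r%:C%C : C) = 0. Proof. by []. Qed.

Lemma Re_sum I (s : seq I) (P : pred I) (F : I -> C) :
  complex.Re (\sum_(i <- s | P i) F i) = \sum_(i <- s | P i) complex.Re (F i).
Proof. by rewrite (big_morph _ ReD (erefl : complex.Re 0 = 0)). Qed.

Lemma Im_sum I (s : seq I) (P : pred I) (F : I -> C) :
  complex.Im (\sum_(i <- s | P i) F i) = \sum_(i <- s | P i) complex.Im (F i).
Proof. by rewrite (big_morph _ ImD (erefl : complex.Im 0 = 0)). Qed.

Lemma normc_sum I (s : seq I) (P : pred I) (F : I -> C) :
  normc (\sum_(i <- s | P i) F i) <= \sum_(i <- s | P i) normc (F i).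
Proof.
elim/big_rec2 : _ => [|i x y _ ih]; first by rewrite normc0.
by rewrite (le_trans (normcD _ _))// lerD2l.
Qed.

Lemma normc_sqr z : normc z ^+ 2 = complex.Re z ^+ 2 + complex.Im z ^+ 2.
Proof. by case: z => a b /=; rewrite sqr_sqrtr// addr_ge0// sqr_ge0. Qed.

Lemma ReV z : complex.Re z^-1 = complex.Re z / normc z ^+ 2.
Proof. by rewrite normc_sqr; case: z. Qed.

Lemma ImV z : complex.Im z^-1 = - (complex.Im z / normc z ^+ 2).
Proof. by rewrite normc_sqr; case: z. Qed.

Lemma scalecE (a : R[i]) z : a *: z = a * z. Proof. by []. Qed.

Lemma diskP z : disk z <-> normc z < 1. Proof. by []. Qed.

Lemma disk0 : disk (0 : C).
Proof. by rewrite /disk /= expr0n addr0 sqrtr0. Qed.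

End ComplexModulus.

Section ComplexLimits.
Variable R : realType.
Local Notation C := (R[i]^o).

Lemma gt0_complexR (e : R[i]) : 0 < e -> exists2 d : R, 0 < d & e = d%:C%C.
Proof.
case: e => a b; rewrite ltcE/= => /andP[/eqP -> a0].
by exists a.
Qed.

Lemma cvg_normcP (u : nat -> C) (l : C) :
  u @ \oo --> l <->
  forall e : R, 0 < e -> exists N, forall n, (N <= n)%N -> normc (u n - l) < e.
Proof.
split=> [/cvgrPdist_lt ul e e0|ul].
  have e0' : 0 < e%:C%C :> R[i] by rewrite ltcR.
  have [N _ NE] := ul _ e0'; exists N => n Nn.
  have := NE n Nn; rewrite /= normcE ltcR.
  by rewrite normcB.
apply/cvgrPdist_lt => e /gt0_complexR[d d0 ->].
have [N NE] := ul _ d0; exists N => // n /= Nn.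
by rewrite normcE ltcR normcB; exact: NE.
Qed.

Lemma cvg_normc_lim (u : nat -> C) (l : C) :
  (forall e : R, 0 < e -> exists N, forall n, (N <= n)%N -> normc (u n - l) < e) ->
  lim (u @ \oo) = l.
Proof. by move/cvg_normcP/cvg_lim; apply. Qed.

(** The order of [R[i]] lives on the complex numbers themselves; with real
    epsilon and delta the estimates of derivatives become inequalities in [R]. *)
Definition cdiff (f : C -> C) (z d : C) := forall e : R, 0 < e ->
  exists2 r : R, 0 < r & forall w : C, normc (w - z) < r ->
    normc (f w - f z - d * (w - z)) <= e * normc (w - z).

Lemma cdiff_is_derive (f : C -> C) (z d : C) : cdiff f z d -> is_derive z 1 f d.
Proof.
move=> fd.
have cv : h^-1 *: (f (h *: (1 : C) + z) - f z) @[h --> (0 : C)^'] --> d.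
  apply/cvgrPdist_le => e /gt0_complexR[e' e0 ->].
  have [r r0 rP] := fd _ e0.
  near=> h.
  have h0 : h != 0 by near: h; exact: withinT.
  have hr : normc h < r.
    have : `|h : R[i]| < r%:C%C.
      by near: h; apply: (@dnbhs0_lt _ C); rewrite ltcR.
    by rewrite normcE ltcR.
  rewrite normcE lecR.
  have := rP (h *: (1 : C) + z).
  have hE : h *: (1 : C) + z - z = h by rewrite addrK; exact: mulr1.
  rewrite hE => /(_ hr).
  have -> : d - h^-1 *: (f (h *: (1 : C) + z) - f z) =
    - (h^-1 * (f (h *: (1 : C) + z) - f z - d * h)) :> C.
    by rewrite scalecE; field.
  rewrite normcN normcM normcV => H.
  by rewrite mulrC ler_pdivrMr// normc_gt0.
split; first by apply/cvg_ex; exists d.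
by apply/cvg_lim.
Unshelve. all: by end_near. Qed.

Lemma is_derive_cdiff (f : C -> C) (z d : C) : is_derive z 1 f d -> cdiff f z d.
Proof.
move=> [fz fd] e e0.
have : h^-1 *: (f (h *: (1 : C) + z) - f z) @[h --> (0 : C)^'] --> d.
  by rewrite -fd; exact: fz.
move/cvgrPdist_le => /(_ e%:C%C).
rewrite ltcR => /(_ e0) [r' /= /gt0_complexR[r r0 ->] rP].
exists r => // w wr.
have [->|wz] := eqVneq w z.
  by rewrite !subrr mulr0 subrr normc0 mulr0.
have wz0 : w - z != 0 by rewrite subr_eq0.
have := rP (w - z).
rewrite /ball_/= sub0r normrN normcE ltcR => /(_ wr wz0).
have hE : (w - z) *: (1 : C) + z = w by rewrite [_ *: _]mulr1 subrK.
rewrite hE normcE lecR.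
have -> : f w - f z - d * (w - z) =
  - ((w - z) * (d - (w - z)^-1 *: (f w - f z))) :> C.
  by rewrite scalecE; field.
by rewrite normcN normcM mulrC => ?; rewrite ler_wpM2r// normc_ge0.
Qed.

Lemma derivable_cdiff (f : C -> C) (z : C) :
  derivable f z 1 -> cdiff f z (derive1 f z).
Proof.
by move=> fz; apply: is_derive_cdiff; rewrite derive1E; exact: derivableP.
Qed.

Lemma cdiff_derivable (f : C -> C) (z d : C) : cdiff f z d -> derivable f z 1.
Proof. by move/cdiff_is_derive => []. Qed.

Lemma cdiff_derive1 (f : C -> C) (z d : C) : cdiff f z d -> derive1 f z = d.
Proof. by move/cdiff_is_derive => [_ <-]; rewrite derive1E. Qed.

Lemma cdiff_local (f g : C -> C) (z d : C) (r : R) : 0 < r ->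
  (forall w, normc (w - z) < r -> f w = g w) -> cdiff f z d -> cdiff g z d.
Proof.
move=> r0 fg fd e e0; have [s s0 sP] := fd _ e0.
exists (Num.min r s); first by rewrite lt_min r0.
move=> w; rewrite lt_min => /andP[wr ws].
by rewrite -!fg ?subrr ?normc0//; exact: sP.
Qed.

Lemma disk_nbhs (z : C) : disk z -> exists2 r : R, 0 < r &
  forall w, normc (w - z) < r -> disk w.
Proof.
move=> z1; exists (1 - normc z); first by rewrite subr_gt0.
move=> w wz; have := normcD (w - z) z; rewrite subrK => wle.
apply: le_lt_trans wle _; lra.
Qed.

Lemma cdiff_disk (f g : C -> C) (z d : C) : disk z ->
  (forall w, disk w -> f w = g w) -> cdiff f z d -> cdiff g z d.
Proof.
move=> /disk_nbhs[r r0 rD] fg; apply: (cdiff_local r0) => w wr.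
by apply: fg; exact: rD.
Qed.

Definition ccont (f : C -> C) (z : C) := forall e : R, 0 < e ->
  exists2 r : R, 0 < r & forall w : C, normc (w - z) < r -> normc (f w - f z) < e.

Lemma cdiff_ccont (f : C -> C) (z d : C) : cdiff f z d -> ccont f z.
Proof.
move=> fd e e0; have [r r0 rP] := fd 1 ltr01.
have d0 := normc_ge0 d.
have k0 : 0 < normc d + 1 by rewrite ltr_wpDl.
exists (Num.min r (e / (normc d + 1))); first by rewrite lt_min r0 divr_gt0.
move=> w; rewrite lt_min => /andP[wr we].
have := rP w wr; rewrite mul1r => H.
have := normcD (f w - f z - d * (w - z)) (d * (w - z)).
rewrite subrK normcM => /le_lt_trans; apply.
move: we; rewrite ltr_pdivlMr// => we.
apply: le_lt_trans we; lra.
Qed.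

End ComplexLimits.

Section CplxSeq.
Variable R : realType.
Local Notation C := (R[i]^o).

Lemma cvg_normc (u : nat -> C) (l : C) : u @ \oo --> l ->
  (fun n => normc (u n - l)) @ \oo --> (0 : R).
Proof.
move/cvg_normcP => ul; apply/cvgrPdist_lt => e e0.
have [N NE] := ul _ e0; exists N => // n /= Nn.
by rewrite sub0r normrN ger0_norm ?normc_ge0//; exact: NE.
Qed.

Lemma normc_cvg (u : nat -> C) (l : C) :
  (fun n => normc (u n - l)) @ \oo --> (0 : R) -> u @ \oo --> l.
Proof.
move/cvgrPdist_lt => ul; apply/cvg_normcP => e e0.
have [N _ NE] := ul _ e0; exists N => n /NE /=.
by rewrite sub0r normrN ger0_norm ?normc_ge0.
Qed.

Lemma cvgc_squeeze (u : nat -> C) (l : C) (v : nat -> R) :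
  (forall n, normc (u n - l) <= v n) -> v @ \oo --> (0 : R) -> u @ \oo --> l.
Proof.
move=> uv v0; apply: normc_cvg.
apply: (@squeeze_cvgr _ _ _ _ (fun=> 0) v) => //; last exact: cvg_cst.
by apply: nearW => n; rewrite normc_ge0 uv.
Qed.

Lemma cvgc_Re (u : nat -> C) (l : C) : u @ \oo --> l ->
  (fun n => complex.Re (u n)) @ \oo --> complex.Re l.
Proof.
move/cvg_normcP => ul; apply/cvgrPdist_lt => e e0.
have [N NE] := ul _ e0; exists N => // n /= /NE; apply: le_lt_trans.
by rewrite -ReN -ReD normcB normRe_le.
Qed.

Lemma cvgc_Im (u : nat -> C) (l : C) : u @ \oo --> l ->
  (fun n => complex.Im (u n)) @ \oo --> complex.Im l.
Proof.
move/cvg_normcP => ul; apply/cvgrPdist_lt => e e0.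
have [N NE] := ul _ e0; exists N => // n /= /NE; apply: le_lt_trans.
by rewrite -ImN -ImD normcB normIm_le.
Qed.

Lemma cvgc_ReIm (u : nat -> C) (a b : R) :
  (fun n => complex.Re (u n)) @ \oo --> a ->
  (fun n => complex.Im (u n)) @ \oo --> b -> u @ \oo --> (Complex a b : C).
Proof.
move=> ua ub.
apply: (@cvgc_squeeze _ _ (fun n => `|complex.Re (u n) - a| +
  `|complex.Im (u n) - b|)).
  by move=> n; apply: le_trans (normc_leD _) _; rewrite ReD ImD ReN ImN.
rewrite -[0 in X in _ --> X]addr0.
have cv0 (v : nat -> R) (c : R) : v @ \oo --> c ->
    (fun n => `|v n - c|) @ \oo --> (0 : R).
  move/cvgrPdist_lt => vc; apply/cvgrPdist_lt => e /vc; apply: filterS => n.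
  by rewrite sub0r normrN normr_id distrC.
by apply: cvgD; exact: cv0.
Qed.

Lemma cvgc_unique (u : nat -> C) (l l' : C) :
  u @ \oo --> l -> u @ \oo --> l' -> l = l'.
Proof.
move=> ul ul'; have := cvgc_Re ul; have := cvgc_Im ul.
have := cvgc_Re ul'; have := cvgc_Im ul'.
case: l l' {ul ul'} => a b [c d] /= h1 h2 h3 h4.
congr Complex.
  by rewrite -(cvg_lim (@Rhausdorff _) h4) (cvg_lim (@Rhausdorff _) h2).
by rewrite -(cvg_lim (@Rhausdorff _) h3) (cvg_lim (@Rhausdorff _) h1).
Qed.

Lemma normc_cvg_le (u : nat -> C) (l : C) (B : R) :
  u @ \oo --> l -> (forall n, normc (u n) <= B) -> normc l <= B.
Proof.
move/cvg_normcP => ul uB; rewrite leNgt; apply/negP => Bl.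
have [N NE] := ul (normc l - B) ltac:(lra).
have := NE N (leqnn _); have := normcBl l (u N).
by rewrite normcB; have := uB N; lra.
Qed.

End CplxSeq.

(** * Integrals of complex-valued functions *)

Section ComplexIntegral.
Context d (T : measurableType d) (R : realType).
Variable mu : {measure set T -> \bar R}.
Local Notation C := (R[i]^o).
Implicit Types (D : set T) (u v : T -> C).

Definition Cint D u : C :=
  Complex (\int[mu]_(x in D) complex.Re (u x))%R
          (\int[mu]_(x in D) complex.Im (u x))%R.

Definition cmeasurable D u :=
  measurable_fun D (fun x => complex.Re (u x)) /\
  measurable_fun D (fun x => complex.Im (u x)).

Definition cintegrable D u :=
  mu.-integrable D (EFin \o (fun x => complex.Re (u x))) /\
  mu.-integrable D (EFin \o (fun x => complex.Im (u x))).

Lemma eq_Cint D u v : (forall x, D x -> u x = v x) -> Cint D u = Cint D v.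
Proof.
move=> uv; congr Complex; apply: eq_Rintegral => x; rewrite inE => Dx.
  by rewrite uv.
by rewrite uv.
Qed.

Lemma cmeasurableD D u v : cmeasurable D u -> cmeasurable D v ->
  cmeasurable D (fun x => u x + v x).
Proof.
move=> [u1 u2] [v1 v2]; split.
  by under eq_fun do rewrite ReD; exact: measurable_funD.
by under eq_fun do rewrite ImD; exact: measurable_funD.
Qed.

Lemma cmeasurableM D u v : cmeasurable D u -> cmeasurable D v ->
  cmeasurable D (fun x => u x * v x).
Proof.
move=> [u1 u2] [v1 v2]; split.
  under eq_fun do rewrite ReM.
  by apply: measurable_funB; exact: measurable_funM.
under eq_fun do rewrite ImM.
by apply: measurable_funD; exact: measurable_funM.
Qed.

Lemma cmeasurable_cst D (c : C) : cmeasurable D (fun=> c).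
Proof. by split; exact: measurable_cst. Qed.

Lemma cmeasurable_real D (g : T -> R) : measurable_fun D g ->
  cmeasurable D (fun x => (g x)%:C%C).
Proof. by move=> mg; split => //=; exact: measurable_cst. Qed.

Lemma cmeasurable_cvg D (w : nat -> T -> C) u :
  (forall n, cmeasurable D (w n)) ->
  (forall x, D x -> (fun n => w n x) @ \oo --> u x) -> cmeasurable D u.
Proof.
move=> mw wu; split.
  apply: (measurable_fun_cvg (h := fun n x => complex.Re (w n x))).
    by move=> n; exact: (mw n).1.
  by move=> x Dx; exact: cvgc_Re (wu x Dx).
apply: (measurable_fun_cvg (h := fun n x => complex.Im (w n x))).
  by move=> n; exact: (mw n).2.
by move=> x Dx; exact: cvgc_Im (wu x Dx).
Qed.

Lemma cmeasurable_normc D u : cmeasurable D u ->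
  measurable_fun D (fun x => normc (u x)).
Proof.
move=> [u1 u2].
have -> : (fun x => normc (u x)) =
    (fun x => Num.sqrt (complex.Re (u x) ^+ 2 + complex.Im (u x) ^+ 2)).
  by apply/funext => x; case: (u x).
apply: (measurableT_comp (f := @Num.sqrt R)); first
    by apply: continuous_measurable_fun; exact: sqrt_continuous.
by apply: measurable_funD; exact: measurable_funX.
Qed.

Lemma cintegrable_le D u (g : T -> R) : measurable D -> cmeasurable D u ->
  mu.-integrable D (EFin \o g) -> (forall x, D x -> normc (u x) <= g x) ->
  cintegrable D u.
Proof.
move=> mD [m1 m2] ig ug; split.
- apply: (le_integrable mD _ _ ig); first exact/measurable_EFinP.
  move=> x Dx /=; rewrite lee_fin (le_trans (normRe_le _))//.
  by rewrite (le_trans (ug x Dx))// ler_norm.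
- apply: (le_integrable mD _ _ ig); first exact/measurable_EFinP.
  move=> x Dx /=; rewrite lee_fin (le_trans (normIm_le _))//.
  by rewrite (le_trans (ug x Dx))// ler_norm.
Qed.

Lemma cintegrable_meas D u : cintegrable D u -> cmeasurable D u.
Proof.
by move=> [/measurable_int h1 /measurable_int h2]; split; exact/measurable_EFinP.
Qed.

Lemma cintegrableD D u v : measurable D -> cintegrable D u -> cintegrable D v ->
  cintegrable D (fun x => u x + v x).
Proof.
move=> mD [u1 u2] [v1 v2]; split.
  have := integrableD mD u1 v1; apply: eq_integrable => // x _ /=.
  by rewrite ReD.
have := integrableD mD u2 v2; apply: eq_integrable => // x _ /=.
by rewrite ImD.
Qed.

Lemma cintegrableZ D (c : C) u : measurable D -> cintegrable D u ->
  cintegrable D (fun x => c * u x).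
Proof.
move=> mD [u1 u2]; split.
  have := integrableB mD (integrableZl mD (complex.Re c) u1)
    (integrableZl mD (complex.Im c) u2).
  by apply: eq_integrable => // x _ /=; rewrite ReM -!EFinM EFinB.
have := integrableD mD (integrableZl mD (complex.Re c) u2)
  (integrableZl mD (complex.Im c) u1).
by apply: eq_integrable => // x _ /=; rewrite ImM -!EFinM EFinD.
Qed.

Lemma CintD D u v : measurable D -> cintegrable D u -> cintegrable D v ->
  Cint D (fun x => u x + v x) = Cint D u + Cint D v.
Proof.
move=> mD [u1 u2] [v1 v2]; rewrite /Cint; simpc.
under eq_Rintegral do rewrite ReD.
under [X in Complex _ X]eq_Rintegral do rewrite ImD.
by rewrite !RintegralD.
Qed.

Lemma CintZ D (c : C) u : measurable D -> cintegrable D u ->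
  Cint D (fun x => c * u x) = c * Cint D u.
Proof.
move=> mD [u1 u2]; case: c => a b; rewrite /Cint; simpc.
have iZ r (w : T -> R) : mu.-integrable D (EFin \o w) ->
    mu.-integrable D (EFin \o (fun x => r * w x)).
  move=> iw; have := integrableZl mD r iw.
  by apply: eq_integrable => // x _ /=; rewrite EFinM.
under eq_Rintegral do rewrite ReM/=.
under [X in Complex _ X]eq_Rintegral do rewrite ImM/=.
rewrite RintegralB//; [|exact: iZ|exact: iZ].
rewrite RintegralD//; [|exact: iZ|exact: iZ].
by rewrite !RintegralZl.
Qed.

Lemma CintB D u v : measurable D -> cintegrable D u -> cintegrable D v ->
  Cint D (fun x => u x - v x) = Cint D u - Cint D v.
Proof.
move=> mD iu iv.
have -> : (fun x => u x - v x) = (fun x => u x + (-1) * v x).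
  by apply/funext => x; rewrite mulN1r.
rewrite CintD ?CintZ ?mulN1r//; exact: cintegrableZ.
Qed.

Lemma cintegrableB D u v : measurable D -> cintegrable D u -> cintegrable D v ->
  cintegrable D (fun x => u x - v x).
Proof.
move=> mD iu iv.
have -> : (fun x => u x - v x) = (fun x => u x + (-1) * v x).
  by apply/funext => x; rewrite mulN1r.
by apply: cintegrableD => //; exact: cintegrableZ.
Qed.

Lemma cintegrable0 D : measurable D -> cintegrable D (fun=> 0).
Proof.
by move=> mD; split; apply: (eq_integrable mD (cst 0%E)) => //; exact: integrable0.
Qed.

Lemma Cint0 D : Cint D (fun=> 0) = 0.
Proof.
rewrite /Cint /= (_ : (\int[mu]_(x in D) 0)%R = 0)//.
by rewrite /Rintegral integral0.
Qed.

Lemma cintegrable_sum D (F : nat -> T -> C) n : measurable D ->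
  (forall k, cintegrable D (F k)) ->
  cintegrable D (fun x => \sum_(0 <= k < n) F k x).
Proof.
move=> mD iF; elim: n => [|n ih].
  by under eq_fun do rewrite big_nil; exact: cintegrable0.
by under eq_fun do rewrite big_nat_recr//=; exact: cintegrableD.
Qed.

Lemma Cint_sum D (F : nat -> T -> C) n : measurable D ->
  (forall k, cintegrable D (F k)) ->
  Cint D (fun x => \sum_(0 <= k < n) F k x) = \sum_(0 <= k < n) Cint D (F k).
Proof.
move=> mD iF; elim: n => [|n ih].
  by under eq_fun do rewrite big_nil; rewrite big_nil Cint0.
under eq_fun do rewrite big_nat_recr//=.
by rewrite CintD ?ih ?big_nat_recr//; exact: cintegrable_sum.
Qed.

(** The constant 2 comes from estimating real and imaginary parts separately. *)
Lemma normc_Cint_le D u (g : T -> R) : measurable D -> cintegrable D u ->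
  mu.-integrable D (EFin \o g) -> (forall x, D x -> normc (u x) <= g x) ->
  normc (Cint D u) <= 2 * (\int[mu]_(x in D) g x)%R.
Proof.
move=> mD [u1 u2] ig ug; apply: le_trans (normc_leD _) _.
rewrite mulr_natl mulr2n /=; apply: lerD; apply: le_trans (le_normr_Rintegral _ _) _ => //.
  apply: le_Rintegral => //; first exact: integrable_norm u1.
  by move=> x Dx; rewrite (le_trans (normRe_le _))// ug.
apply: le_Rintegral => //; first exact: integrable_norm u2.
by move=> x Dx; rewrite (le_trans (normIm_le _))// ug.
Qed.

Lemma Cint_dominated_cvg D (w : nat -> T -> C) u (g : T -> R) : measurable D ->
  (forall n, cmeasurable D (w n)) ->
  (forall x, D x -> (fun n => w n x) @ \oo --> u x) ->
  mu.-integrable D (EFin \o g) ->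
  (forall n x, D x -> normc (w n x) <= g x) ->
  (fun n => Cint D (w n)) @ \oo --> Cint D u.
Proof.
move=> mD mw wu ig wg.
have real_dct (p : nat -> T -> R) (l : T -> R) :
    (forall n, measurable_fun D (p n)) ->
    (forall x, D x -> (fun n => p n x) @ \oo --> l x) ->
    (forall n x, D x -> `|p n x| <= g x) ->
    (fun n => (\int[mu]_(x in D) p n x)%R) @ \oo --> (\int[mu]_(x in D) l x)%R.
  move=> mp pl pg; apply: fine_cvg; rewrite fineK.
    apply: (@dominated_cvg _ _ _ _ D mD (fun n x => (p n x)%:E) _ (EFin \o g)) => //.
    - by move=> n; exact/measurable_EFinP.
    - by move=> x Dx; apply: cvg_EFin; [exact: nearW|exact: pl].
  apply: integrable_fin_num => //.
  apply: (le_integrable mD _ _ ig).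
    by apply/measurable_EFinP; exact: measurable_fun_cvg mp pl.
  move=> x Dx /=; rewrite lee_fin.
  apply: le_trans (ler_norm (g x)).
  have plx : (fun n => `|p n x|) @ \oo --> `|l x|.
    by apply: cvg_norm; exact: pl.
  rewrite -(cvg_lim (@Rhausdorff _) plx).
  apply: limr_le; first by apply/cvg_ex; exists `|l x|.
  by apply: nearW => n; exact: pg.
apply: cvgc_ReIm => /=.
  apply: real_dct.
  - by move=> n; exact: (mw n).1.
  - by move=> x Dx; exact: cvgc_Re (wu x Dx).
  - by move=> n x Dx; rewrite (le_trans (normRe_le _))// wg.
apply: real_dct.
- by move=> n; exact: (mw n).2.
- by move=> x Dx; exact: cvgc_Im (wu x Dx).
- by move=> n x Dx; rewrite (le_trans (normIm_le _))// wg.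
Qed.

Lemma bounded_integrable D (g : T -> R) (B : R) : measurable D ->
  (mu D < +oo)%E -> measurable_fun D g -> (forall x, D x -> `|g x| <= B) ->
  mu.-integrable D (EFin \o g).
Proof.
move=> mD fD mg gB; apply: measurable_bounded_integrable => //.
by exists B; split; rewrite ?num_real// => M BM x /= Dx; apply: le_trans (gB x Dx) (ltW BM).
Qed.

Lemma bounded_cintegrable D u (B : R) : measurable D ->
  (mu D < +oo)%E -> cmeasurable D u -> (forall x, D x -> normc (u x) <= B) ->
  cintegrable D u.
Proof.
move=> mD fD mu_ uB; apply: (@cintegrable_le _ _ (cst B)) => //.
by apply: (@bounded_integrable _ _ `|B|) => //; exact: measurable_cst.
Qed.

End ComplexIntegral.

(** * Bisection of rectangles *)

Section Bisection.
Variable R : realType.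
Local Notation C := (R[i]^o).

Record rect := Rect { rl : R; rr : R; rb : R; rt : R }.

Definition rect_sub (p q : rect) :=
  [/\ rl q <= rl p, rl p <= rr p, rr p <= rr q &
   [/\ rb q <= rb p, rb p <= rt p & rt p <= rt q]].

Definition rect_mem (q : rect) (x y : R) :=
  [/\ rl q <= x, x <= rr q, rb q <= y & y <= rt q].

Definition rect_size (q : rect) := (rr q - rl q) + (rt q - rb q).

Definition quarter_ll (q : rect) :=
  Rect (rl q) ((rl q + rr q) / 2) (rb q) ((rb q + rt q) / 2).
Definition quarter_lu (q : rect) :=
  Rect (rl q) ((rl q + rr q) / 2) ((rb q + rt q) / 2) (rt q).
Definition quarter_rl (q : rect) :=
  Rect ((rl q + rr q) / 2) (rr q) (rb q) ((rb q + rt q) / 2).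
Definition quarter_ru (q : rect) :=
  Rect ((rl q + rr q) / 2) (rr q) ((rb q + rt q) / 2) (rt q).

Section Steps.
Variable Phi : rect -> C.

Definition big_quarter (q : rect) : rect :=
  if normc (Phi q) / 4 <= normc (Phi (quarter_ll q)) then quarter_ll q else
  if normc (Phi q) / 4 <= normc (Phi (quarter_lu q)) then quarter_lu q else
  if normc (Phi q) / 4 <= normc (Phi (quarter_rl q)) then quarter_rl q else
  quarter_ru q.

Lemma big_quarter_sub (q : rect) : rl q <= rr q -> rb q <= rt q ->
  rect_sub (big_quarter q) q.
Proof.
move=> h1 h2; rewrite /big_quarter; do 3? [case: ifP => _];
  split => /=; try split => /=; lra.
Qed.

Lemma big_quarter_size (q : rect) :
  rr (big_quarter q) - rl (big_quarter q) = (rr q - rl q) / 2 /\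
  rt (big_quarter q) - rb (big_quarter q) = (rt q - rb q) / 2.
Proof.
rewrite /big_quarter; do 3? [case: ifP => _]; split => /=; lra.
Qed.

Lemma big_quarter_norm (q : rect) :
  Phi q = Phi (quarter_ll q) + Phi (quarter_lu q) + Phi (quarter_rl q) +
          Phi (quarter_ru q) ->
  normc (Phi q) / 4 <= normc (Phi (big_quarter q)).
Proof.
move=> qE; rewrite /big_quarter; case: ifP => // /negbT; rewrite -ltNge => h1.
case: ifP => // /negbT; rewrite -ltNge => h2.
case: ifP => // /negbT; rewrite -ltNge => h3.
rewrite leNgt; apply/negP => h4.
have := normcD (Phi (quarter_ll q) + Phi (quarter_lu q) + Phi (quarter_rl q))
  (Phi (quarter_ru q)).
have := normcD (Phi (quarter_ll q) + Phi (quarter_lu q)) (Phi (quarter_rl q)).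
have := normcD (Phi (quarter_ll q)) (Phi (quarter_lu q)).
rewrite -qE; lra.
Qed.

(** Bisection: a rectangle on which [Phi] is large relative to its squared size
    has a quarter with the same property, and the nested quarters shrink to a
    point where [Phi] is relatively small. *)
Lemma additive_rect_eq0 (Q : rect) : rl Q < rr Q -> rb Q < rt Q ->
  (forall q, rect_sub q Q ->
    Phi q = Phi (quarter_ll q) + Phi (quarter_lu q) + Phi (quarter_rl q) +
            Phi (quarter_ru q)) ->
  (forall x y, rect_mem Q x y -> forall e : R, 0 < e -> exists2 r : R, 0 < r &
    forall q, rect_sub q Q -> rect_mem q x y -> rect_size q < r ->
      normc (Phi q) <= e * rect_size q ^+ 2) ->
  Phi Q = 0.
Proof.
move=> lr bt addP locP; apply/eqP/negPn/negP => PhiQ.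
have Q0 : 0 < normc (Phi Q) by rewrite normc_gt0.
pose q n := iter n big_quarter Q.
have qS n : q n.+1 = big_quarter (q n) by [].
have sub n : rect_sub (q n) Q.
  elim: n => [|n [h1 h2 h3 [h4 h5 h6]]].
    by split; rewrite ?lexx//; try split; rewrite ?lexx// ltW.
  have [k1 k2 k3 [k4 k5 k6]] := big_quarter_sub h2 h5.
  by rewrite qS; split; try split => //; lra.
have step n : rect_sub (q n.+1) (q n).
  by have [_ h2 _ [_ h5 _]] := sub n; exact: big_quarter_sub.
have mono n m : rect_sub (q (m + n)%N) (q n).
  elim: m => [|m [h1 h2 h3 [h4 h5 h6]]].
    by have [_ h2 _ [_ h5 _]] := sub n; split; rewrite ?lexx//; split; rewrite ?lexx.
  rewrite addSn; have [k1 k2 k3 [k4 k5 k6]] := step (m + n)%N.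
  by split; try split => //; lra.
have size n : rect_size (q n) = rect_size Q / 2 ^+ n.
  elim: n => [|n ih]; first by rewrite expr0 divr1.
  have [h1 h2] := big_quarter_size (q n).
  rewrite /rect_size qS h1 h2 -mulrDl -/(rect_size (q n)) ih exprS invfM.
  by rewrite mulrA mulrAC.
have normq n : normc (Phi Q) / 4 ^+ n <= normc (Phi (q n)).
  elim: n => [|n ih]; first by rewrite expr0 divr1.
  have := big_quarter_norm (addP _ (sub n)); rewrite -qS.
  apply: le_trans; rewrite exprS invfM mulrA mulrAC ler_pM2r ?invr_gt0//.
have supx (f g : rect -> R) : (forall n m, f (q n) <= g (q m)) ->
    exists x, forall n, f (q n) <= x <= g (q n).
  move=> fg; exists (sup (range (f \o q))) => n; apply/andP; split.
    apply: ub_le_sup; last by exists n.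
    by exists (g (q 0%N)) => _ [m _ <-]; exact: fg.
  apply: ge_sup; first by exists (f (q 0%N)); exists 0%N.
  by move=> _ [m _ <-]; exact: fg.
have [x xP] : exists x, forall n, rl (q n) <= x <= rr (q n).
  apply: supx => n m; have [h1 h2 _ _] := mono n m.
  have [_ _ h4 _] := mono m n; rewrite [(n + m)%N]addnC in h4.
  exact: le_trans h1 (le_trans h2 h4).
have [y yP] : exists y, forall n, rb (q n) <= y <= rt (q n).
  apply: supx => n m; have [_ _ _ [h1 h2 _]] := mono n m.
  have [_ _ _ [_ _ h4]] := mono m n; rewrite [(n + m)%N]addnC in h4.
  exact: le_trans h1 (le_trans h2 h4).
have mem n : rect_mem (q n) x y.
  by have /andP[? ?] := xP n; have /andP[? ?] := yP n; split.
have s0 : 0 < rect_size Q by rewrite /rect_size; lra.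
pose k := normc (Phi Q) / rect_size Q ^+ 2.
have k0 : 0 < k by rewrite divr_gt0// exprn_gt0.
have [r r0 rP] := locP x y (mem 0%N) (k / 2) ltac:(lra).
have [n nr] : exists n, rect_size (q n) < r.
  have : (fun n => rect_size Q * (2^-1) ^+ n) @ \oo --> (0 : R).
    rewrite -[X in _ --> X](mulr0 (rect_size Q)); apply: cvgMr.
    by apply: cvg_expr; rewrite ger0_norm; lra.
  move/cvgrPdist_lt => /(_ _ r0)[N _ NP]; exists N.
  have := NP N (leqnn _); rewrite sub0r normrN size exprVn.
  by apply: le_lt_trans; rewrite ler_norm.
have := rP _ (sub n) (mem n) nr; have := normq n.
have sn0 : 0 < rect_size (q n) by rewrite size divr_gt0// exprn_gt0.
have -> : normc (Phi Q) / 4 ^+ n = k * rect_size (q n) ^+ 2.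
  rewrite size /k exprMn exprVn -exprM mulnC exprM.
  have -> : (2 : R) ^+ 2 = 4 by ring.
  by field; rewrite !expf_neq0//; lra.
have : 0 < k * rect_size (q n) ^+ 2 by rewrite mulr_gt0// exprn_gt0.
move: (normc _) (_ ^+ 2) => u v; rewrite [k / 2 * v]mulrAC.
move: (k * v) => w; lra.
Qed.

End Steps.
End Bisection.

(** * Goursat's theorem *)

Section Goursat.
Variable R : realType.
Local Notation C := (R[i]^o).
Local Notation leb := (@lebesgue_measure R).
Local Notation ci a b u := (Cint leb `[a, b]%classic u).
Local Notation ic := (Complex (0 : R) 1 : C).

Lemma complex_eq (x y : C) : complex.Re x = complex.Re y ->
  complex.Im x = complex.Im y -> x = y.
Proof. by case: x y => a b [c d] /= -> ->. Qed.

Definition pcont (u : R -> C) (x : R) := forall e : R, 0 < e ->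
  exists2 r : R, 0 < r & forall y, `|y - x| < r -> normc (u y - u x) < e.

Lemma pcont_comp (G : C -> C) (u : R -> C) (x : R) :
  pcont u x -> ccont G (u x) -> pcont (G \o u) x.
Proof.
move=> ux Gu e e0; have [r r0 rP] := Gu e e0; have [s s0 sP] := ux r r0.
by exists s => // y /sP /rP.
Qed.

Lemma pcont_Re (u : R -> C) (x : R) : pcont u x ->
  {for x, continuous (fun y => complex.Re (u y))}.
Proof.
move=> ux; apply/(@cvgrPdist_lt _ R) => e e0; have [r r0 rP] := ux e e0.
exists r => // y; rewrite /ball_/= distrC => /rP; apply: le_lt_trans.
by rewrite distrC -ReN -ReD normRe_le.
Qed.

Lemma pcont_Im (u : R -> C) (x : R) : pcont u x ->
  {for x, continuous (fun y => complex.Im (u y))}.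
Proof.
move=> ux; apply/(@cvgrPdist_lt _ R) => e e0; have [r r0 rP] := ux e e0.
exists r => // y; rewrite /ball_/= distrC => /rP; apply: le_lt_trans.
by rewrite distrC -ImN -ImD normIm_le.
Qed.

Lemma pcont_cintegrable (a b : R) (u : R -> C) :
  (forall x, a <= x <= b -> pcont u x) -> cintegrable leb `[a, b]%classic u.
Proof.
move=> ux; split; apply: continuous_compact_integrable => //;
  try exact: segment_compact; apply: continuous_in_subspaceT => x;
  rewrite inE /= in_itv /= => /ux.
  exact: pcont_Re.
exact: pcont_Im.
Qed.

Lemma Rint_split (a m b : R) (f : R -> R) : a <= m -> m <= b ->
  leb.-integrable `[a, b]%classic (EFin \o f) ->
  (\int[leb]_(x in `[a, b]) f x =
   \int[leb]_(x in `[a, m]) f x + \int[leb]_(x in `[m, b]) f x)%R.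
Proof.
move=> am mb iF.
have h := @Rintegral_itvB R f (BLeft a) (BRight b) m iF.
have h1 : (BLeft a <= BRight m)%O by rewrite bnd_simp.
have h2 : (BRight m <= BRight b)%O by rewrite bnd_simp.
have := h h1 h2; rewrite Rintegral_itv_obnd_cbnd.
  by move=> <-; rewrite addrC subrK.
apply: integrableS iF => //.
by apply: subset_itv; rewrite bnd_simp.
Qed.

Lemma ci_split (a m b : R) (u : R -> C) : a <= m -> m <= b ->
  (forall x, a <= x <= b -> pcont u x) ->
  ci a b u = ci a m u + ci m b u.
Proof.
move=> am mb /pcont_cintegrable[i1 i2].
by rewrite /Cint; simpc; rewrite (Rint_split am mb i1) (Rint_split am mb i2).
Qed.

Lemma mu_itv_fin (a b : R) : (leb `[a, b]%classic < +oo)%E.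
Proof. by rewrite lebesgue_measure_itv/=; case: ifP => _; rewrite ltry. Qed.

Lemma Rint_cst (a b c : R) : a <= b ->
  (\int[leb]_(x in `[a, b]) c = c * (b - a))%R.
Proof.
move=> ab; rewrite Rintegral_cst//= lebesgue_measure_itv/= lte_fin.
case: ltP => // ba; rewrite (_ : b - a = 0)//; lra.
Qed.

Lemma pcont_cst (c : C) x : pcont (fun=> c) x.
Proof. by move=> e e0; exists 1 => // y _; rewrite subrr normc0. Qed.

Lemma pcontB u v x : pcont u x -> pcont v x -> pcont (fun y => u y - v y) x.
Proof.
move=> pu pv e e0.
have [r r0 rP] := pu (e / 2) ltac:(lra).
have [s s0 sP] := pv (e / 2) ltac:(lra).
exists (Num.min r s); first by rewrite lt_min r0.
move=> y; rewrite lt_min => /andP[/rP h1 /sP h2].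
have -> : u y - v y - (u x - v x) = (u y - u x) - (v y - v x) by ring.
by apply: le_lt_trans (normcBD _ _) _; lra.
Qed.

Lemma ciB (a b : R) (u v : R -> C) :
  (forall x, a <= x <= b -> pcont u x) -> (forall x, a <= x <= b -> pcont v x) ->
  ci a b (fun x => u x - v x) = ci a b u - ci a b v.
Proof. by move=> pu pv; rewrite CintB//; exact: pcont_cintegrable. Qed.

Lemma ci_cst (a b : R) (c : C) : a <= b -> ci a b (fun=> c) = c * (b - a)%:C%C.
Proof. by case: c => x y ab; rewrite /Cint/= !Rint_cst//; simpc. Qed.

Lemma normc_ci_le (a b : R) (u : R -> C) (M : R) : a <= b ->
  (forall x, a <= x <= b -> pcont u x) ->
  (forall x, a <= x <= b -> normc (u x) <= M) ->
  normc (ci a b u) <= 2 * (M * (b - a)).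
Proof.
move=> ab /pcont_cintegrable iu uM; rewrite -Rint_cst//.
apply: normc_Cint_le => //.
  apply: (@bounded_integrable _ _ _ _ _ _ `|M|) => //.
  exact: mu_itv_fin.
Qed.

(** A function of two real variables which is differentiable in the complex
    variable [s + it], stated without identifying the plane with [R[i]]. *)
Definition gdiff (g : R -> R -> C) (s t : R) (b : C) := forall e : R, 0 < e ->
  exists2 r : R, 0 < r & forall s' t', `|s' - s| < r -> `|t' - t| < r ->
    normc (g s' t' - g s t - b * (Complex (s' - s) (t' - t))) <=
    e * (`|s' - s| + `|t' - t|).

Lemma gdiff_pcont g s t b : gdiff g s t b -> pcont (g s) t /\ pcont (g ^~ t) s.
Proof.
move=> gd; have [r r0 rP] := gd 1 ltr01.
have b0 := normc_ge0 b.
have k0 : 0 < normc b + 1 by rewrite ltr_wpDl.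
split=> e e0; exists (Num.min r (e / (normc b + 1)));
  rewrite ?lt_min ?r0 ?divr_gt0// => y; rewrite lt_min => /andP[yr ye].
- have := rP s y; rewrite subrr normr0 => /(_ r0 yr).
  have := normcD (g s y - g s t - b * Complex 0 (y - t)) (b * Complex 0 (y - t)).
  rewrite subrK normcM (_ : normc (Complex 0 (y - t)) = `|y - t|); last first.
    by rewrite /= expr0n add0r sqrtr_sqr.
  move=> h1 h2; apply: le_lt_trans h1 _.
  move: ye; rewrite ltr_pdivlMr//.
  have := normr_ge0 (y - t); lra.
- have := rP y t; rewrite subrr normr0 => /(_ yr r0).
  have := normcD (g y t - g s t - b * Complex (y - s) 0) (b * Complex (y - s) 0).
  rewrite subrK normcM (_ : normc (Complex (y - s) 0) = `|y - s|); last first.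
    by rewrite /= expr0n addr0 sqrtr_sqr.
  move=> h1 h2; apply: le_lt_trans h1 _.
  move: ye; rewrite ltr_pdivlMr//.
  have := normr_ge0 (y - s); lra.
Qed.

(** The integral of [g(w) dw] along the boundary of the rectangle. *)
Definition rect_integral (g : R -> R -> C) (q : rect R) : C :=
  ci (rb q) (rt q) (fun t => g (rr q) t - g (rl q) t) * ic -
  ci (rl q) (rr q) (fun s => g s (rt q) - g s (rb q)).

Section OnRectangle.
Variables (g : R -> R -> C) (Q : rect R).
Hypothesis gQ : forall s t, rect_mem Q s t -> exists b, gdiff g s t b.

Lemma rect_pcont_t s t : rect_mem Q s t -> pcont (g s) t.
Proof. by move=> /gQ[b /gdiff_pcont[]]. Qed.

Lemma rect_pcont_s s t : rect_mem Q s t -> pcont (g ^~ t) s.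
Proof. by move=> /gQ[b /gdiff_pcont[]]. Qed.

Lemma rect_integral_add q : rect_sub q Q ->
  rect_integral g q = rect_integral g (quarter_ll q) +
    rect_integral g (quarter_lu q) + rect_integral g (quarter_rl q) +
    rect_integral g (quarter_ru q).
Proof.
case: q => l r b t [/= Ql lr rQ [Qb bt tQ]]; rewrite /rect_integral/=.
set m := (l + r) / 2; set n := (b + t) / 2.
have lm : l <= m by rewrite /m; lra.
have mr : m <= r by rewrite /m; lra.
have bn : b <= n by rewrite /n; lra.
have nt : n <= t by rewrite /n; lra.
clearbody m n.
have pt x (y z : R) : l <= x <= r -> b <= y -> z <= t ->
    forall v, y <= v <= z -> pcont (g x) v.
  by move=> /andP[? ?] ? ? v /andP[? ?]; apply: rect_pcont_t; split; lra.
have ps x (y z : R) : b <= x <= t -> l <= y -> z <= r ->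
    forall v, y <= v <= z -> pcont (g ^~ x) v.
  by move=> /andP[? ?] ? ? v /andP[? ?]; apply: rect_pcont_s; split; lra.
have [xl xm xr] : [/\ l <= l <= r, l <= m <= r & l <= r <= r].
  by split; rewrite ?lexx ?lr ?lm ?mr.
have [yb yn yt] : [/\ b <= b <= t, b <= n <= t & b <= t <= t].
  by split; rewrite ?lexx ?bt ?bn ?nt.
rewrite !ciB; try by [apply: pt | apply: ps].
have -> : ci b t (g r) = ci b n (g r) + ci n t (g r).
  by apply: ci_split => //; apply: pt.
have -> : ci b t (g l) = ci b n (g l) + ci n t (g l).
  by apply: ci_split => //; apply: pt.
have -> : ci l r (g ^~ t) = ci l m (g ^~ t) + ci m r (g ^~ t).
  by apply: ci_split => //; apply: ps.
have -> : ci l r (g ^~ b) = ci l m (g ^~ b) + ci m r (g ^~ b).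
  by apply: ci_split => //; apply: ps.
clear; by ring.
Qed.

(** The affine part of [g] at the point [x + iy] contributes nothing to the
    boundary integral, and the remainder is at most a small multiple of the size,
    over a boundary of length comparable to the size. *)
Lemma rect_integral_small x y : rect_mem Q x y -> forall e : R, 0 < e ->
  exists2 r : R, 0 < r & forall q, rect_sub q Q -> rect_mem q x y ->
    rect_size q < r -> normc (rect_integral g q) <= e * rect_size q ^+ 2.
Proof.
move=> Qxy e e0; have [b gb] := gQ Qxy.
have [r r0 rP] := gb (e / 4) ltac:(lra).
exists r => // -[l r' b' t] [/= Ql lr rQ [Qb bt tQ]] [/= lx xr by' yt] szr.
rewrite /rect_size/= in szr.
pose S := (r' - l) + (t - b').
have S0 : 0 <= S by rewrite /S; lra.
have near s v : l <= s <= r' -> b' <= v <= t ->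
    normc (g s v - g x y - b * Complex (s - x) (v - y)) <= e / 4 * S.
  move=> /andP[h1 h2] /andP[h3 h4].
  have n1 : `|s - x| <= r' - l by rewrite ler_norml; lra.
  have n2 : `|v - y| <= t - b' by rewrite ler_norml; lra.
  apply: le_trans (rP s v _ _) _; try lra.
  by apply: ler_wpM2l; [rewrite divr_ge0// ltW|exact: lerD].
have pt s v : l <= s <= r' -> b' <= v <= t -> pcont (g s) v.
  move=> /andP[h1 h2] /andP[h3 h4]; apply: rect_pcont_t; split;
    [exact: le_trans h1|exact: le_trans rQ|exact: le_trans h3|exact: le_trans tQ].
have ps s v : l <= s <= r' -> b' <= v <= t -> pcont (g ^~ v) s.
  move=> /andP[h1 h2] /andP[h3 h4]; apply: rect_pcont_s; split;
    [exact: le_trans h1|exact: le_trans rQ|exact: le_trans h3|exact: le_trans tQ].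
have [sl sr] : l <= l <= r' /\ l <= r' <= r' by split; rewrite lr !lexx.
have [vb vt] : b' <= b' <= t /\ b' <= t <= t by split; rewrite bt !lexx.
have E1 : normc (ci b' t (fun v => g r' v - g l v - b * (r' - l)%:C%C)) <=
    2 * (e / 2 * S * (t - b')).
  apply: normc_ci_le => // v bv.
    by apply: pcontB; [apply: pcontB; exact: pt|exact: pcont_cst].
  have h1 := near r' v sr bv; have h2 := near l v sl bv.
  have -> : g r' v - g l v - b * (r' - l)%:C%C =
     (g r' v - g x y - b * Complex (r' - x) (v - y)) -
     (g l v - g x y - b * Complex (l - x) (v - y)).
    have -> : ((r' - l)%:C%C : C) = Complex (r' - x) (v - y) - Complex (l - x) (v - y).
      by apply: complex_eq; rewrite ?(ReD, ReN, ImD, ImN)/=; ring.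
    by ring.
  by apply: le_trans (normcBD _ _) _; lra.
have E2 : normc (ci l r' (fun s => g s t - g s b' - b * Complex 0 (t - b'))) <=
    2 * (e / 2 * S * (r' - l)).
  apply: normc_ci_le => // s ls.
    by apply: pcontB; [apply: pcontB; exact: ps|exact: pcont_cst].
  have h1 := near s t ls vt; have h2 := near s b' ls vb.
  have -> : g s t - g s b' - b * Complex 0 (t - b') =
     (g s t - g x y - b * Complex (s - x) (t - y)) -
     (g s b' - g x y - b * Complex (s - x) (b' - y)).
    have -> : (Complex 0 (t - b') : C) = Complex (s - x) (t - y) - Complex (s - x) (b' - y).
      by apply: complex_eq; rewrite ?(ReD, ReN, ImD, ImN)/=; ring.
    by ring.
  by apply: le_trans (normcBD _ _) _; lra.
rewrite ciB in E1; [|by move=> v bv; apply: pcontB; exact: pt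
                    |by move=> *; exact: pcont_cst].
rewrite ciB in E2; [|by move=> v bv; apply: pcontB; exact: ps
                    |by move=> *; exact: pcont_cst].
rewrite ci_cst// in E1; rewrite ci_cst// in E2.
pose I1 := ci b' t (fun v => g r' v - g l v).
pose I2 := ci l r' (fun s => g s t - g s b').
change (normc (rect_integral g (Rect l r' b' t)) <=
  e * rect_size (Rect l r' b' t) ^+ 2).
have -> : rect_integral g (Rect l r' b' t) = (I1 - b * (r' - l)%:C%C * (t - b')%:C%C) * ic -
    (I2 - b * Complex 0 (t - b') * (r' - l)%:C%C).
  have -> : (Complex 0 (t - b') : C) = (t - b')%:C%C * ic.
    by apply: complex_eq; rewrite ?(ReM, ImM)/=; ring.
  by rewrite /rect_integral/= -/I1 -/I2; ring.
apply: le_trans (normcBD _ _) _; rewrite normcM.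
have -> : normc ic = 1 by rewrite /= expr0n expr1n add0r sqrtr1.
rewrite mulr1; apply: le_trans (lerD E1 E2) _.
by rewrite /rect_size /S /=; lra.
Qed.

Lemma goursat_rect : rl Q < rr Q -> rb Q < rt Q -> rect_integral g Q = 0.
Proof.
move=> h1 h2; apply: additive_rect_eq0 => //.
  exact: rect_integral_add.
exact: rect_integral_small.
Qed.

End OnRectangle.
End Goursat.

(** * Circle means and the mean value property *)

Section CircleMean.
Variable R : realType.
Local Notation C := (R[i]^o).
Local Notation leb := (@lebesgue_measure R).
Local Notation ci a b u := (Cint leb `[a, b]%classic u).
Local Notation ic := (Complex (0 : R) 1 : C).

Definition circ (r t : R) : C := Complex (r * cos t) (r * sin t).

Lemma normc_circ r t : normc (circ r t) = `|r|.
Proof.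
by rewrite /= !exprMn -mulrDr cos2Dsin2 mulr1 sqrtr_sqr.
Qed.

Lemma circM r s t v : circ r t * circ s v = circ (r * s) (t + v).
Proof.
by apply: complex_eq; rewrite ?(ReM, ImM)/= ?cosD ?sinD; ring.
Qed.

Lemma circ0 t : circ 0 t = 0.
Proof. by rewrite /circ !mul0r. Qed.

Lemma circ_periodic r t : circ r (t + 2 * pi) = circ r t.
Proof.
have -> : 2 * pi = pi + pi :> R by ring.
by rewrite /circ addrA !cosDpi !sinDpi !opprK.
Qed.

Lemma real_derive (f : R -> R) (x d : R) : is_derive x 1 f d ->
  forall e, 0 < e -> exists2 r : R, 0 < r & forall y, `|y - x| < r ->
    `|f y - f x - d * (y - x)| <= e * `|y - x|.
Proof.
move=> [fz fd] e e0.
have : h^-1 *: (f (h *: (1 : R) + x) - f x) @[h --> (0 : R)^'] --> d.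
  by rewrite -fd; exact: fz.
move/cvgrPdist_le => /(_ e e0)[r /= r0 rP]; exists r => // y yr.
have [->|yx] := eqVneq y x; first by rewrite !subrr mulr0 subrr normr0 mulr0.
have yx0 : y - x != 0 by rewrite subr_eq0.
have := rP (y - x); rewrite /ball_/= sub0r normrN => /(_ yr yx0).
have -> : (y - x) *: (1 : R) + x = y by rewrite [_ *: _]mulr1 subrK.
rewrite [_ *: _]/(_ * _) => H.
have -> : f y - f x - d * (y - x) = - ((y - x) * (d - (y - x)^-1 * (f y - f x))).
  by field.
by rewrite normrN normrM mulrC ler_wpM2r.
Qed.

(** The derivative of the complex exponential at 0, obtained from those of the
    real exponential, cosine and sine. *)
Lemma circ_expansion (e : R) : 0 < e -> exists2 r : R, 0 < r &
  forall s t, `|s| < r -> `|t| < r ->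
    normc (circ (expR s) t - 1 - Complex s t) <= e * (`|s| + `|t|).
Proof.
move=> e0; pose k := Num.min 1 e / 8.
have k0 : 0 < k by rewrite /k divr_gt0// lt_min ltr01.
have k1 : k <= 1 / 8 by rewrite /k ler_pM2r ?invr_gt0// ge_min lexx.
have ke : k <= e / 8 by rewrite /k ler_pM2r ?invr_gt0// ge_min lexx orbT.
have [r1 r10 r1P] := real_derive (@is_derive_expR R 0) k0.
have [r2 r20 r2P] := real_derive (@is_derive_cos R 0) k0.
have [r3 r30 r3P] := real_derive (@is_derive_sin R 0) k0.
exists (Num.min (Num.min r1 k) (Num.min r2 r3)).
  by rewrite !lt_min r10 k0 r20 r30.
move=> s t; rewrite !lt_min => /andP[/andP[s1 sk] _] /andP[_ /andP[t2 t3]].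
have := r1P s; rewrite subr0 expR0 mul1r => /(_ s1) h1.
have := r2P t; rewrite subr0 cos0 sin0 oppr0 mul0r subr0 => /(_ t2) h2.
have := r3P t; rewrite subr0 sin0 cos0 mul1r subr0 => /(_ t3) h3.
have n1 : `|expR s - 1| <= 2 * `|s|.
  have -> : expR s - 1 = (expR s - 1 - s) + s by ring.
  apply: le_trans (ler_normD _ _) _.
  have : k * `|s| <= 1 / 8 * `|s| by rewrite ler_wpM2r.
  by have := normr_ge0 s; lra.
have e2 : expR s <= 2.
  have : expR s - 1 <= 2 * `|s| by apply: le_trans n1; exact: ler_norm.
  lra.
have es0 := expR_gt0 s.
apply: le_trans (normc_leD _) _; rewrite !(ReD, ReN, ImD, ImN)/= subr0.
have c1 : `|expR s * cos t - 1 - s| <= 2 * (k * `|t|) + k * `|s|.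
  have -> : expR s * cos t - 1 - s = expR s * (cos t - 1) + (expR s - 1 - s) by ring.
  apply: le_trans (ler_normD _ _) _; apply: lerD => //.
  by rewrite normrM; apply: ler_pM => //; rewrite ger0_norm// ltW.
have c2 : `|expR s * sin t - t| <= 2 * (k * `|t|) + 2 * k * `|t|.
  have -> : expR s * sin t - t = expR s * (sin t - t) + (expR s - 1) * t by ring.
  apply: le_trans (ler_normD _ _) _; apply: lerD => //.
    by rewrite normrM; apply: ler_pM => //; rewrite ger0_norm// ltW.
  rewrite normrM; apply: ler_wpM2r => //; lra.
apply: le_trans (lerD c1 c2) _.
have : k * `|t| <= e / 8 * `|t| by rewrite ler_wpM2r.
have : k * `|s| <= e / 8 * `|s| by rewrite ler_wpM2r.
have : 0 <= e * `|t| by rewrite mulr_ge0// ltW.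
have : 0 <= e * `|s| by rewrite mulr_ge0// ltW.
by clearbody k; lra.
Qed.

(** Polar coordinates turn a function differentiable on an annulus into one
    differentiable on a strip, with period [2 pi]. *)
Lemma gdiff_polar (G : C -> C) (s t : R) (d : C) :
  cdiff G (circ (expR s) t) d ->
  gdiff (fun s t => G (circ (expR s) t)) s t (d * circ (expR s) t).
Proof.
move=> Gd e e0; set z := circ (expR s) t in Gd *.
have z0 := normc_ge0 z; have d0 := normc_ge0 d.
pose k := e / (2 * (normc z + 1) + 2 * (normc d * normc z + 1)).
have D0 : 0 < 2 * (normc z + 1) + 2 * (normc d * normc z + 1).
  have h : 0 <= normc d * normc z by rewrite mulr_ge0.
  lra.
have k0 : 0 < k by rewrite divr_gt0.
have kE : k * (2 * (normc z + 1) + 2 * (normc d * normc z + 1)) = e.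
  by rewrite /k divfK// lt0r_neq0.
have [r1 r10 r1P] := Gd k k0.
have [r2 r20 r2P] := circ_expansion k0.
have [r3 r30 r3P] := circ_expansion ltr01.
pose r4 := r1 / (4 * (normc z + 1)).
have r40 : 0 < r4 by rewrite divr_gt0// mulr_gt0//; lra.
exists (Num.min (Num.min r2 r3) r4); first by rewrite !lt_min r20 r30.
move=> s' t'; rewrite !lt_min => /andP[/andP[s2 s3] s4] /andP[/andP[t2 t3] t4].
set S := `|s' - s| + `|t' - t|.
have S0 : 0 <= S by rewrite /S addr_ge0.
set z' := circ (expR s') t'.
set D : C := Complex (s' - s) (t' - t).
have z'E : z' = z * circ (expR (s' - s)) (t' - t).
  by rewrite circM -expRD; congr circ; [congr expR|]; ring.
have DS : normc D <= S by exact: normc_leD.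
have h2 : normc (z' - z - z * D) <= normc z * (k * S).
  have -> : z' - z - z * D = z * (circ (expR (s' - s)) (t' - t) - 1 - D).
    by rewrite z'E; ring.
  by rewrite normcM ler_wpM2l//; exact: r2P.
have h3 : normc (z' - z) <= normc z * (2 * S).
  have -> : z' - z = z * ((circ (expR (s' - s)) (t' - t) - 1 - D) + D).
    by rewrite z'E; ring.
  rewrite normcM ler_wpM2l//; apply: le_trans (normcD _ _) _.
  have := r3P _ _ s3 t3; rewrite -/D -/S; lra.
have zr : normc (z' - z) < r1.
  have r1E : r1 = normc z * (4 * r4) + 4 * r4.
    by rewrite /r4; field; rewrite lt0r_neq0//; lra.
  apply: le_lt_trans h3 _; rewrite r1E.
  apply: (@le_lt_trans _ _ (normc z * (4 * r4))); last by rewrite ltrDl mulr_gt0.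
  by apply: ler_wpM2l => //; rewrite /S; lra.
have h1 := r1P z' zr.
have -> : G z' - G z - d * z * D = (G z' - G z - d * (z' - z)) + d * (z' - z - z * D).
  by ring.
apply: le_trans (normcD _ _) _; rewrite normcM.
have h4 : k * normc (z' - z) <= k * (normc z * (2 * S)) by rewrite ler_pM2l.
have h5 : normc d * normc (z' - z - z * D) <= normc d * (normc z * (k * S)).
  by rewrite ler_wpM2l.
apply: le_trans (lerD h1 h5) _; apply: le_trans (lerD h4 (lexx _)) _.
rewrite -kE.
have -> : k * (normc z * (2 * S)) + normc d * (normc z * (k * S)) =
  k * S * (2 * normc z + normc d * normc z) by ring.
have -> : k * (2 * (normc z + 1) + 2 * (normc d * normc z + 1)) * S =
  k * S * (2 * (normc z + 1) + 2 * (normc d * normc z + 1)) by ring.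
apply: ler_wpM2l; first by rewrite mulr_ge0// ltW.
have : 0 <= normc d * normc z by rewrite mulr_ge0.
lra.
Qed.

Lemma pcont_circ r t : pcont (circ r) t.
Proof.
move=> e e0.
have cd : {for t, continuous (fun t => r * cos t)}.
  by apply: cvgM; [exact: cvg_cst|exact: continuous_cos].
have sd : {for t, continuous (fun t => r * sin t)}.
  by apply: cvgM; [exact: cvg_cst|exact: continuous_sin].
have e2 : 0 < e / 2 by lra.
move/cvgrPdist_lt : cd => /(_ _ e2)[r1 r10 r1P].
move/cvgrPdist_lt : sd => /(_ _ e2)[r2 r20 r2P].
exists (Num.min r1 r2); first by rewrite lt_min r10.
move=> y; rewrite lt_min => /andP[y1 y2].
apply: le_lt_trans (normc_leD _) _; rewrite !(ReD, ReN, ImD, ImN)/=.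
have := r1P y; rewrite /ball_/= distrC => /(_ y1).
have := r2P y; rewrite /ball_/= distrC => /(_ y2).
rewrite distrC [X in _ -> X < _ -> _]distrC; lra.
Qed.

Definition circle_mean (G : C -> C) (r : R) : C :=
  ((2 * pi)^-1)%:C%C * ci 0 (2 * pi) (fun t => G (circ r t)).

Lemma pi2_gt0 : 0 < 2 * pi :> R.
Proof. by rewrite mulr_gt0// pi_gt0. Qed.

(** Cauchy's theorem on an annulus: in logarithmic coordinates the annulus is a
    rectangle, and the two radial sides cancel by periodicity. *)
Lemma circle_mean_annulus (G : C -> C) (r1 r2 : R) : 0 < r1 -> r1 < r2 ->
  (forall z, r1 <= normc z <= r2 -> exists d, cdiff G z d) ->
  circle_mean G r1 = circle_mean G r2.
Proof.
move=> r10 r12 Gd; rewrite /circle_mean; congr (_ * _).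
have r20 : 0 < r2 by exact: lt_trans r12.
pose g s t := G (circ (expR s) t).
pose Q := Rect (ln r1) (ln r2) 0 (2 * pi).
have gQ s t : rect_mem Q s t -> exists b, gdiff g s t b.
  move=> [/= s1 s2 _ _]; have [|d dP] := Gd (circ (expR s) t).
    rewrite normc_circ ger0_norm ?expR_ge0//.
    by rewrite -{1}(@lnK _ r1) ?posrE// -{1}(@lnK _ r2) ?posrE// !ler_expR s1.
  by exists (d * circ (expR s) t); exact: gdiff_polar.
have ln12 : ln r1 < ln r2 by rewrite ltr_ln.
have p0 := pi2_gt0.
have := goursat_rect gQ ln12 p0; rewrite /rect_integral/=.
have -> : (fun s => g s (2 * pi) - g s 0) = (fun=> 0).
  apply/funext => s; rewrite /g -[2 * pi]add0r circ_periodic subrr//.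
rewrite ci_cst ?(ltW ln12)// mul0r subr0 ciB.
- move/eqP; rewrite mulf_eq0 => /orP[|].
    rewrite subr_eq0 => /eqP; rewrite /g !lnK ?posrE//.
  by rewrite eq_complex/= oner_eq0 andbF.
- by move=> x /andP[? ?]; apply: (rect_pcont_t gQ); split => //=; rewrite ?lexx ?ltW.
- by move=> x /andP[? ?]; apply: (rect_pcont_t gQ); split => //=; rewrite ?lexx ?ltW.
Qed.

Lemma circ_cintegrable (G : C -> C) (r : R) :
  (forall t, ccont G (circ r t)) ->
  cintegrable leb `[0, 2 * pi]%classic (fun t => G (circ r t)).
Proof.
move=> Gc; apply: pcont_cintegrable => t _.
by apply: (pcont_comp (pcont_circ r t)).
Qed.

Lemma circle_mean_cvg (G : C -> C) (B r : R) (rn : nat -> R) :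
  (forall z, disk z -> ccont G z) -> (forall z, disk z -> normc (G z) <= B) ->
  (forall n, 0 <= rn n < 1) -> 0 <= r < 1 -> rn @ \oo --> r ->
  (fun n => circle_mean G (rn n)) @ \oo --> circle_mean G r.
Proof.
move=> Gc GB rn1 r1 rnr.
have dk s t : 0 <= s < 1 -> disk (circ s t).
  by move=> /andP[s0 s1]; apply/diskP; rewrite normc_circ ger0_norm.
have h : (fun n => ci 0 (2 * pi) (fun t => G (circ (rn n) t))) @ \oo -->
    ci 0 (2 * pi) (fun t => G (circ r t)).
  apply: (@Cint_dominated_cvg _ _ _ _ _ _ _ (fun=> B)) => //.
  - move=> n; apply/cintegrable_meas/circ_cintegrable => t.
    by apply: Gc; exact: dk.
  - move=> t _; apply/cvg_normcP => e e0.
    have [d d0 dP] := Gc _ (dk r t r1) e e0.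
    move/cvgrPdist_lt : rnr => /(_ _ d0)[N _ NP]; exists N => n /NP /= rnd.
    apply: dP.
    have -> : circ (rn n) t - circ r t = circ (rn n - r) t.
      by apply: complex_eq; rewrite ?(ReD, ReN, ImD, ImN)/=; ring.
    by rewrite normc_circ distrC.
  - apply: (@bounded_integrable _ _ _ _ _ _ `|B|) => //.
    exact: mu_itv_fin.
  - by move=> n t _; apply: GB; exact: dk.
apply/cvg_normcP => e e0.
have p0 := pi2_gt0.
move/cvg_normcP : h => /(_ (e * (2 * pi)) (mulr_gt0 e0 p0))[N NP].
exists N => n /NP h; rewrite /circle_mean -mulrBr normcM normcR ger0_norm ?invr_ge0 ?ltW//.
by rewrite ltr_pdivrMl// [2 * pi * e]mulrC.
Qed.

Lemma circle_mean0 (G : C -> C) : circle_mean G 0 = G 0.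
Proof.
rewrite /circle_mean.
have -> : (fun t => G (circ 0 t)) = (fun=> G 0) by apply/funext => t; rewrite circ0.
have p0 := pi2_gt0.
rewrite ci_cst ?(ltW p0)// subr0 mulrCA -rmorphM mulVf ?mulr1//.
exact: lt0r_neq0.
Qed.

(** The mean value property, tolerating one point at which [G] is only known to
    be continuous: the means are constant on either side of that point's
    circle, and they depend continuously on the radius. *)
Lemma circle_mean_value (G : C -> C) (B : R) (z : C) (r : R) :
  (forall w, disk w -> ccont G w) -> (forall w, disk w -> normc (G w) <= B) ->
  (forall w, disk w -> w != z -> exists d, cdiff G w d) ->
  0 < r < 1 -> circle_mean G r = G 0.
Proof.
move=> Gc GB Gd /andP[r0 r1].
have const r1' r2' : 0 < r1' -> r1' <= r2' -> r2' < 1 ->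
    (r2' < normc z) || (normc z < r1') ->
    circle_mean G r1' = circle_mean G r2'.
  rewrite le_eqVlt => h1 /orP[/eqP-> //|h2] h3 h4.
  apply: circle_mean_annulus => // w /andP[w1 w2]; apply: Gd.
    by apply/diskP; exact: le_lt_trans h3.
  apply/eqP => wz; move: h4 w1 w2; rewrite wz => /orP[]; lra.
have lim_left (a : R) (rn : nat -> R) (c : C) : 0 <= a < 1 -> rn @ \oo --> a ->
    (forall n, 0 <= rn n < 1) -> (forall n, circle_mean G (rn n) = c) ->
    circle_mean G a = c.
  move=> a1 rna rn1 rnc.
  have := circle_mean_cvg Gc GB rn1 a1 rna.
  under eq_fun do rewrite rnc.
  move=> h; apply: cvgc_unique h _; exact: cvg_cst.
have harm (c a : R) : (fun n : nat => a + c * n.+1%:R^-1) @ \oo --> a.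
  rewrite -[X in _ --> X]addr0; apply: cvgD; first exact: cvg_cst.
  by rewrite -[X in _ --> X](mulr0 c); apply: cvgMr; exact: cvg_harmonic.
have h01 n : 0 < (n.+1%:R^-1 : R) <= 1.
  by rewrite invr_gt0 ltr0n/= invf_le1 ?ltr0n// ler1n.
have scal (c : R) n : 0 < c -> 0 < c * n.+1%:R^-1 <= c.
  move=> c0; have /andP[h1 h2] := h01 n.
  by rewrite mulr_gt0//= ler_piMr// ltW.
have below s : 0 < s -> s < 1 -> s < normc z -> circle_mean G s = G 0.
  move=> s0 s1 sz; rewrite -circle_mean0; apply/esym.
  apply: (lim_left 0 (fun n => 0 + s * n.+1%:R^-1)) => //.
  - by rewrite lexx ltr01.
  - move=> n; have /andP[h1 h2] := h01 n; rewrite add0r mulr_ge0 ?ltW//=.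
    by apply: le_lt_trans s1; rewrite ler_piMr// ltW.
  - move=> n; have /andP[h1 h2] := h01 n; rewrite add0r; apply: const => //.
    + by rewrite mulr_gt0.
    + by rewrite ler_piMr// ltW.
    + by rewrite sz.
have at_z : normc z < 1 -> circle_mean G (normc z) = G 0.
  move=> z1; have := normc_ge0 z; rewrite le_eqVlt => /orP[/eqP<-|z0].
    exact: circle_mean0.
  apply: (lim_left _ (fun n => normc z + (- (normc z / 2)) * n.+1%:R^-1)) => //.
  - by rewrite (ltW z0).
  - move=> n; have /andP[h1 h2] := scal (normc z / 2) n ltac:(lra).
    by rewrite mulNr; move: (_ / n.+1%:R) h1 h2 => p h1 h2; apply/andP; split; lra.
  - move=> n; have /andP[h1 h2] := scal (normc z / 2) n ltac:(lra).
    by rewrite mulNr; move: (_ / n.+1%:R) h1 h2 => p h1 h2; apply: below; lra.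
have [rz|zr|rz] := ltgtP r (normc z); first exact: below.
  have z1 := lt_trans zr r1; rewrite -(at_z z1); apply/esym.
  have z0 := normc_ge0 z.
  apply: (lim_left _ (fun n => normc z + (r - normc z) * n.+1%:R^-1)) => //.
  - by rewrite z0.
  - move=> n; have /andP[h1 h2] := scal (r - normc z) n ltac:(lra).
    move: (_ / n.+1%:R) h1 h2 => p h1 h2; by apply/andP; split; lra.
  - move=> n; have /andP[h1 h2] := scal (r - normc z) n ltac:(lra).
    move: (_ / n.+1%:R) h1 h2 => p h1 h2; by apply: const => //; try lra; apply/orP; right; lra.
by rewrite rz; apply: at_z; rewrite -rz.
Qed.

End CircleMean.

Section CircleAlgebra.
Variable R : realType.
Local Notation C := (R[i]^o).
Local Notation leb := (@lebesgue_measure R).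
Local Notation ci a b u := (Cint leb `[a, b]%classic u).
Implicit Types (G H : C -> C) (z : C).

Lemma cderivable_cst (c : C) z : derivable (fun=> c : C) z 1.
Proof. exact: derivable_cst. Qed.

Lemma cderivable_id z : derivable (fun w : C => w) z 1.
Proof. exact: derivable_id. Qed.

Lemma cderivableD G H z : derivable G z 1 -> derivable H z 1 ->
  derivable (fun w => G w + H w) z 1.
Proof. exact: derivableD. Qed.

Lemma cderivableB G H z : derivable G z 1 -> derivable H z 1 ->
  derivable (fun w => G w - H w) z 1.
Proof. exact: derivableB. Qed.

Lemma cderivableM G H z : derivable G z 1 -> derivable H z 1 ->
  derivable (fun w => G w * H w) z 1.
Proof. exact: (@derivableM (R[i]) C). Qed.

Lemma cderivableV G z : G z != 0 -> derivable G z 1 ->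
  derivable (fun w => (G w)^-1) z 1.
Proof. exact: (@derivableV (R[i]) C). Qed.

Lemma cderivableX G n z : derivable G z 1 -> derivable (fun w => G w ^+ n) z 1.
Proof.
move=> Gz; elim: n => [|n ih].
  by under eq_fun do rewrite expr0; exact: cderivable_cst.
by under eq_fun do rewrite exprS; exact: cderivableM.
Qed.

Lemma cderivable_sum (F : nat -> C -> C) n z : (forall k, derivable (F k) z 1) ->
  derivable (fun w => \sum_(0 <= k < n) F k w) z 1.
Proof.
move=> Fz; elim: n => [|n ih].
  by under eq_fun do rewrite big_nil; exact: cderivable_cst.
have -> : (fun w => \sum_(0 <= k < n.+1) F k w) =
    (fun w => \sum_(0 <= k < n) F k w + F n w).
  by apply/funext => w; rewrite big_nat_recr.
exact: (cderivableD ih (Fz n)).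
Qed.

Lemma cderivable_cdiff G z : derivable G z 1 -> exists d, cdiff G z d.
Proof. by move=> /derivable_cdiff Gz; exists (derive1 G z). Qed.

Lemma cderivable_ccont G z : derivable G z 1 -> ccont G z.
Proof. by move=> /derivable_cdiff/cdiff_ccont. Qed.

Variables (r : R) (r_gt0 : 0 < r).

Definition circ_diff G := forall z, normc z = r -> derivable G z 1.

Lemma circ_diff_cintegrable G : circ_diff G ->
  cintegrable leb `[0, 2 * pi]%classic (fun t => G (circ r t)).
Proof.
move=> Gd; apply: circ_cintegrable => t; apply: cderivable_ccont; apply: Gd.
by rewrite normc_circ gtr0_norm.
Qed.

Lemma circle_meanD G H : circ_diff G -> circ_diff H ->
  circle_mean (fun z => G z + H z) r = circle_mean G r + circle_mean H r.
Proof.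
move=> Gd Hd; rewrite /circle_mean -mulrDr; congr (_ * _).
by rewrite CintD//; exact: circ_diff_cintegrable.
Qed.

Lemma circle_meanB G H : circ_diff G -> circ_diff H ->
  circle_mean (fun z => G z - H z) r = circle_mean G r - circle_mean H r.
Proof.
move=> Gd Hd; rewrite /circle_mean -mulrBr; congr (_ * _).
by rewrite CintB//; exact: circ_diff_cintegrable.
Qed.

Lemma circle_meanZ (c : C) G : circ_diff G ->
  circle_mean (fun z => c * G z) r = c * circle_mean G r.
Proof.
move=> Gd; rewrite /circle_mean mulrCA; congr (_ * _).
by rewrite CintZ//; exact: circ_diff_cintegrable.
Qed.

Lemma circle_mean_sum (F : nat -> C -> C) n : (forall k, circ_diff (F k)) ->
  circle_mean (fun z => \sum_(0 <= k < n) F k z) r =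
  \sum_(0 <= k < n) circle_mean (F k) r.
Proof.
move=> Fd; rewrite /circle_mean -mulr_sumr; congr (_ * _).
by rewrite Cint_sum// => k; exact: circ_diff_cintegrable.
Qed.

Lemma eq_circle_mean G H : (forall z, normc z = r -> G z = H z) ->
  circle_mean G r = circle_mean H r.
Proof.
move=> GH; rewrite /circle_mean; congr (_ * _); apply: eq_Cint => t _.
by apply: GH; rewrite normc_circ gtr0_norm.
Qed.

Lemma normc_circle_mean_le G (M : R) : circ_diff G ->
  (forall z, normc z = r -> normc (G z) <= M) ->
  normc (circle_mean G r) <= 2 * M.
Proof.
move=> Gd GM; have p0 := pi2_gt0 R.
rewrite /circle_mean normcM normcR ger0_norm ?invr_ge0 ?(ltW p0)//.
rewrite ler_pdivrMl//.
have -> : 2 * pi * (2 * M) = 2 * (M * (2 * pi - 0)) by rewrite subr0; ring.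
apply: normc_ci_le => [|t _|t _]; first exact: ltW.
  apply: (pcont_comp (pcont_circ r t)); apply: cderivable_ccont; apply: Gd.
  by rewrite normc_circ gtr0_norm.
by apply: GM; rewrite normc_circ gtr0_norm.
Qed.

Lemma circle_mean_cst (c : C) : circle_mean (fun=> c) r = c.
Proof. exact: (circle_mean0 (fun=> c)). Qed.

End CircleAlgebra.

Section Orthogonality.
Variable R : realType.
Local Notation C := (R[i]^o).

Lemma normc_gt0_neq (r : R) (z : C) : 0 < r -> normc z = r -> z != 0.
Proof. by move=> r0 zr; rewrite -normc_gt0 zr. Qed.

Lemma circle_mean_radius (G : C -> C) (r s : R) : 0 < r -> 0 < s ->
  (forall z, Num.min r s <= normc z <= Num.max r s -> derivable G z 1) ->
  circle_mean G r = circle_mean G s.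
Proof.
have lt_case (a b : R) : 0 < a -> a < b ->
    (forall z, a <= normc z <= b -> derivable G z 1) ->
    circle_mean G a = circle_mean G b.
  move=> a0 ab Gd; apply: circle_mean_annulus => // z /Gd.
  exact: cderivable_cdiff.
move=> r0 s0; have [rs|sr|->] := ltgtP r s => // Gd.
  exact: lt_case.
by apply/esym; exact: lt_case.
Qed.

(** The mean of a monomial does not depend on the radius, and it is small on
    small circles (positive exponents) or on large ones (negative exponents). *)
Lemma circle_mean_orthogonal (k l : nat) (r : R) : 0 < r ->
  circle_mean (fun z => z ^+ k / z ^+ l) r = (k == l)%:R.
Proof.
move=> r0.
have dkl z : z != 0 -> derivable (fun z : C => z ^+ k / z ^+ l) z 1.
  move=> z0; apply: cderivableM.
    by apply: cderivableX; exact: cderivable_id.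
  apply: cderivableV; first by rewrite expf_neq0.
  by apply: cderivableX; exact: cderivable_id.
have indep s : 0 < s -> circle_mean (fun z => z ^+ k / z ^+ l) r =
    circle_mean (fun z => z ^+ k / z ^+ l) s.
  move=> s0; apply: circle_mean_radius => // z /andP[zm _]; apply: dkl.
  by rewrite -normc_gt0; apply: lt_le_trans zm; rewrite lt_min r0.
have bound s : 0 < s -> normc (circle_mean (fun z => z ^+ k / z ^+ l) r) <=
    2 * (s ^+ k / s ^+ l).
  move=> s0; rewrite (indep s s0); apply: normc_circle_mean_le => //.
    by move=> z /(normc_gt0_neq s0); exact: dkl.
  by move=> z zs; rewrite normcM normcV !normcX zs.
have zero : (forall e, 0 < e -> exists2 s : R, 0 < s & s ^+ k / s ^+ l <= e) ->
    circle_mean (fun z => z ^+ k / z ^+ l) r = 0.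
  move=> small; apply/eqP; rewrite -normc_eq0 eq_le normc_ge0 andbT.
  apply/ler_addgt0Pr => e e0; rewrite add0r.
  have [s s0 sP] := small (e / 2) ltac:(lra).
  by apply: le_trans (bound s s0) _; lra.
have [kl|lk|->] := ltngtP k l.
- apply: zero => e e0; exists (1 + e^-1).
    by rewrite addr_gt0// invr_gt0.
  have s1 : 1 <= 1 + e^-1 by rewrite lerDl invr_ge0 ltW.
  have s0 : 0 < 1 + e^-1 by exact: lt_le_trans s1.
  rewrite -(subnK (ltnW kl)) exprD invfM mulrCA mulfV ?mulr1; last first.
    by rewrite expf_neq0// lt0r_neq0.
  rewrite -[leRHS]invrK lef_pV2 ?posrE ?exprn_gt0 ?invr_gt0//.
  apply: (@le_trans _ _ (1 + e^-1)); first by rewrite lerDr.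
  by rewrite -{1}[1 + e^-1]expr1 ler_weXn2l// subn_gt0.
- apply: zero => e e0; exists (Num.min 1 e); first by rewrite lt_min ltr01.
  have s0 : 0 < Num.min 1 e by rewrite lt_min ltr01.
  rewrite -(subnK (ltnW lk)) exprD mulfK ?expf_neq0// ?lt0r_neq0//.
  apply: (@le_trans _ _ (Num.min 1 e)); last by rewrite ge_min lexx orbT.
  rewrite -{2}[Num.min 1 e]expr1; apply: ler_wiXn2l; last by rewrite subn_gt0.
    exact: ltW.
  by rewrite ge_min lexx.
- rewrite -[RHS](circle_mean_cst r 1); apply: eq_circle_mean => // z /(normc_gt0_neq r0) z0.
  by rewrite mulfV// expf_neq0.
Qed.

End Orthogonality.

(** * Cauchy's formula for the Taylor coefficients *)

Section CauchyCoefficients.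
Variable R : realType.
Local Notation C := (R[i]^o).

Lemma geometric_cvg0 (K x : R) : 0 <= x < 1 ->
  (fun n => K * x ^+ n) @ \oo --> (0 : R).
Proof.
move=> /andP[x0 x1]; rewrite -[X in _ --> X](mulr0 K); apply: cvgMr.
by apply: cvg_expr; rewrite ger0_norm.
Qed.

Lemma geometric_kernel (w z : C) n : w != 0 -> w != z ->
  w / (w - z) = \sum_(0 <= k < n) z ^+ k / w ^+ k +
    z ^+ n / w ^+ n * (w / (w - z)).
Proof.
move=> w0 wz; have wz0 : w - z != 0 by rewrite subr_eq0.
elim: n => [|n ih]; first by rewrite big_nil add0r !expr0 divr1 mul1r.
rewrite [LHS]ih big_nat_recr//= -addrA; congr (_ + _).
have wn : w ^+ n != 0 by rewrite expf_neq0.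
by rewrite !exprS; field; rewrite wn wz0.
Qed.

Lemma circle_mean_comb (r : R) (c : C) (G A E T : C -> C) : 0 < r ->
  circ_diff r A -> circ_diff r E -> circ_diff r T ->
  (forall w : C, normc w = r -> G w = A w - c * E w + T w) ->
  circle_mean G r = circle_mean A r - c * circle_mean E r + circle_mean T r.
Proof.
move=> r0 Ad Ed Td /(eq_circle_mean r0) ->.
have cEd : circ_diff r (fun w => c * E w).
  by move=> w /Ed; apply: cderivableM; exact: cderivable_cst.
have ABd : circ_diff r (fun w => A w - c * E w).
  by move=> w wr; apply: cderivableB; [exact: Ad|exact: cEd].
have e1 := circle_meanD r0 ABd Td.
have e2 := circle_meanB r0 Ad cEd.
have e3 := circle_meanZ r0 c Ed.
by rewrite e1 e2 e3.
Qed.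

Variables (f : C -> C) (M : R).
Hypothesis fa : analytic f.
Hypothesis fM : forall z, disk z -> normc (f z) <= M.

(** Any radius in ]0, 1[ gives the same value, by [cauchy_coefE]. *)
Definition cauchy_coef k := circle_mean (fun z => f z / z ^+ k) (1 / 2).

Lemma bound_ge0 : 0 <= M.
Proof. exact: le_trans (normc_ge0 _) (fM (disk0 R)). Qed.

Lemma derivable_over_power k (z : C) : z != 0 -> disk z ->
  derivable (fun z => f z / z ^+ k) z 1.
Proof.
move=> z0 z1; apply: cderivableM; first exact: fa.
apply: cderivableV; first by rewrite expf_neq0.
by apply: cderivableX; exact: cderivable_id.
Qed.

Lemma cauchy_coefE r k : 0 < r < 1 ->
  circle_mean (fun z => f z / z ^+ k) r = cauchy_coef k.
Proof.
move=> /andP[r0 r1]; apply: circle_mean_radius => //.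
move=> z /andP[z0 z1]; apply: derivable_over_power.
  by rewrite -normc_gt0; apply: lt_le_trans z0; rewrite lt_min r0; lra.
by apply/diskP; apply: le_lt_trans z1 _; rewrite gt_max r1; lra.
Qed.

Lemma circ_diff_over_power r k : 0 < r < 1 ->
  circ_diff r (fun z => f z / z ^+ k).
Proof.
move=> /andP[r0 r1] z zr; apply: derivable_over_power.
  exact: normc_gt0_neq zr.
by apply/diskP; rewrite zr.
Qed.

Lemma circle_mean_times_power r k : 0 < r < 1 -> (0 < k)%N ->
  circle_mean (fun z => f z * z ^+ k) r = 0.
Proof.
move=> r01 k0.
have Gd w : disk w -> derivable (fun z => f z * z ^+ k) w 1.
  move=> w1; apply: cderivableM; first exact: fa.
  by apply: cderivableX; exact: cderivable_id.
rewrite (@circle_mean_value _ _ M 0)//.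
- by rewrite expr0n eqn0Ngt k0 mulr0.
- by move=> w /Gd /cderivable_ccont.
- move=> w w1; rewrite normcM normcX -[leRHS]mulr1.
  apply: ler_pM; rewrite ?exprn_ge0 ?normc_ge0 ?fM//.
  by rewrite exprn_ile1 ?normc_ge0 ?ltW.
- by move=> w /Gd /cderivable_cdiff.
Qed.

Lemma cauchy_coef_bound_radius r k : 0 < r < 1 ->
  normc (cauchy_coef k) * r ^+ k <= 2 * M.
Proof.
move=> r01; have /andP[r0 r1] := r01.
rewrite -(cauchy_coefE k r01) -ler_pdivlMr ?exprn_gt0// -mulrA.
apply: normc_circle_mean_le => //; first exact: circ_diff_over_power.
move=> z zr; rewrite normcM normcV normcX zr ler_pM2r ?invr_gt0 ?exprn_gt0//.
by apply: fM; apply/diskP; rewrite zr.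
Qed.

Section Kernel.
Variables (z : C) (z1 : disk z).

(** The circle mean of [quot] is the contour integral of (f(w) - f(z)) / (w - z).
    Its continuous extension [G] satisfies the mean value property and vanishes at
    the origin, which is Cauchy's formula for [f z]. *)
Let quot (w : C) : C := (f w - f z) * w / (w - z).
Let G (w : C) : C := if w == z then z * derive1 f z else quot w.

Let quot_derivable w : disk w -> w != z -> derivable quot w 1.
Proof.
move=> w1 wz; apply: cderivableM.
  apply: cderivableM; last exact: cderivable_id.
  by apply: cderivableB; [exact: fa|exact: cderivable_cst].
apply: cderivableV; first by rewrite subr_eq0.
by apply: cderivableB; [exact: cderivable_id|exact: cderivable_cst].
Qed.

Let G_cdiff w : disk w -> w != z -> exists d, cdiff G w d.
Proof.
move=> w1 wz; have [d dP] := cderivable_cdiff (quot_derivable w1 wz).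
exists d; apply: (@cdiff_local _ quot G _ _ (normc (w - z))) => //.
  by rewrite normc_gt0 subr_eq0.
move=> v vw; rewrite /G; case: eqVneq => // vz.
by move: vw; rewrite vz normcB ltxx.
Qed.

Let G_cont_z : ccont G z.
Proof.
move=> e e0; set d := derive1 f z.
have [r r0 rP] := derivable_cdiff (fa z1) (divr_gt0 e0 (ltr0n _ 2)).
have [s s0 sP] := disk_nbhs z1.
have d0 := normc_ge0 d.
pose t := e / (2 * (normc d + 1)).
have t0 : 0 < t by rewrite divr_gt0//; lra.
exists (Num.min (Num.min r s) t); first by rewrite !lt_min r0 s0.
move=> w; rewrite !lt_min => /andP[/andP[wr ws] wt].
rewrite /G eqxx; case: eqVneq => [_|wz]; first by rewrite subrr normc0.
have wz0 : w - z != 0 by rewrite subr_eq0.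
have -> : quot w - z * derive1 f z =
    (f w - f z - d * (w - z)) / (w - z) * w + d * (w - z).
  by rewrite /quot -/d; field.
apply: le_lt_trans (normcD _ _) _.
have w1 : normc w < 1 by exact: sP.
have wzp : 0 < normc (w - z) by rewrite normc_gt0.
have h1 : normc ((f w - f z - d * (w - z)) / (w - z) * w) <= e / 2.
  rewrite !normcM normcV -[leRHS]mulr1; apply: ler_pM.
  - by rewrite mulr_ge0 ?invr_ge0 ?normc_ge0.
  - exact: normc_ge0.
  - by rewrite ler_pdivrMr// rP.
  - exact: ltW.
have h2 : normc (d * (w - z)) < e / 2.
  rewrite normcM; apply: (@le_lt_trans _ _ (normc d * t)).
    by rewrite ler_wpM2l// ltW.
  have tE : t * (2 * (normc d + 1)) = e by rewrite /t divfK// lt0r_neq0//; lra.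
  by rewrite -tE; lra.
lra.
Qed.

Let G_cont w : disk w -> ccont G w.
Proof.
move=> w1; have [->|wz] := eqVneq w z; first exact: G_cont_z.
by have [d /cdiff_ccont] := G_cdiff w1 wz.
Qed.

Let G_bounded : exists B, forall w, disk w -> normc (G w) <= B.
Proof.
have [r r0 rP] := G_cont_z ltr01; have M0 := bound_ge0.
exists (normc (G z) + 1 + 2 * M / r) => w w1.
have := normc_ge0 (G z) => Gz0.
have Mr0 : 0 <= 2 * M / r by apply: divr_ge0; [lra|exact: ltW].
have [wr|rw] := ltP (normc (w - z)) r.
  have := rP w wr; have := normcD (G w - G z) (G z); rewrite subrK; lra.
have wz : w != z by apply: contraTneq rw => ->; rewrite subrr normc0 -ltNge.
suff : normc (G w) <= 2 * M / r by lra.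
rewrite /G (negbTE wz) /quot 2!normcM normcV.
apply: ler_pM; rewrite ?invr_ge0 ?mulr_ge0 ?normc_ge0//.
  rewrite -[leRHS]mulr1; apply: ler_pM; rewrite ?normc_ge0//; last exact: ltW.
  by apply: le_trans (normcBD _ _) _; have := fM w1; have := fM z1; lra.
by rewrite lef_pV2 ?posrE// normc_gt0 subr_eq0.
Qed.

Let G0 : G 0 = 0.
Proof.
by rewrite /G /quot; case: eqVneq => [<-|_]; rewrite ?mul0r// mulr0 mul0r.
Qed.

(** On the circle of radius (1 + |z|) / 2 the geometric expansion of w / (w - z)
    splits the vanishing mean of [G] into the partial sum, [f z] and a remainder
    of ratio 2 |z| / (1 + |z|). *)
Lemma cauchy_partial_sum n :
  normc (series (fun k => cauchy_coef k * z ^+ k) n - f z) <=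
  4 * M * ((1 + normc z) / (1 - normc z)) * (2 * normc z / (1 + normc z)) ^+ n.
Proof.
have M0 := bound_ge0; have z0 := normc_ge0 z; have z1' : normc z < 1 by [].
have K1 : 1 <= (1 + normc z) / (1 - normc z) by rewrite ler_pdivlMr; lra.
case: n => [|n].
  rewrite /series/= big_geq// sub0r normcN expr0 mulr1.
  apply: le_trans (fM z1) _.
  have : M * 1 <= M * ((1 + normc z) / (1 - normc z)) by rewrite ler_wpM2l.
  by rewrite -mulrA; lra.
pose r := (1 + normc z) / 2.
have r0 : 0 < r by rewrite /r; lra.
have r1 : r < 1 by rewrite /r; lra.
have r01 : 0 < r < 1 by rewrite r0.
have zr : normc z < r by rewrite /r; lra.
have [B GB] := G_bounded.
have meanG := circle_mean_value G_cont GB G_cdiff r01.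
rewrite G0 in meanG.
have on_circle w : normc w = r -> [/\ w != 0, w != z & disk w].
  move=> wr; split; first exact: normc_gt0_neq wr.
    by apply: contraTneq zr => <-; rewrite wr ltxx.
  by apply/diskP; rewrite wr.
pose A w : C := \sum_(0 <= k < n.+1) z ^+ k * (f w / w ^+ k).
pose E w : C := \sum_(0 <= k < n.+1) z ^+ k * (w ^+ 0 / w ^+ k).
pose T w : C := (f w - f z) * (z ^+ n.+1 / w ^+ n.+1 * (w / (w - z))).
have Ad k : circ_diff r (fun w => z ^+ k * (f w / w ^+ k)).
  move=> w wr; apply: cderivableM; first exact: cderivable_cst.
  exact: (@circ_diff_over_power r).
have Id k : circ_diff r (fun w => w ^+ 0 / w ^+ k).
  move=> w wr; have [w0 _ _] := on_circle w wr.
  apply: cderivableM; first by apply: cderivableX; exact: cderivable_id.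
  apply: cderivableV; first by rewrite expf_neq0.
  by apply: cderivableX; exact: cderivable_id.
have Ed k : circ_diff r (fun w => z ^+ k * (w ^+ 0 / w ^+ k)).
  move=> w wr; apply: cderivableM; first exact: cderivable_cst.
  exact: Id.
have AAd : circ_diff r A by move=> w wr; apply: cderivable_sum => k; exact: Ad.
have EEd : circ_diff r E by move=> w wr; apply: cderivable_sum => k; exact: Ed.
have Td : circ_diff r T.
  move=> w wr; have [w0 wz w1] := on_circle w wr.
  apply: cderivableM.
    by apply: cderivableB; [exact: fa|exact: cderivable_cst].
  apply: cderivableM.
    apply: cderivableM; first exact: cderivable_cst.
    apply: cderivableV; first by rewrite expf_neq0.
    by apply: cderivableX; exact: cderivable_id.
  apply: cderivableM; first exact: cderivable_id.
  apply: cderivableV; first by rewrite subr_eq0.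
  by apply: cderivableB; [exact: cderivable_id|exact: cderivable_cst].
have GE (w : C) : normc w = r -> G w = A w - f z * E w + T w.
  move=> wr; have [w0 wz w1] := on_circle w wr.
  rewrite /G (negbTE wz) /quot -mulrA (geometric_kernel n.+1 w0 wz) mulrDr.
  congr (_ + _); rewrite /A /E mulrBl !mulr_sumr; congr (_ - _).
    by apply: eq_bigr => k _; rewrite mulrCA.
  by apply: eq_bigr => k _; rewrite expr0 mul1r.
rewrite (circle_mean_comb r0 AAd EEd Td GE) in meanG.
have EA : circle_mean A r = series (fun k => cauchy_coef k * z ^+ k) n.+1.
  rewrite (circle_mean_sum r0 _ Ad) /series/=; apply: eq_bigr => k _.
  by rewrite (circle_meanZ r0 _ (circ_diff_over_power (k := k) r01)) (cauchy_coefE _ r01) mulrC.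
have EE : circle_mean E r = 1.
  rewrite (circle_mean_sum r0 _ Ed) big_nat_recl//=.
  rewrite (circle_meanZ r0 _ (Id 0%N)) (circle_mean_orthogonal 0 0 r0).
  rewrite expr0 mulr1 big1 ?addr0// => k _.
  by rewrite (circle_meanZ r0 _ (Id k.+1)) (circle_mean_orthogonal 0 k.+1 r0) mulr0.
rewrite EA EE mulr1 in meanG.
rewrite (_ : _ - f z = - circle_mean T r); last first.
  by apply/eqP; rewrite -addr_eq0; apply/eqP.
rewrite normcN; set c := 2 * normc z / (1 + normc z).
have -> : 4 * M * ((1 + normc z) / (1 - normc z)) * c ^+ n.+1 =
    2 * (2 * M * (c ^+ n.+1 * ((1 + normc z) / (1 - normc z)))) by ring.
apply: normc_circle_mean_le => // w wr; have [w0 wz w1] := on_circle w wr.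
rewrite /T normcM; apply: ler_pM; rewrite ?normc_ge0//.
  by apply: le_trans (normcBD _ _) _; have := fM w1; have := fM z1; lra.
rewrite normcM; apply: ler_pM; rewrite ?normc_ge0//.
  rewrite normcM normcV !normcX wr -expr_div_n.
  rewrite (_ : normc z / r = c)// /c /r; field; lra.
rewrite normcM normcV wr.
have wz' : (1 - normc z) / 2 <= normc (w - z).
  by have := normcBl w z; rewrite wr /r; lra.
have -> : (1 + normc z) / (1 - normc z) = r / ((1 - normc z) / 2).
  by rewrite /r; field; rewrite lt0r_neq0//; lra.
by rewrite ler_pM2l// lef_pV2 ?posrE//; lra.
Qed.

End Kernel.

Lemma cauchy_expansion (z : C) : disk z ->
  series (fun k => cauchy_coef k * z ^+ k) @ \oo --> f z.
Proof.
move=> z1; have z1' : normc z < 1 by []; have z0 := normc_ge0 z.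
apply: cvgc_squeeze (cauchy_partial_sum z1) _.
apply: geometric_cvg0; apply/andP; split.
  by rewrite divr_ge0//; lra.
by rewrite ltr_pdivrMr; lra.
Qed.

End CauchyCoefficients.

Section RadialLimit.
Variable R : realType.
Local Notation C := (R[i]^o).

Lemma cvg_finsum0 (F : nat -> nat -> R) n :
  (forall k, F k @ \oo --> (0 : R)) ->
  (fun j => \sum_(0 <= k < n) F k j) @ \oo --> (0 : R).
Proof.
move=> F0; elim: n => [|n ih].
  by under eq_fun do rewrite big_nil; exact: cvg_cst.
have -> : (fun j => \sum_(0 <= k < n.+1) F k j) =
    (fun j => \sum_(0 <= k < n) F k j + F n j).
  by apply/funext => j; rewrite big_nat_recr.
by rewrite -[X in _ --> X]addr0; apply: cvgD.
Qed.

Lemma radial_bound (c : nat -> C) (n : nat) (B : R) :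
  (forall r : R, 0 < r < 1 -> normc (\sum_(0 <= k < n) c k * (r ^+ k)%:C%C) <= B) ->
  normc (\sum_(0 <= k < n) c k) <= B.
Proof.
move=> cB; pose r j : R := 1 - j.+2%:R^-1.
have r01 j : 0 < r j < 1.
  have h : 0 < (j.+2%:R^-1 : R) < 1 by rewrite invr_gt0 ltr0n/= invf_lt1 ?ltr0n// ltr1n.
  by rewrite /r; move: (j.+2%:R^-1) h => x h; lra.
have rcv : r @ \oo --> (1 : R).
  rewrite -[X in _ --> X]subr0; apply: cvgB; first exact: cvg_cst.
  by have := @cvg_harmonic R; rewrite -(cvg_shiftS _).
have rk k : (fun j => r j ^+ k) @ \oo --> (1 : R).
  rewrite -[X in _ --> X](expr1n _ k).
  elim: k => [|k ih]; first by rewrite expr0; exact: cvg_cst.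
  by rewrite exprS; under eq_fun do rewrite exprS; apply: cvgM.
apply: (@normc_cvg_le _ (fun j => \sum_(0 <= k < n) c k * (r j ^+ k)%:C%C)); last first.
  by move=> j; exact: cB.
apply: (@cvgc_squeeze _ _ _ (fun j => \sum_(0 <= k < n) normc (c k) * (1 - r j ^+ k))).
  move=> j; rewrite -sumrB; apply: le_trans (normc_sum _ _ _) _.
  apply: ler_sum => k _.
  rewrite -{2}[c k]mulr1 -mulrBr normcM ler_wpM2l ?normc_ge0//.
  rewrite (_ : _ - 1 = (r j ^+ k - 1)%:C%C); last by rewrite rmorphB.
  have /andP[r0 r1] := r01 j.
  by rewrite normcR distrC ger0_norm// subr_ge0 exprn_ile1// ltW.
apply: cvg_finsum0 => k.
rewrite -[X in _ --> X](mulr0 (normc (c k))) -[X in _ * X](subrr 1).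
by apply: cvgMr; apply: cvgB => //; exact: cvg_cst.
Qed.

End RadialLimit.

(** * Power series on the disk *)

Section PowerSeries.
Variable R : realType.
Local Notation C := (R[i]^o).
Implicit Types (a : nat -> C) (z w : C).

Lemma cvgc_lim (u : nat -> C) (l : C) : u @ \oo --> l -> lim (u @ \oo) = l.
Proof. by move/cvg_normcP/cvg_normc_lim. Qed.

Lemma cvgcB (u v : nat -> C) (l m : C) : u @ \oo --> l -> v @ \oo --> m ->
  (fun n => u n - v n) @ \oo --> l - m.
Proof.
move=> /cvg_normc ul /cvg_normc vm.
apply: (@cvgc_squeeze _ _ _ (fun n => normc (u n - l) + normc (v n - m))).
  move=> n; have -> : u n - v n - (l - m) = (u n - l) - (v n - m) by ring.
  exact: normcBD.
by rewrite -[X in _ --> X]addr0; apply: cvgD.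
Qed.

Lemma cvgcMl (u : nat -> C) (l c : C) : u @ \oo --> l ->
  (fun n => u n * c) @ \oo --> l * c.
Proof.
move=> /cvg_normc ul.
apply: (@cvgc_squeeze _ _ _ (fun n => normc (u n - l) * normc c)).
  by move=> n; rewrite -mulrBl normcM.
by rewrite -[X in _ --> X](mul0r (normc c)); apply: cvgMl.
Qed.

Lemma cvgcS (u : nat -> C) (l : C) : u @ \oo --> l ->
  (fun n => u n.+1) @ \oo --> l.
Proof.
move/cvg_normcP => ul; apply/cvg_normcP => e /ul[N NP]; exists N => n Nn.
by apply: NP; exact: leqW.
Qed.

Lemma cvgc_series (u : nat -> C) (v : nat -> R) (V : R) :
  (forall k, normc (u k) <= v k) -> (forall n, \sum_(0 <= k < n) v k <= V) ->
  exists l : C, series u @ \oo --> l.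
Proof.
move=> uv vV.
have real_case (p : nat -> R) : (forall k, `|p k| <= v k) -> cvgn (series p).
  move=> pv; apply: normed_cvg.
  apply: nondecreasing_is_cvgn.
    by apply: nondecreasing_series => n _ _ /=; exact: normr_ge0.
  exists V => _ [n _ <-]; apply: le_trans (vV n).
  by apply: ler_sum => k _; exact: pv.
have /cvg_ex[x xP] := real_case (fun k => complex.Re (u k))
  (fun k => le_trans (normRe_le _) (uv k)).
have /cvg_ex[y yP] := real_case (fun k => complex.Im (u k))
  (fun k => le_trans (normIm_le _) (uv k)).
exists (Complex x y); apply: cvgc_ReIm.
  rewrite (_ : (fun n => _) = series (fun k => complex.Re (u k)))//.
  by apply/funext => n; rewrite /series/= Re_sum.
rewrite (_ : (fun n => _) = series (fun k => complex.Im (u k)))//.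
by apply/funext => n; rewrite /series/= Im_sum.
Qed.

Lemma geometric_sum_le (x : R) n : 0 <= x < 1 ->
  \sum_(0 <= k < n) x ^+ k <= (1 - x)^-1.
Proof.
move=> /andP[x0 x1].
have -> : \sum_(0 <= k < n) x ^+ k = (1 - x ^+ n) / (1 - x).
  elim: n => [|n ih]; first by rewrite big_nil expr0 subrr mul0r.
  by rewrite big_nat_recr//= ih exprS; field; rewrite lt0r_neq0//; lra.
rewrite ler_pdivrMr; last by lra.
by rewrite mulVf ?gerBl ?exprn_ge0// lt0r_neq0//; lra.
Qed.

Lemma natmul_power_le (x : R) k : 0 <= x < 1 -> k%:R * x ^+ k <= (1 - x)^-1.
Proof.
move=> x01; have /andP[x0 x1] := x01.
apply: le_trans (geometric_sum_le k x01).
have -> : k%:R * x ^+ k = \sum_(0 <= j < k) x ^+ k.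
  by rewrite sumr_const_nat subn0 mulr_natl.
rewrite !big_mkord; apply: ler_sum => j _.
apply: ler_wiXn2l; [by []|exact: ltW|exact: ltnW].
Qed.

(** Coefficients of a power series whose radius of convergence is at least 1. *)
Definition disk_coefs a := forall r : R, 0 <= r < 1 ->
  exists B : R, forall k, normc (a k) * r ^+ k <= B.

Lemma bounded_disk_coefs a (B : R) : (forall k, normc (a k) <= B) -> disk_coefs a.
Proof.
move=> aB r /andP[r0 r1]; exists B => k; apply: le_trans (aB k).
by rewrite ler_piMr ?normc_ge0// exprn_ile1// ltW.
Qed.

Definition psum a z : C := lim (series (fun k => a k * z ^+ k) @ \oo).

Definition dcoef a k : C := k.+1%:R * a k.+1.

(** With [r = x ^ 4], one factor [x ^ k] controls [|a k|], two control [k ^ 2] and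
    the last one makes the sum converge. *)
Lemma disk_coefs_sum a (r : R) : disk_coefs a -> 0 < r < 1 ->
  exists V : R, forall n,
    \sum_(0 <= k < n) normc (a k) * k%:R ^+ 2 * r ^+ k <= V.
Proof.
move=> aD /andP[r0 r1]; pose x := Num.sqrt (Num.sqrt r).
have x4 : x ^+ 4 = r by rewrite (exprM x 2 2) !sqr_sqrtr ?sqrtr_ge0 ?ltW.
have x0 : 0 < x by rewrite !sqrtr_gt0.
have x1 : x < 1.
  rewrite ltNge; apply/negP => h; have := exprn_ege1 4 h; rewrite x4; lra.
have x01 : 0 <= x < 1 by rewrite (ltW x0).
have [B BP] := aD x x01.
have B0 : 0 <= B by apply: le_trans (BP 0%N); rewrite expr0 mulr1 normc_ge0.
have i0 : 0 < (1 - x)^-1 by rewrite invr_gt0 subr_gt0.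
exists (B * (1 - x)^-1 ^+ 2 * (1 - x)^-1) => n.
apply: (@le_trans _ _ (\sum_(0 <= k < n) B * (1 - x)^-1 ^+ 2 * x ^+ k)).
  apply: ler_sum => k _.
  have -> : normc (a k) * k%:R ^+ 2 * r ^+ k =
     (normc (a k) * x ^+ k) * (k%:R * x ^+ k) ^+ 2 * x ^+ k.
    by rewrite -x4 -exprM mulnC exprM; ring.
  apply: ler_wpM2r; first by rewrite exprn_ge0// ltW.
  apply: ler_pM; rewrite ?exprn_ge0 ?mulr_ge0 ?normc_ge0 ?exprn_ge0 ?ler0n ?(ltW x0)//.
  by rewrite ler_pXn2r ?nnegrE ?mulr_ge0 ?ler0n ?exprn_ge0 ?(ltW x0) ?(ltW i0)// natmul_power_le.
rewrite -mulr_sumr; apply: ler_wpM2l (geometric_sum_le _ x01).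
by rewrite mulr_ge0// exprn_ge0// ltW.
Qed.

Lemma disk_coefs_dcoef a : disk_coefs a -> disk_coefs (dcoef a).
Proof.
move=> aD r0 /andP[r00 r01]; pose r := Num.max r0 (1 / 2).
have r0' : 0 < r by rewrite lt_max; apply/orP; right; lra.
have r1 : r < 1 by rewrite gt_max r01; lra.
have rr0 : r0 <= r by rewrite le_max lexx.
pose x := Num.sqrt r.
have x2 : x ^+ 2 = r by rewrite sqr_sqrtr// ltW.
have x0 : 0 < x by rewrite sqrtr_gt0.
have x1 : x < 1.
  rewrite ltNge; apply/negP => h; have := exprn_ege1 2 h; rewrite x2; lra.
have x01 : 0 <= x < 1 by rewrite (ltW x0).
have [B BP] := aD x x01.
exists (B * (1 - x)^-1 / r) => k.
apply: (@le_trans _ _ (normc (dcoef a k) * r ^+ k)).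
  by rewrite ler_wpM2l ?normc_ge0// lerXn2r ?nnegrE// ltW.
rewrite ler_pdivlMr// -mulrA -exprSr /dcoef normcM normc_nat.
have -> : k.+1%:R * normc (a k.+1) * r ^+ k.+1 =
    (normc (a k.+1) * x ^+ k.+1) * (k.+1%:R * x ^+ k.+1).
  by rewrite -x2 -exprM mulnC exprM; ring.
apply: ler_pM; rewrite ?mulr_ge0 ?normc_ge0 ?exprn_ge0 ?ler0n ?(ltW x0)//.
exact: natmul_power_le.
Qed.

Lemma psum_cvg a z : disk_coefs a -> disk z ->
  series (fun k => a k * z ^+ k) @ \oo --> psum a z.
Proof.
move=> aD z1; have z1' : normc z < 1 by []; have z0 := normc_ge0 z.
pose r := (1 + normc z) / 2.
have [B BP] := aD r ltac:(rewrite /r; lra).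
have r0 : 0 < r by rewrite /r; lra.
pose x := normc z / r.
have x01 : 0 <= x < 1.
  by rewrite /x divr_ge0 ?(ltW r0)//= ltr_pdivrMr// /r; lra.
have B0 : 0 <= B by apply: le_trans (BP 0%N); rewrite expr0 mulr1 normc_ge0.
have [|n|l lP] := @cvgc_series (fun k => a k * z ^+ k) (fun k => B * x ^+ k) (B * (1 - x)^-1).
- move=> k; rewrite normcM normcX /x expr_div_n mulrA ler_pdivlMr ?exprn_gt0//.
  rewrite mulrAC; apply: ler_wpM2r (BP k); by rewrite exprn_ge0 ?normc_ge0.
- by rewrite -mulr_sumr ler_wpM2l// geometric_sum_le.
by rewrite /psum (cvgc_lim lP).
Qed.

Lemma power_remainder (r : R) z w k : 0 < r -> normc z <= r -> normc w <= r ->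
  normc (w ^+ k - z ^+ k - k%:R * z ^+ k.-1 * (w - z)) * r ^+ 2 <=
  k%:R ^+ 2 * r ^+ k * normc (w - z) ^+ 2.
Proof.
move=> r0 zr wr; have h0 := normc_ge0 (w - z).
elim: k => [|k ih].
  by rewrite !expr0 subrr mul0r mul0r subrr normc0 !mul0r expr0n /= !mul0r.
have -> : w ^+ k.+1 - z ^+ k.+1 - k.+1%:R * z ^+ k.+1.-1 * (w - z) =
    w * (w ^+ k - z ^+ k - k%:R * z ^+ k.-1 * (w - z)) +
    k%:R * z ^+ k.-1 * (w - z) ^+ 2.
  case: k {ih} => [|k]; first by rewrite !expr0 !expr1; ring.
  by rewrite -natr1 /= !exprS; ring.
apply: (@le_trans _ _ ((normc w * normc (w ^+ k - z ^+ k - k%:R * z ^+ k.-1 * (w - z))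
    + k%:R * normc z ^+ k.-1 * normc (w - z) ^+ 2) * r ^+ 2)).
  rewrite ler_wpM2r ?exprn_ge0 ?(ltW r0)//.
  by apply: le_trans (normcD _ _) _; rewrite !normcM !normcX normc_nat.
rewrite mulrDl -mulrA.
have h1 : normc w * (normc (w ^+ k - z ^+ k - k%:R * z ^+ k.-1 * (w - z)) * r ^+ 2) <=
    r * (k%:R ^+ 2 * r ^+ k * normc (w - z) ^+ 2).
  by apply: ler_pM; rewrite ?mulr_ge0 ?normc_ge0 ?exprn_ge0 ?(ltW r0).
have h2 : k%:R * normc z ^+ k.-1 * normc (w - z) ^+ 2 * r ^+ 2 <=
    k%:R * r ^+ k.+1 * normc (w - z) ^+ 2.
  case: k {ih h1} => [|k]; first by rewrite !mul0r.
  rewrite mulrAC ler_wpM2r ?exprn_ge0//= -!mulrA ler_wpM2l//.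
  rewrite -[k.+2]addn2 exprD ler_wpM2r ?exprn_ge0 ?(ltW r0)//.
  by rewrite lerXn2r ?nnegrE ?normc_ge0 ?(ltW r0).
apply: le_trans (lerD h1 h2) _.
have -> : r * (k%:R ^+ 2 * r ^+ k * normc (w - z) ^+ 2) +
    k%:R * r ^+ k.+1 * normc (w - z) ^+ 2 =
    (k%:R ^+ 2 + k%:R) * (r ^+ k.+1 * normc (w - z) ^+ 2).
  by rewrite [r ^+ k.+1]exprS; ring.
rewrite -mulrA ler_wpM2r ?mulr_ge0 ?exprn_ge0 ?(ltW r0)//.
rewrite -natr1; have := ler0n R k; move: (k%:R) => x x0.
rewrite sqrrD expr1n mulr1; lra.
Qed.

(** Each power differs from its linear part by at most a multiple of
    [k ^ 2 r ^ k |w - z| ^ 2], by [power_remainder], and these bounds are summable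
    against the coefficients. *)
Lemma psum_cdiff a z : disk_coefs a -> disk z ->
  cdiff (psum a) z (psum (dcoef a) z).
Proof.
move=> aD z1 e e0; have z1' : normc z < 1 by []; have z0 := normc_ge0 z.
pose r := (1 + normc z) / 2.
have r0 : 0 < r by rewrite /r; lra.
have r1 : r < 1 by rewrite /r; lra.
have zr : normc z < r by rewrite /r; lra.
have [V VP] := disk_coefs_sum aD ltac:(by apply/andP; split; [exact: r0|exact: r1]).
have V0 : 0 <= V by have := VP 0%N; rewrite big_nil.
have r20 : 0 < r ^+ 2 by rewrite exprn_gt0.
exists (Num.min (r - normc z) (e * r ^+ 2 / (V + 1))).
  by rewrite lt_min subr_gt0 zr/= divr_gt0 ?mulr_gt0//; lra.
move=> w; rewrite lt_min => /andP[wz1 wz2].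
have wr : normc w < r by have := normcD (w - z) z; rewrite subrK; lra.
have w1 : disk w by exact: lt_trans wr r1.
have h0 := normc_ge0 (w - z).
suff : normc (psum a w - psum a z - psum (dcoef a) z * (w - z)) <=
    V * normc (w - z) ^+ 2 / r ^+ 2.
  move=> /le_trans; apply; rewrite ler_pdivrMr// expr2 mulrA mulrAC.
  rewrite [e * _ * _]mulrAC; apply: ler_wpM2r => //.
  move: wz2; rewrite ltr_pdivlMr; last by lra.
  rewrite mulrDr mulr1 [normc (w - z) * V]mulrC; lra.
pose D n : C := series (fun k => a k * w ^+ k) n.+1 -
  series (fun k => a k * z ^+ k) n.+1 -
  series (fun k => dcoef a k * z ^+ k) n * (w - z).
have DE n : D n = \sum_(0 <= k < n.+1)
    a k * (w ^+ k - z ^+ k - k%:R * z ^+ k.-1 * (w - z)).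
  rewrite /D; have -> : series (fun k => dcoef a k * z ^+ k) n =
      \sum_(0 <= k < n.+1) k%:R * a k * z ^+ k.-1.
    by rewrite big_nat_recl// !mul0r add0r.
  rewrite /series/= mulr_suml -!sumrB; apply: eq_bigr => k _; ring.
have Dl : D @ \oo --> psum a w - psum a z - psum (dcoef a) z * (w - z).
  have sw := psum_cvg aD w1; have sz := psum_cvg aD z1.
  have sd := psum_cvg (disk_coefs_dcoef aD) z1.
  have h1 := cvgcB (cvgcS sw) (cvgcS sz).
  have h2 := cvgcMl (c := w - z) sd.
  have h3 := cvgcB h1 h2.
  exact: h3.
apply: normc_cvg_le Dl _ => n; rewrite DE.
rewrite ler_pdivlMr//; apply: le_trans (ler_wpM2r (ltW r20) (normc_sum _ _ _)) _.
apply: (@le_trans _ _ (\sum_(0 <= k < n.+1) (normc (a k) * k%:R ^+ 2 * r ^+ k) *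
    normc (w - z) ^+ 2)).
  rewrite mulr_suml; apply: ler_sum => k _.
  rewrite normcM -[X in X <= _]mulrA.
  have -> : normc (a k) * k%:R ^+ 2 * r ^+ k * normc (w - z) ^+ 2 =
    normc (a k) * (k%:R ^+ 2 * r ^+ k * normc (w - z) ^+ 2) by ring.
  by apply: ler_wpM2l; rewrite ?normc_ge0//; apply: power_remainder; rewrite // ltW.
by rewrite -mulr_suml ler_wpM2r// exprn_ge0.
Qed.

Lemma psum_at0 a : disk_coefs a -> psum a 0 = a 0%N.
Proof.
move=> aD; apply: cvg_normc_lim => e e0; exists 1%N => -[//|n] _.
rewrite /series/= big_nat_recl//= expr0 mulr1 big1 ?addr0 ?subrr ?normc0// => k _.
by rewrite exprS mul0r mulr0.
Qed.

Lemma iter_dcoefE a n k :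
  k`!%:R * iter n dcoef a k = (n + k)`!%:R * a (n + k)%N.
Proof.
elim: n k => [//|n ih] k.
rewrite iterS /dcoef mulrA -natrM mulnC -factS ih addSnnS; congr (_ * _).
Qed.

Lemma disk_coefs_iter a n : disk_coefs a -> disk_coefs (iter n dcoef a).
Proof. by move=> aD; elim: n => // n ih; exact: disk_coefs_dcoef. Qed.

Lemma psum_derive1n (f : C -> C) a : disk_coefs a ->
  (forall z, disk z -> f z = psum a z) ->
  forall n z, disk z -> derive1n n f z = psum (iter n dcoef a) z.
Proof.
move=> aD fa; elim => [//|n ih] z z1; rewrite derive1nS.
apply: cdiff_derive1; apply: (cdiff_disk z1) (psum_cdiff _ z1) => [w w1|].
  by rewrite ih.
exact: disk_coefs_iter.
Qed.

(** The Taylor coefficients defined through iterated derivatives are those of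
    any power series representing the function on the disk. *)
Lemma psum_taylor_coef (f : C -> C) a : disk_coefs a ->
  (forall z, disk z -> f z = psum a z) -> forall n, taylor_coef f n = a n.
Proof.
move=> aD fa n; rewrite /taylor_coef (psum_derive1n aD fa n (disk0 R)).
rewrite psum_at0; last exact: disk_coefs_iter.
have := iter_dcoefE a n 0; rewrite fact0 mul1r addn0 => ->.
by rewrite mulrAC mulfV ?mul1r.
Qed.

Lemma psum_analytic (f : C -> C) a : disk_coefs a ->
  (forall z, disk z -> f z = psum a z) -> analytic f.
Proof.
move=> aD fa z z1; apply: (@cdiff_derivable _ f z (psum (dcoef a) z)).
by apply: (cdiff_disk z1) (psum_cdiff aD z1) => w w1; rewrite fa.
Qed.

End PowerSeries.

(** * Landau's bound for the partial sums of the Taylor coefficients *)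

Section LandauCoefficients.
Variable R : realType.

(** [central_coef k] is the k-th Taylor coefficient of (1 - z)^(-1/2), that is
    the central binomial coefficient divided by [4 ^ k]. *)
Fixpoint central_coef (k : nat) : R :=
  if k is j.+1 then central_coef j * (2 * j%:R + 1) / (2 * j%:R + 2) else 1.

Lemma central_coefS k :
  k.+1%:R * central_coef k.+1 = (k%:R + 1 / 2) * central_coef k.
Proof.
rewrite /= -natr1; field; have := ler0n R k => k0.
by rewrite lt0r_neq0//; lra.
Qed.

Lemma central_coef_sqr k : central_coef k ^+ 2 <= k.+1%:R^-1.
Proof.
elim: k => [|k ih]; first by rewrite /= expr1n invr1.
have k0 := ler0n R k.
have -> : central_coef k.+1 = central_coef k * ((2 * k%:R + 1) / (2 * k%:R + 2)).
  by rewrite /= mulrA.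
rewrite exprMn.
apply: le_trans (ler_wpM2r (sqr_ge0 _) ih) _.
rewrite -[k.+2%:R]natr1 -[k.+1%:R]natr1.
move: (k%:R : R) k0 => x x0.
rewrite mulrC ler_pdivrMr; last by lra.
rewrite expr_div_n ler_pdivrMr; last by rewrite exprn_gt0//; lra.
rewrite -mulrA ler_pdivlMl; last by lra.
nra.
Qed.

Definition central_conv n :=
  \sum_(0 <= i < n.+1) central_coef i * central_coef (n - i)%N.

Lemma central_conv_sym n :
  2 * (\sum_(0 <= i < n.+1) i%:R * (central_coef i * central_coef (n - i)%N)) =
  n%:R * central_conv n.
Proof.
rewrite mulr_natl mulr2n {2}big_nat_rev/= -big_split/= /central_conv mulr_sumr.
apply: eq_big_nat => i /andP[_ iN]; rewrite add0n subSS subKn//.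
rewrite natrB//; ring.
Qed.

(** The square of (1 - z)^(-1/2) is 1 / (1 - z). Symmetrizing the recurrence of the
    coefficients shows that their convolution has constant value. *)
Lemma central_conv1 n : central_conv n = 1.
Proof.
elim: n => [|n ih]; first by rewrite /central_conv big_nat1 subn0 mulr1.
apply: (@mulfI _ n.+1%:R); first by rewrite pnatr_eq0.
rewrite -central_conv_sym big_nat_recl// mul0r add0r.
under eq_bigr do rewrite subSS mulrA central_coefS.
have -> : n.+1%:R * 1 = n%:R * central_conv n + central_conv n.
  by rewrite ih -natr1; ring.
rewrite -central_conv_sym /central_conv.
rewrite !mulr_sumr -big_split/=; apply: eq_bigr => i _; by field.
Qed.

End LandauCoefficients.

Section PartialSums.
Variable R : realType.
Local Notation C := (R[i]^o).

Lemma sum_kronecker (g : nat -> C) k n : (k < n)%N ->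
  \sum_(0 <= l < n) g l * (k == l)%:R = g k.
Proof.
move=> kn; rewrite big_mkord (bigD1 (Ordinal kn))//= eqxx mulr1.
rewrite big1 ?addr0// => l /eqP lk; case: eqP => [kl|_]; last by rewrite mulr0.
by case: lk; apply: val_inj.
Qed.

Lemma abel_bound (a : nat -> C) (b tau : nat -> R) n :
  (forall n, normc (\sum_(0 <= k < n) a k) <= \sum_(0 <= k < n) b k) ->
  (forall k, tau k.+1 <= tau k) -> (forall k, 0 <= tau k) ->
  normc (\sum_(0 <= k < n) a k * (tau k)%:C%C) <= \sum_(0 <= k < n) b k * tau k.
Proof.
move=> ab tauS tau0.
pose A n := \sum_(0 <= k < n) a k; pose B n := \sum_(0 <= k < n) b k.
have EA : \sum_(0 <= k < n) a k * (tau k)%:C%C = A n * (tau n)%:C%C +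
    \sum_(0 <= k < n) A k.+1 * (tau k - tau k.+1)%:C%C.
  elim: n => [|n ih]; first by rewrite /A !big_nil mul0r addr0.
  rewrite !big_nat_recr//= ih /A big_nat_recr//= -/(A n) rmorphB/=; ring.
have EB : \sum_(0 <= k < n) b k * tau k = B n * tau n +
    \sum_(0 <= k < n) B k.+1 * (tau k - tau k.+1).
  elim: n {EA} => [|n ih]; first by rewrite /B !big_nil mul0r addr0.
  rewrite !big_nat_recr//= ih /B big_nat_recr//= -/(B n); ring.
rewrite EA EB; apply: le_trans (normcD _ _) _; apply: lerD.
  by rewrite normcM normcR ger0_norm//; apply: ler_wpM2r => //; exact: ab.
apply: le_trans (normc_sum _ _ _) _; apply: ler_sum => k _.
rewrite normcM normcR ger0_norm ?subr_ge0//.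
by apply: ler_wpM2r; rewrite ?subr_ge0//; exact: ab.
Qed.

Lemma circle_mean_dom (r M : R) (G H : C -> C) : 0 < r ->
  circ_diff r G -> circ_diff r H ->
  (forall z, normc z = r -> normc (G z) <= M * complex.Re (H z)) ->
  normc (circle_mean G r) <= 2 * M * complex.Re (circle_mean H r).
Proof.
move=> r0 Gd Hd GH; have p0 := pi2_gt0 R.
have iH := circ_diff_cintegrable r0 Hd.
rewrite /circle_mean normcM normcR ger0_norm ?invr_ge0 ?(ltW p0)//.
rewrite ReM Re_real Im_real mul0r subr0.
rewrite [leRHS]mulrCA ler_pM2l ?invr_gt0//.
have mD : measurable (`[0, 2 * pi]%classic : set (measurableTypeR R)).
  exact: measurable_itv.
rewrite -mulrA -(RintegralZl M mD iH.1).
apply: normc_Cint_le => //.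
- exact: circ_diff_cintegrable.
- have := integrableZl mD M iH.1.
  by apply: eq_integrable => // x _ /=; rewrite EFinM.
- by move=> t _; apply: GH; rewrite normc_circ gtr0_norm.
Qed.

Lemma conjc_unit (w : C) : normc w = 1 -> w^-1 = conjc w.
Proof.
move=> w1; have w0 : w != 0 by apply: (@normc_gt0_neq _ 1).
apply: (mulfI w0); rewrite mulfV//.
case: w w1 {w0} => a b /= ab; have : Num.sqrt (a ^+ 2 + b ^+ 2) ^+ 2 = 1.
  by rewrite ab expr1n.
rewrite sqr_sqrtr ?addr_ge0 ?sqr_ge0// => e.
by apply: complex_eq; rewrite ?(ReM, ImM)/= -?e; ring.
Qed.

Lemma mul_conjc (w : C) : complex.Re (w * conjc w) = normc w ^+ 2.
Proof. by rewrite normc_sqr; case: w => a b; rewrite ReM /=; ring. Qed.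

Section LandauBound.
Variables (f : C -> C) (M : R).
Hypothesis fa : analytic f.
Hypothesis fM : forall z, disk z -> normc (f z) <= M.
Variables (n : nat) (r : R).
Hypothesis r01 : 0 < r < 1.

Let b k : C := (central_coef R k)%:C%C.
Let P (w : C) : C := \sum_(0 <= k < n.+1) b k * w ^+ k.
Let rc : C := r%:C%C.

Let r_gt0 : 0 < r. Proof. by case/andP: r01. Qed.

Let rc_neq0 : rc != 0.
Proof. by rewrite -normc_gt0 normcR gtr0_norm. Qed.

Let mean_sqr : circle_mean (fun z => P (z / rc) * P (rc / z)) r =
  (\sum_(0 <= k < n.+1) central_coef R k ^+ 2)%:C%C.
Proof.
pose F k l (z : C) : C := (b k * b l * (rc ^+ l / rc ^+ k)) * (z ^+ k / z ^+ l).
have m k l : circ_diff r (fun z => z ^+ k / z ^+ l).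
  move=> z /(normc_gt0_neq r_gt0) z0; apply: cderivableM.
    by apply: cderivableX; exact: cderivable_id.
  apply: cderivableV; first by rewrite expf_neq0.
  by apply: cderivableX; exact: cderivable_id.
have Fd k l : circ_diff r (F k l).
  by move=> z zr; apply: cderivableM; [exact: cderivable_cst|exact: m].
have FFd k : circ_diff r (fun z => \sum_(0 <= l < n.+1) F k l z).
  by move=> z zr; apply: cderivable_sum => l; exact: Fd.
have E (z : C) : normc z = r -> P (z / rc) * P (rc / z) =
    \sum_(0 <= k < n.+1) \sum_(0 <= l < n.+1) F k l z.
  move=> /(normc_gt0_neq r_gt0) z0; rewrite /P mulr_suml; apply: eq_bigr => k _.
  rewrite mulr_sumr; apply: eq_bigr => l _; rewrite /F !expr_div_n.
  by field; rewrite !expf_neq0.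
rewrite (eq_circle_mean r_gt0 E) (circle_mean_sum r_gt0 _ FFd) rmorph_sum/=.
apply: eq_big_nat => k /andP[_ kn]; rewrite (circle_mean_sum r_gt0 _ (Fd k)).
have mF l : circle_mean (F k l) r = (b k * b l * (rc ^+ l / rc ^+ k)) * (k == l)%:R.
  by rewrite (circle_meanZ r_gt0 _ (m k l)) (circle_mean_orthogonal k l r_gt0).
under eq_bigr do rewrite mF.
rewrite sum_kronecker// mulfV ?expf_neq0// mulr1 -rmorphM -expr2.
by [].
Qed.

Let norm_sqr (z : C) : normc z = r ->
  complex.Re (P (z / rc) * P (rc / z)) = normc (P (z / rc)) ^+ 2.
Proof.
move=> zr; rewrite -mul_conjc; congr (complex.Re (_ * _)).
have -> : rc / z = conjc (z / rc).
  rewrite -conjc_unit ?invf_div// normcM normcV zr normcR gtr0_norm// mulfV//.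
  exact: lt0r_neq0.
rewrite /P [RHS]rmorph_sum/=; apply: eq_bigr => k _.
rewrite [RHS]rmorphM/= rmorphXn; congr (_ * _).
by rewrite /b /= oppr0.
Qed.

(** Landau's estimate of the partial sums. In the integral for the partial sum
    the kernel 1 + z^-1 + .. + z^-n may be completed by positive powers of z,
    whose products with [f] have mean zero; completed to z^-n P(z)^2, with [P]
    the Taylor polynomial of (1 - z)^(-1/2), its mean modulus is the sum of the
    squared coefficients of [P]. *)
Lemma landau_partial_sum_radius :
  normc (\sum_(0 <= k < n.+1) cauchy_coef f k * (r ^+ k)%:C%C) <=
  2 * M * \sum_(0 <= k < n.+1) central_coef R k ^+ 2.
Proof.
pose K (z : C) : C := P (z / rc) ^+ 2 * (rc / z) ^+ n.
have divd (z : C) : z != 0 -> derivable (fun z : C => rc / z) z 1.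
  move=> z0; apply: cderivableM; first exact: cderivable_cst.
  by apply: cderivableV => //; exact: cderivable_id.
have Pd (g : C -> C) z : derivable g z 1 -> derivable (fun z => P (g z)) z 1.
  move=> gz; apply: cderivable_sum => k.
  by apply: cderivableM; [exact: cderivable_cst|exact: cderivableX].
have muld (z : C) : derivable (fun z : C => z / rc) z 1.
  by apply: cderivableM; [exact: cderivable_id|exact: cderivable_cst].
have disk_r (z : C) : normc z = r -> z != 0 /\ disk z.
  move=> zr; split; first exact: (normc_gt0_neq r_gt0).
  by apply/diskP; rewrite zr; case/andP: r01.
have fKd : circ_diff r (fun z => f z * K z).
  move=> z /disk_r[z0 z1]; apply: cderivableM; first exact: fa.
  apply: cderivableM; first by apply: cderivableX; apply: Pd; exact: muld.
  by apply: cderivableX; exact: divd.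
have PPd : circ_diff r (fun z => P (z / rc) * P (rc / z)).
  move=> z /disk_r[z0 z1]; apply: cderivableM; apply: Pd; first exact: muld.
  exact: divd.
have bound z : normc z = r ->
    normc (f z * K z) <= M * complex.Re (P (z / rc) * P (rc / z)).
  move=> zr; have [z0 z1] := disk_r z zr.
  rewrite (norm_sqr zr) normcM; apply: ler_pM; rewrite ?normc_ge0 ?fM//.
  rewrite /K normcM !normcX normcM normcV zr normcR gtr0_norm//.
  by rewrite mulfV ?lt0r_neq0// expr1n mulr1.
have := circle_mean_dom r_gt0 fKd PPd bound.
rewrite mean_sqr Re_real => /(le_trans _); apply.
rewrite le_eqVlt; apply/orP; left; apply/eqP; congr normc.
(* up to degree [n] the square of [P] agrees with 1 / (1 - w) *)
pose p : {poly R[i]} := \poly_(k < n.+1) b k.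
have pE (w : C) : P w = p.[w].
  rewrite horner_poly /P big_mkord; by apply: eq_bigr.
have pp j : (j < n.+1)%N -> (p * p)`_j = 1.
  move=> jn; rewrite coefM -[RHS](rmorph1 (real_complex R)) -(central_conv1 R j).
  rewrite /central_conv big_mkord rmorph_sum/=; apply: eq_bigr => i _.
  rewrite !coef_poly (leq_ltn_trans _ jn) ?leq_ord//.
  by rewrite (leq_ltn_trans (leq_subr _ _) jn) -rmorphM.
pose T j (z : C) : C := (p * p)`_j * (f z * (z / rc) ^+ j * (rc / z) ^+ n).
have Td j : circ_diff r (T j).
  move=> z /disk_r[z0 z1]; apply: cderivableM; first exact: cderivable_cst.
  apply: cderivableM; last by apply: cderivableX; exact: divd.
  by apply: cderivableM; [exact: fa|apply: cderivableX; exact: muld].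
have fKE (z : C) : normc z = r ->
    f z * K z = \sum_(0 <= j < n.+1 + n.+1) T j z.
  move=> zr; rewrite /K pE expr2 -hornerM (@horner_coef_wide _ (n.+1 + n.+1)); last first.
    apply: leq_trans (size_polyMleq _ _) _; apply: leq_trans (leq_pred _) _.
    by apply: leq_add; exact: size_poly.
  rewrite mulr_suml mulr_sumr big_mkord; apply: eq_bigr => j _.
  by rewrite /T; ring.
rewrite (eq_circle_mean r_gt0 fKE) (circle_mean_sum r_gt0 _ Td).
have cancel (z : C) m : z != 0 -> (z / rc) ^+ m * (rc / z) ^+ m = 1.
  by move=> z0; rewrite -exprMn mulrA divfK// mulfV// expr1n.
have high : \sum_(n.+1 <= j < n.+1 + n.+1) circle_mean (T j) r = 0.
  rewrite big_nat big1// => j /andP[nj _].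
  pose c : C := (p * p)`_j / rc ^+ (j - n).
  have Gd : circ_diff r (fun z => f z * z ^+ (j - n)).
    move=> z /disk_r[z0 z1]; apply: cderivableM; first exact: fa.
    by apply: cderivableX; exact: cderivable_id.
  rewrite (@eq_circle_mean _ r r_gt0 _ (fun z => c * (f z * z ^+ (j - n)))).
    rewrite (circle_meanZ r_gt0 _ Gd) (circle_mean_times_power fa fM r01) ?mulr0//.
    by rewrite subn_gt0.
  move=> z /disk_r[z0 _]; rewrite /T /c.
  have -> : (z / rc) ^+ j = (z / rc) ^+ (j - n) * (z / rc) ^+ n.
    by rewrite -exprD subnK// ltnW.
  by rewrite -!mulrA cancel// mulr1 expr_div_n; ring.
rewrite [RHS](@big_cat_nat _ _ _ n.+1) ?leq_addr//= high addr0.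
rewrite [LHS]big_nat_rev/=; apply: eq_big_nat => j /andP[_ jn].
rewrite add0n subSS; apply/esym.
rewrite (@eq_circle_mean _ r r_gt0 _ (fun z => rc ^+ (n - j) * (f z / z ^+ (n - j)))).
  rewrite (circle_meanZ r_gt0 _ (circ_diff_over_power (k := (n - j)%N) fa r01)).
  by rewrite (cauchy_coefE fa _ r01) mulrC rmorphXn.
move=> z /disk_r[z0 _]; rewrite /T pp// mul1r.
have -> : (rc / z) ^+ n = (rc / z) ^+ (n - j) * (rc / z) ^+ j.
  by rewrite -exprD subnK.
by rewrite mulrACA cancel// mulr1 expr_div_n; ring.
Qed.

End LandauBound.

Lemma landau_partial_sum (f : C -> C) (M : R) (n : nat) : analytic f ->
  (forall z, disk z -> normc (f z) <= M) ->
  normc (\sum_(0 <= k < n) cauchy_coef f k) <=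
  \sum_(0 <= k < n) 2 * M / k.+1%:R.
Proof.
move=> fa fM; case: n => [|n]; first by rewrite !big_nil normc0.
have M0 := bound_ge0 fM.
apply: radial_bound => r r01.
apply: le_trans (landau_partial_sum_radius fa fM n r01) _.
rewrite mulr_sumr; apply: ler_sum => k _.
by apply: ler_wpM2l; [lra|exact: central_coef_sqr].
Qed.

(** Abel summation spreads the logarithmic bound at the boundary point 1 over
    the radius: the majorant has mu-integral the sum of 2 M mu_k / (k + 1). *)
Lemma taylor_partial_sum_bound (f : C -> C) (M t : R) (n : nat) : analytic f ->
  (forall z, disk z -> normc (f z) <= M) -> 0 <= t < 1 ->
  normc (\sum_(0 <= k < n) cauchy_coef f k * (t ^+ k)%:C%C) <=
  \sum_(0 <= k < n) 2 * M / k.+1%:R * t ^+ k.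
Proof.
move=> fa fM /andP[t0 t1].
apply: abel_bound => [m|k|k]; first exact: landau_partial_sum.
  by rewrite exprS ler_piMl ?exprn_ge0// ltW.
exact: exprn_ge0.
Qed.

Lemma cauchy_coef_bound (f : C -> C) (M : R) : analytic f ->
  (forall z, disk z -> normc (f z) <= M) ->
  forall k, normc (cauchy_coef f k) <= 2 * M.
Proof.
move=> fa fM k.
have := @radial_bound R (fun j => cauchy_coef f k * (k == j)%:R) k.+1 (2 * M).
rewrite (sum_kronecker (fun=> cauchy_coef f k))//; apply => r r01.
under eq_bigr do rewrite mulrAC.
rewrite (sum_kronecker (fun j => cauchy_coef f k * (r ^+ j)%:C%C))//.
rewrite normcM normcR ger0_norm.
  exact: (cauchy_coef_bound_radius fa fM).
by rewrite exprn_ge0//; case/andP: r01 => /ltW.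
Qed.

Lemma hinfty_expansion (f : C -> C) (M : R) : analytic f ->
  (forall z, disk z -> normc (f z) <= M) ->
  disk_coefs (cauchy_coef f) /\ (forall z, disk z -> f z = psum (cauchy_coef f) z).
Proof.
move=> fa fM; have cD := bounded_disk_coefs (cauchy_coef_bound fa fM).
split=> // z z1; apply: cvgc_unique (psum_cvg cD z1).
exact: cauchy_expansion fa fM _ z1.
Qed.

Lemma taylor_cauchy_coef (f : C -> C) (M : R) : analytic f ->
  (forall z, disk z -> normc (f z) <= M) -> taylor_coef f = cauchy_coef f.
Proof.
move=> fa fM; have [cD cE] := hinfty_expansion fa fM.
by apply/funext; exact: psum_taylor_coef.
Qed.

End PartialSums.

(** * Cauchy transforms of densities on the radius *)

Section CauchyIntegrals.
Variable R : realType.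
Local Notation C := (R[i]^o).
Variable mu : {finite_measure set (measurableTypeR R) -> \bar R}.
Local Notation D01 := (`[0%R, 1%R[%classic : set (measurableTypeR R)).

Lemma D01_itv (t : R) : D01 t -> 0 <= t < 1.
Proof. by rewrite /= in_itv/=. Qed.

Lemma mD01 : measurable D01.
Proof. exact: measurable_itv. Qed.

Lemma mu_D01_fin : (mu D01 < +oo)%E.
Proof. by rewrite ltey_eq fin_num_measure//; exact: mD01. Qed.

Lemma measurable_power (n : nat) : measurable_fun D01 (fun t : R => t ^+ n).
Proof. by apply: measurable_funX; exact: measurable_id. Qed.

Lemma power_itv (t : R) n : 0 <= t < 1 -> 0 <= t ^+ n <= 1.
Proof.
by move=> /andP[t0 t1]; rewrite exprn_ge0//= exprn_ile1// ltW.
Qed.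

Lemma moment_ge0 n : 0 <= moment mu n.
Proof.
by apply: Rintegral_ge0 => t /D01_itv/power_itv-/(_ n)/andP[].
Qed.

Lemma integrable_power n : mu.-integrable D01 (EFin \o (fun t : R => t ^+ n)).
Proof.
apply: (@bounded_integrable _ _ _ _ _ _ 1); [exact: mD01|exact: mu_D01_fin| |].
  exact: measurable_power.
by move=> t /D01_itv/power_itv-/(_ n)/andP[? ?]; rewrite ger0_norm.
Qed.

Lemma moment_nonincreasing m n : (m <= n)%N -> moment mu n <= moment mu m.
Proof.
move=> mn; apply: le_Rintegral; [exact: mD01|exact: integrable_power..|].
by move=> t /D01_itv/andP[t0 t1]; rewrite ler_wiXn2l// ltW.
Qed.

Lemma one_sub_neq0 (t : R) (z : C) : 0 <= t < 1 -> disk z -> 1 - t%:C%C * z != 0.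
Proof.
move=> /andP[t0 t1] z1; have z1' : normc z < 1 by [].
rewrite -normc_gt0; have := normcBl 1 (t%:C%C * z).
rewrite normc1 normcM normcR ger0_norm//.
have := ler_wpM2r (normc_ge0 z) (ltW t1); rewrite mul1r; lra.
Qed.

Lemma one_sub_lower (t : R) (z : C) : 0 <= t < 1 ->
  1 - normc z <= normc (1 - t%:C%C * z).
Proof.
move=> /andP[t0 t1]; have := normcBl 1 (t%:C%C * z).
rewrite normc1 normcM normcR ger0_norm//.
have := ler_wpM2r (normc_ge0 z) (ltW t1); rewrite mul1r; lra.
Qed.

Lemma geometric_series_cvg (x : C) : disk x ->
  (fun n => \sum_(0 <= k < n) x ^+ k) @ \oo --> (1 - x)^-1.
Proof.
move=> x1; have x1' : normc x < 1 by [].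
have x0 : 1 - x != 0.
  by rewrite subr_eq0; apply/eqP => h; move: x1'; rewrite -h normc1 ltxx.
have E n : \sum_(0 <= k < n) x ^+ k - (1 - x)^-1 = - (x ^+ n / (1 - x)).
  elim: n => [|n ih]; first by rewrite big_nil expr0 mul1r sub0r.
  by rewrite big_nat_recr//= addrAC ih exprS; field.
apply: (@cvgc_squeeze _ _ _ (fun n => (normc (1 - x))^-1 * normc x ^+ n)).
  by move=> n; rewrite E normcN normcM normcV normcX mulrC.
by apply: geometric_cvg0; rewrite normc_ge0.
Qed.

Lemma disk_scale (t : R) (z : C) : 0 <= t < 1 -> disk z -> disk (t%:C%C * z).
Proof.
move=> /andP[t0 t1] z1; apply/diskP; rewrite normcM normcR ger0_norm//.
by apply: le_lt_trans z1; rewrite -[leRHS]mul1r ler_wpM2r ?normc_ge0// ltW.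
Qed.

Lemma cmeasurable_kernel (z : C) : disk z ->
  cmeasurable D01 (fun t : R => (1 - t%:C%C * z)^-1).
Proof.
move=> z1.
apply: (@cmeasurable_cvg _ (measurableTypeR R) R D01
  (fun n (t : R) => (\sum_(0 <= k < n) (t%:C%C * z) ^+ k : C))).
  elim=> [|n ih].
    rewrite (_ : (fun t : R => _) = (fun=> 0 : C)); first exact: cmeasurable_cst.
    by apply/funext => t; rewrite big_nil.
  rewrite (_ : (fun t : R => _) = (fun t : R =>
    (\sum_(0 <= k < n) (t%:C%C * z) ^+ k : C) + (t ^+ n)%:C%C * z ^+ n)).
    apply: cmeasurableD => //; apply: cmeasurableM; last exact: cmeasurable_cst.
    by apply: cmeasurable_real; exact: measurable_power.
  by apply/funext => t; rewrite big_nat_recr//= exprMn rmorphXn.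
by move=> t /D01_itv t1; apply: geometric_series_cvg; exact: disk_scale.
Qed.

Section Density.
Variables (w : R -> C) (M : R).
Hypothesis mw : cmeasurable D01 w.
Hypothesis wM : forall t, 0 <= t < 1 -> normc (w t) <= M.

Definition cmoment n : C := Cint mu D01 (fun t => (t ^+ n)%:C%C * w t).

Definition wmoment n : R := (\int[mu]_(t in D01) (t ^+ n * normc (w t)))%R.

Definition cauchy_int (z : C) : C := Cint mu D01 (fun t => w t / (1 - t%:C%C * z)).

Definition cauchy_int' (z : C) : C :=
  Cint mu D01 (fun t => t%:C%C * w t / (1 - t%:C%C * z) ^+ 2).

Let M_ge0 : 0 <= M.
Proof. by apply: le_trans (normc_ge0 _) (@wM 0 _); rewrite lexx ltr01. Qed.

Lemma cintegrable_moment n : cintegrable mu D01 (fun t => (t ^+ n)%:C%C * w t).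
Proof.
apply: (@bounded_cintegrable _ _ _ _ _ _ M); [exact: mD01|exact: mu_D01_fin| |].
  by apply: cmeasurableM => //; apply: cmeasurable_real; exact: measurable_power.
move=> t /D01_itv t1; have /andP[h0 h1] := power_itv n t1.
rewrite normcM normcR ger0_norm//; apply: le_trans (wM t1).
by rewrite ler_piMl ?normc_ge0.
Qed.

Lemma integrable_wmoment n :
  mu.-integrable D01 (EFin \o (fun t => t ^+ n * normc (w t))).
Proof.
apply: (@bounded_integrable _ _ _ _ _ _ M); [exact: mD01|exact: mu_D01_fin| |].
  apply: measurable_funM; first exact: measurable_power.
  exact: cmeasurable_normc.
move=> t /D01_itv t1; have /andP[h0 h1] := power_itv n t1.
rewrite ger0_norm ?mulr_ge0 ?normc_ge0//; apply: le_trans (wM t1).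
by rewrite ler_piMl ?normc_ge0.
Qed.

Lemma wmoment_ge0 n : 0 <= wmoment n.
Proof.
apply: Rintegral_ge0 => t /D01_itv/power_itv-/(_ n)/andP[? _].
by rewrite mulr_ge0 ?normc_ge0.
Qed.

Lemma wmoment_nonincreasing m n : (m <= n)%N -> wmoment n <= wmoment m.
Proof.
move=> mn; apply: le_Rintegral; [exact: mD01|exact: integrable_wmoment..|].
move=> t /D01_itv/andP[t0 t1]; rewrite ler_wpM2r ?normc_ge0//.
by rewrite ler_wiXn2l// ltW.
Qed.

Lemma wmoment_le n : wmoment n <= M * moment mu n.
Proof.
rewrite /moment -RintegralZl; [|exact: mD01|exact: integrable_power].
apply: le_Rintegral; [exact: mD01|exact: integrable_wmoment| |].
  have := integrableZl mD01 M (integrable_power n).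
  by apply: eq_integrable => //; exact: mD01.
move=> t /D01_itv t1; have /andP[h0 h1] := power_itv n t1.
by rewrite mulrC ler_wpM2r// wM.
Qed.

Lemma cmoment_le n : normc (cmoment n) <= 2 * wmoment n.
Proof.
apply: normc_Cint_le; [exact: mD01|exact: cintegrable_moment
  |exact: integrable_wmoment|].
move=> t /D01_itv/power_itv-/(_ n)/andP[h0 _].
by rewrite normcM normcR ger0_norm.
Qed.

Lemma cmoment_bounded n : normc (cmoment n) <= 2 * (M * moment mu 0).
Proof.
apply: le_trans (cmoment_le n) _; rewrite ler_pM2l//.
by apply: le_trans (wmoment_le n) _; rewrite ler_wpM2l// moment_nonincreasing.
Qed.

Lemma cauchy_int_cvg (z : C) : disk z ->
  series (fun n => cmoment n * z ^+ n) @ \oo --> cauchy_int z.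
Proof.
move=> z1; have z1' : normc z < 1 by [].
have E n : series (fun n => cmoment n * z ^+ n) n =
    Cint mu D01 (fun t => \sum_(0 <= k < n) z ^+ k * ((t ^+ k)%:C%C * w t)).
  rewrite Cint_sum; [|exact: mD01|by move=> k; apply: cintegrableZ;
    [exact: mD01|exact: cintegrable_moment]].
  rewrite /series/=; apply: eq_bigr => k _.
  have h := CintZ (z ^+ k) mD01 (cintegrable_moment k).
  by rewrite h mulrC.
rewrite (_ : series _ = (fun n => Cint mu D01 (fun t =>
    \sum_(0 <= k < n) z ^+ k * ((t ^+ k)%:C%C * w t)))); last first.
  by apply/funext => n; exact: E.
have FE (t : R) n : \sum_(0 <= k < n) z ^+ k * ((t ^+ k)%:C%C * w t) =
    w t * \sum_(0 <= k < n) (t%:C%C * z) ^+ k.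
  by rewrite mulr_sumr; apply: eq_bigr => k _; rewrite exprMn rmorphXn; ring.
apply: (@Cint_dominated_cvg _ _ _ _ _ _ _ (fun=> M * (1 - normc z)^-1)).
- exact: mD01.
- move=> n; apply: cintegrable_meas; apply: cintegrable_sum; first exact: mD01.
  by move=> k; apply: cintegrableZ; [exact: mD01|exact: cintegrable_moment].
- move=> t /D01_itv t1; under eq_fun do rewrite FE mulrC.
  rewrite [_ / _]mulrC; apply: cvgcMl.
  by apply: geometric_series_cvg; exact: disk_scale.
- apply: (@bounded_integrable _ _ _ _ _ _ `|M * (1 - normc z)^-1|) => //.
  exact: mu_D01_fin.
- move=> n t /D01_itv t1; rewrite FE normcM; apply: ler_pM; rewrite ?normc_ge0 ?wM//.
  have zz : 0 <= normc z < 1 by rewrite normc_ge0.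
  apply: le_trans (normc_sum _ _ _) (le_trans _ (geometric_sum_le n zz)).
  apply: ler_sum => k _; rewrite normcX; apply: lerXn2r; rewrite ?nnegrE ?normc_ge0//.
  have /andP[t0 t1'] := t1; rewrite normcM normcR ger0_norm//.
  by rewrite ler_piMl ?normc_ge0// ltW.
Qed.

Lemma cmeasurable_cauchy (z : C) : disk z ->
  cmeasurable D01 (fun t => w t / (1 - t%:C%C * z)).
Proof. by move=> z1; apply: cmeasurableM => //; exact: cmeasurable_kernel. Qed.

Lemma cmeasurable_cauchy' (z : C) : disk z ->
  cmeasurable D01 (fun t => t%:C%C * w t / (1 - t%:C%C * z) ^+ 2).
Proof.
move=> z1; rewrite (_ : (fun _ => _) = (fun t : R => t%:C%C * w t *
    ((1 - t%:C%C * z)^-1 * (1 - t%:C%C * z)^-1))); last first.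
  by apply/funext => t; rewrite -expr2 exprVn.
apply: cmeasurableM.
  apply: cmeasurableM => //; apply: cmeasurable_real; exact: measurable_id.
by apply: cmeasurableM; exact: cmeasurable_kernel.
Qed.

Lemma cintegrable_cauchy (z : C) : disk z ->
  cintegrable mu D01 (fun t => w t / (1 - t%:C%C * z)).
Proof.
move=> z1; have z1' : normc z < 1 by [].
apply: (@bounded_cintegrable _ _ _ _ _ _ (M / (1 - normc z)));
  [exact: mD01|exact: mu_D01_fin|exact: cmeasurable_cauchy|].
move=> t /D01_itv t1; rewrite normcM normcV; apply: ler_pM;
  rewrite ?invr_ge0 ?normc_ge0 ?wM// lef_pV2 ?posrE ?subr_gt0//.
  exact: one_sub_lower.
by rewrite normc_gt0 one_sub_neq0.
Qed.

Lemma cintegrable_cauchy' (z : C) : disk z ->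
  cintegrable mu D01 (fun t => t%:C%C * w t / (1 - t%:C%C * z) ^+ 2).
Proof.
move=> z1; have z1' : normc z < 1 by [].
apply: (@bounded_cintegrable _ _ _ _ _ _ (M / (1 - normc z) ^+ 2));
  [exact: mD01|exact: mu_D01_fin|exact: cmeasurable_cauchy'|].
move=> t /D01_itv t1; have /andP[t0 t1'] := t1.
rewrite normcM normcV normcX; apply: ler_pM;
  rewrite ?invr_ge0 ?exprn_ge0 ?normc_ge0//.
  rewrite normcM normcR ger0_norm//; apply: le_trans (wM t1).
  by rewrite ler_piMl ?normc_ge0// ltW.
have h := one_sub_lower z t1.
have h0 : 0 < 1 - normc z by lra.
rewrite lef_pV2 ?posrE ?exprn_gt0//; last by lra.
by apply: lerXn2r => //; rewrite nnegrE; lra.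
Qed.

Lemma cauchy_int_cdiff (z : C) : disk z -> cdiff cauchy_int z (cauchy_int' z).
Proof.
move=> z1 e e0; have z1' : normc z < 1 by []; have z0 := normc_ge0 z.
pose d := (1 - normc z) / 2.
have d0 : 0 < d by rewrite /d; lra.
pose V := 2 * (M / d ^+ 3 * fine (mu D01)).
have V0 : 0 <= V.
  rewrite /V mulr_ge0// mulr_ge0 ?fine_ge0// divr_ge0 ?exprn_ge0//; exact: ltW.
exists (Num.min d (e / (V + 1))); first by rewrite lt_min d0 divr_gt0//; lra.
move=> v; rewrite lt_min => /andP[vd ve].
have vz := normcD (v - z) z; rewrite subrK in vz.
have v1' : normc v < 1 by rewrite /d in vd; lra.
have v1 : disk v by [].
have h0 := normc_ge0 (v - z).
suff H : normc (cauchy_int v - cauchy_int z - cauchy_int' z * (v - z)) <=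
    V * normc (v - z) ^+ 2.
  apply: le_trans H _; rewrite expr2 mulrA ler_wpM2r//.
  move: ve; rewrite ltr_pdivlMr; last by lra.
  by rewrite mulrDr mulr1 [normc (v - z) * V]mulrC; lra.
have iv := cintegrable_cauchy v1; have iz := cintegrable_cauchy z1.
have iz' := cintegrableZ (v - z) mD01 (cintegrable_cauchy' z1).
have -> : cauchy_int v - cauchy_int z - cauchy_int' z * (v - z) =
  Cint mu D01 (fun t => w t / (1 - t%:C%C * v) - w t / (1 - t%:C%C * z) -
    (v - z) * (t%:C%C * w t / (1 - t%:C%C * z) ^+ 2)).
  rewrite CintB; [|exact: mD01|by apply: cintegrableB => //; exact: mD01|exact: iz'].
  rewrite CintB; [|exact: mD01|exact: iv|exact: iz].
  rewrite CintZ; [|exact: mD01|exact: cintegrable_cauchy'].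
  by rewrite [_ * (v - z)]mulrC.
have -> : V * normc (v - z) ^+ 2 =
    2 * (\int[mu]_(t in D01) (M / d ^+ 3 * normc (v - z) ^+ 2))%R.
  by rewrite Rintegral_cst ?mD01// /V; ring.
apply: normc_Cint_le; [exact: mD01| | |].
- apply: cintegrableB; [exact: mD01| |exact: iz'].
  by apply: cintegrableB => //; exact: mD01.
- apply: (@bounded_integrable _ _ _ _ _ _ `|M / d ^+ 3 * normc (v - z) ^+ 2|) => //.
  exact: mu_D01_fin.
move=> t /D01_itv t1; have /andP[t0 t1'] := t1.
have nv := one_sub_neq0 t1 v1; have nz := one_sub_neq0 t1 z1.
have -> : w t / (1 - t%:C%C * v) - w t / (1 - t%:C%C * z) -
    (v - z) * (t%:C%C * w t / (1 - t%:C%C * z) ^+ 2) =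
    t%:C%C ^+ 2 * w t * (v - z) ^+ 2 / ((1 - t%:C%C * v) * (1 - t%:C%C * z) ^+ 2).
  by field; rewrite nv nz.
have lv : d <= normc (1 - t%:C%C * v).
  by have := one_sub_lower v t1; rewrite /d in vd *; lra.
have lz : d <= normc (1 - t%:C%C * z).
  by have := one_sub_lower z t1; rewrite /d; lra.
rewrite normcM normcV [M / _ * _]mulrAC; apply: ler_pM;
  rewrite ?invr_ge0 ?normc_ge0//.
  rewrite normcM [normc ((v - z) ^+ 2)]normcX [normc (_ * w t)]normcM normcX.
  apply: ler_wpM2r; first exact: exprn_ge0.
  rewrite -[leRHS]mul1r; apply: ler_pM; rewrite ?exprn_ge0 ?normc_ge0 ?wM//.
  by rewrite normcR ger0_norm// exprn_ile1// ltW.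
have lv0 := lt_le_trans d0 lv; have lz0 := lt_le_trans d0 lz.
have p1 : 0 < normc (1 - t%:C%C * v) * normc (1 - t%:C%C * z) ^+ 2.
  by rewrite mulr_gt0// exprn_gt0.
have p2 : 0 < d ^+ 3 by rewrite exprn_gt0.
rewrite normcM normcX lef_pV2 ?posrE//.
by rewrite exprS; apply: ler_pM; rewrite ?exprn_ge0 ?(ltW d0)//; apply: lerXn2r;
  rewrite ?nnegrE ?normc_ge0 ?(ltW d0).
Qed.

Section Transform.
Variable h : C -> C.
Hypothesis hE : forall z, disk z -> h z = cauchy_int z.

Lemma transform_cdiff z : disk z -> cdiff h z (cauchy_int' z).
Proof.
move=> z1; apply: (cdiff_disk z1) (cauchy_int_cdiff z1) => v v1.
by rewrite hE.
Qed.

Lemma transform_analytic : analytic h.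
Proof. by move=> z /transform_cdiff; exact: cdiff_derivable. Qed.

Lemma transform_derive1 z : disk z -> derive1 h z = cauchy_int' z.
Proof. by move=> /transform_cdiff/cdiff_derive1. Qed.

Lemma transform_taylor_coef n : taylor_coef h n = cmoment n.
Proof.
have cD := bounded_disk_coefs cmoment_bounded.
apply: psum_taylor_coef => // z z1; rewrite hE//.
exact: cvgc_unique (cauchy_int_cvg z1) (psum_cvg cD z1).
Qed.

End Transform.
End Density.
End CauchyIntegrals.

(** * The generalized Hilbert operator as a Cauchy transform *)

Section NonnegativeSeries.
Variable R : realType.

Lemma nneseries_bound (u : nat -> R) (B : R) :
  (forall k, 0 <= u k) -> (forall n, \sum_(0 <= k < n) u k <= B) ->
  (\sum_(0 <= k <oo) (u k)%:E <= B%:E)%E.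
Proof.
move=> u0 uB; apply: lime_le.
  by apply: is_cvg_nneseries => n _ _; rewrite lee_fin.
by apply: nearW => n; rewrite sumEFin lee_fin.
Qed.

Lemma nneseries_partial (u : nat -> R) n : (forall k, 0 <= u k) ->
  ((\sum_(0 <= k < n) u k)%:E <= \sum_(0 <= k <oo) (u k)%:E)%E.
Proof.
move=> u0; rewrite -sumEFin; apply: nneseries_lim_ge => k _ _.
by rewrite lee_fin.
Qed.

Lemma nneseries_lty (u : nat -> R) : (forall k, 0 <= u k) ->
  (\sum_(0 <= k <oo) (u k)%:E < +oo)%E <->
  exists B, forall n, \sum_(0 <= k < n) u k <= B.
Proof.
move=> u0; split=> [ufin|[B uB]]; last first.
  by apply: le_lt_trans (nneseries_bound u0 uB) _; rewrite ltry.
exists (fine (\sum_(0 <= k <oo) (u k)%:E)%E) => n.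
rewrite -lee_fin fineK; first exact: nneseries_partial.
rewrite ge0_fin_numE// nneseries_ge0// => k _ _; by rewrite lee_fin.
Qed.

End NonnegativeSeries.

Section HilbertRepresentation.
Variable R : realType.
Local Notation C := (R[i]^o).
Variable mu : {finite_measure set (measurableTypeR R) -> \bar R}.
Local Notation D01 := (`[0%R, 1%R[%classic : set (measurableTypeR R)).

Definition radial (f : C -> C) (t : R) : C := f t%:C%C.

Lemma disk_real (t : R) : 0 <= t < 1 -> disk (t%:C%C : C).
Proof. by move=> /andP[t0 t1]; apply/diskP; rewrite normcR ger0_norm. Qed.

Lemma Cint_power n : Cint mu D01 (fun t => (t ^+ n)%:C%C) = (moment mu n)%:C%C.
Proof.
rewrite /Cint /= /moment; congr Complex.
by rewrite /Rintegral integral0.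
Qed.

Section Bounded.
Variables (f : C -> C) (M : R).
Hypothesis fa : analytic f.
Hypothesis fM : forall z, disk z -> normc (f z) <= M.

Lemma radial_bounded t : 0 <= t < 1 -> normc (radial f t) <= M.
Proof. by move=> /disk_real/fM. Qed.

Lemma radial_partial_sum_cvg t : 0 <= t < 1 ->
  (fun n => \sum_(0 <= k < n) cauchy_coef f k * (t ^+ k)%:C%C) @ \oo --> radial f t.
Proof.
move=> t1; have := cauchy_expansion fa fM (disk_real t1).
rewrite (_ : series _ = (fun n => \sum_(0 <= k < n) cauchy_coef f k * (t ^+ k)%:C%C))//.
by apply/funext => n; rewrite /series/=; apply: eq_bigr => k _; rewrite rmorphXn.
Qed.

Lemma cmeasurable_partial_sum n :
  cmeasurable D01 (fun t : R => \sum_(0 <= k < n) cauchy_coef f k * (t ^+ k)%:C%C).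
Proof.
elim: n => [|n ih].
  rewrite (_ : (fun t : R => _) = (fun=> 0 : C)); first exact: cmeasurable_cst.
  by apply/funext => t; rewrite big_nil.
rewrite (_ : (fun t : R => _) = (fun t : R =>
    (\sum_(0 <= k < n) cauchy_coef f k * (t ^+ k)%:C%C : C) +
    cauchy_coef f n * (t ^+ n)%:C%C)).
  apply: cmeasurableD => //; apply: cmeasurableM; first exact: cmeasurable_cst.
  by apply: cmeasurable_real; exact: measurable_power.
by apply/funext => t; rewrite big_nat_recr.
Qed.

Lemma cmeasurable_radial : cmeasurable D01 (radial f).
Proof.
apply: (@cmeasurable_cvg _ (measurableTypeR R) R D01
  (fun n (t : R) => (\sum_(0 <= k < n) cauchy_coef f k * (t ^+ k)%:C%C : C))).
  exact: cmeasurable_partial_sum.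
by move=> t /D01_itv t1; exact: radial_partial_sum_cvg.
Qed.

Let p k (t : R) := 2 * M / k.+1%:R * t ^+ k.

Let p_ge0 k t : 0 <= t < 1 -> 0 <= p k t.
Proof.
move=> /power_itv-/(_ k)/andP[h _]; rewrite mulr_ge0// divr_ge0//.
by have := bound_ge0 fM; lra.
Qed.

Let ge (t : R) : \bar R := (\sum_(0 <= k <oo) (p k t)%:E)%E.

Let ge_fin t : 0 <= t < 1 -> ge t \is a fin_num.
Proof.
move=> t1; rewrite ge0_fin_numE; last first.
  by apply: nneseries_ge0 => k _ _; rewrite lee_fin p_ge0.
apply/nneseries_lty; first by move=> k; exact: p_ge0.
exists (2 * M * (1 - t)^-1) => n; have M0 := bound_ge0 fM.
apply: (@le_trans _ _ (\sum_(0 <= k < n) 2 * M * t ^+ k)).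
  apply: ler_sum => k _; apply: ler_wpM2r.
    by have /andP[] := power_itv k t1.
  by rewrite ler_piMr ?mulr_ge0// invf_le1 ?ltr0n// ler1n.
by rewrite -mulr_sumr ler_wpM2l ?mulr_ge0// geometric_sum_le.
Qed.

Let p_integrable k : mu.-integrable D01 (EFin \o p k).
Proof.
have := integrableZl (@mD01 R) (2 * M / k.+1%:R) (integrable_power mu k).
by apply: eq_integrable => //; exact: mD01.
Qed.

Let ge_integrable (S : R) :
  (forall n, \sum_(0 <= k < n) moment mu k / k.+1%:R <= S) ->
  mu.-integrable D01 ge.
Proof.
move=> HS; have M0 := bound_ge0 fM.
have mp k : measurable_fun D01 (fun t : measurableTypeR R => (p k t)%:E).
  apply/measurable_EFinP; apply: measurable_funM; first exact: measurable_cst.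
  exact: measurable_power.
apply/integrableP; split.
  apply: (ge0_emeasurable_sum (P := xpredT) (h := fun k t => (p k t)%:E)) => //.
    by move=> k t /D01_itv t1 _; rewrite lee_fin p_ge0.
  by move=> k _; exact: mp.
have -> : (\int[mu]_(t in D01) `|ge t| = \int[mu]_(t in D01) ge t)%E.
  apply: eq_integral => t; rewrite inE => /D01_itv t1; rewrite gee0_abs//.
  by apply: nneseries_ge0 => k _ _; rewrite lee_fin p_ge0.
rewrite /ge integral_nneseries//.
have E k : (\int[mu]_(t in D01) (p k t)%:E = (2 * M * (moment mu k / k.+1%:R))%:E)%E.
  rewrite -[LHS]fineK; last by apply: integrable_fin_num; [exact: mD01|exact: p_integrable].
  congr (_%:E); rewrite [LHS](_ : _ = (\int[mu]_(t in D01) p k t)%R)//.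
  rewrite RintegralZl; [|exact: mD01|exact: integrable_power].
  by rewrite /moment; ring.
under eq_eseriesr do rewrite E.
apply/nneseries_lty => [k|].
  by rewrite mulr_ge0 ?divr_ge0 ?moment_ge0// mulr_ge0.
exists (2 * M * S) => n; rewrite -mulr_sumr ler_wpM2l// mulr_ge0//.
Qed.

(** The inner series need not converge absolutely; its convergence is dominated
    convergence under the integral, with the logarithmic majorant of the Taylor
    partial sums. *)
Lemma hilbert_inner_cvg (S : R) n :
  (forall n, \sum_(0 <= k < n) moment mu k / k.+1%:R <= S) ->
  hilbert_inner mu f n @ \oo --> cmoment mu (radial f) n.
Proof.
move=> HS; have ip k : cintegrable mu D01 (fun t => (t ^+ k)%:C%C : C).
  apply: (@bounded_cintegrable _ _ _ _ _ _ 1); [exact: mD01|exact: mu_D01_fin| |].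
    by apply: cmeasurable_real; exact: measurable_power.
  by move=> t /D01_itv/power_itv-/(_ k)/andP[? ?]; rewrite normcR ger0_norm.
have E m : hilbert_inner mu f n m = Cint mu D01 (fun t => (t ^+ n)%:C%C *
    (\sum_(0 <= k < m) cauchy_coef f k * (t ^+ k)%:C%C)).
  rewrite /hilbert_inner /series/= (taylor_cauchy_coef fa fM).
  transitivity (\sum_(0 <= k < m)
      Cint mu D01 (fun t => cauchy_coef f k * (t ^+ (n + k))%:C%C)).
    apply: eq_bigr => k _.
    have h := CintZ (cauchy_coef f k) (@mD01 R) (ip (n + k)%N).
    by rewrite h Cint_power mulrC.
  rewrite -Cint_sum; [|exact: mD01|by move=> k; apply: cintegrableZ; [exact: mD01|exact: ip]].
  apply: eq_Cint => t _; rewrite mulr_sumr; apply: eq_bigr => k _.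
  by rewrite exprD rmorphM/=; ring.
rewrite (_ : hilbert_inner mu f n = (fun m => Cint mu D01 (fun t => (t ^+ n)%:C%C *
    (\sum_(0 <= k < m) cauchy_coef f k * (t ^+ k)%:C%C)))); last by apply/funext.
apply: (@Cint_dominated_cvg _ (measurableTypeR R) R mu D01 _ _ (fun t : R => fine (ge t))).
- exact: mD01.
- move=> m; apply: cmeasurableM; last exact: cmeasurable_partial_sum.
  by apply: cmeasurable_real; exact: measurable_power.
- move=> t /D01_itv t1; rewrite [_ * radial f t]mulrC.
  under eq_fun do rewrite mulrC.
  by apply: cvgcMl; exact: radial_partial_sum_cvg.
- have := ge_integrable HS; apply: eq_integrable; first exact: mD01.
  by move=> t; rewrite inE => /D01_itv t1 /=; rewrite fineK// ge_fin.
- move=> m t /D01_itv t1; have /andP[h0 h1] := power_itv n t1.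
  rewrite normcM normcR ger0_norm//.
  apply: (@le_trans _ _ (normc (\sum_(0 <= k < m) cauchy_coef f k * (t ^+ k)%:C%C))).
    by rewrite ler_piMl// normc_ge0.
  apply: le_trans (taylor_partial_sum_bound m fa fM t1) _.
  rewrite -lee_fin fineK ?ge_fin//; apply: nneseries_partial => k.
  exact: p_ge0.
Qed.

(** The representation starts from the limits of the inner series, so that it also
    applies to the constant function 1 for an arbitrary measure. *)
Section Representation.
Hypothesis inner : forall n, hilbert_inner mu f n @ \oo --> cmoment mu (radial f) n.

Lemma hilbert_coefE n : hilbert_coef mu f n = cmoment mu (radial f) n.
Proof. by apply: cvgc_lim; exact: inner. Qed.

Lemma hilbert_outer_cvg z : disk z ->
  hilbert_outer mu f z @ \oo --> cauchy_int mu (radial f) z.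
Proof.
move=> z1; rewrite (_ : hilbert_outer mu f z =
    series (fun n => cmoment mu (radial f) n * z ^+ n)).
  have h := cauchy_int_cvg (mu := mu) cmeasurable_radial radial_bounded z1; exact: h.
by apply/funext => m; rewrite /hilbert_outer /series/=; apply: eq_bigr => n _; rewrite hilbert_coefE.
Qed.

Lemma hilbertE z : disk z -> hilbert mu f z = cauchy_int mu (radial f) z.
Proof. by move=> /hilbert_outer_cvg/cvgc_lim. Qed.

Lemma hilbert_is_defined : hilbert_defined mu f.
Proof.
split; last exact: (transform_analytic cmeasurable_radial radial_bounded hilbertE).
- by move=> n; apply/cvg_ex; exists (cmoment mu (radial f) n); exact: inner.
- by move=> z z1; apply/cvg_ex; exists (cauchy_int mu (radial f) z); exact: hilbert_outer_cvg.
Qed.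

End Representation.
End Bounded.

Lemma analytic_one : analytic (fun=> 1 : C).
Proof. by move=> z _; exact: cderivable_cst. Qed.

Lemma one_bounded (z : C) : disk z -> normc (1 : C) <= 1.
Proof. by rewrite normc1. Qed.

(** The function 1 has a single nonzero Taylor coefficient. *)
Lemma hilbert_inner_one n :
  hilbert_inner mu (fun=> 1) n @ \oo --> cmoment mu (radial (fun=> 1)) n.
Proof.
have c1 k : cauchy_coef (fun=> 1 : C) k = (0%N == k)%:R.
  have h := @circle_mean_orthogonal R 0 k (1 / 2) (divr_gt0 ltr01 (ltr0n _ 2)).
  rewrite -h /cauchy_coef; congr circle_mean; apply/funext => z; rewrite expr0.
have cm : cmoment mu (radial (fun=> 1)) n = (moment mu n)%:C%C.
  by rewrite -Cint_power; apply: eq_Cint => t _; rewrite mulr1.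
apply/cvg_normcP => e e0; exists 1%N => m m1.
rewrite /hilbert_inner /series/= (taylor_cauchy_coef analytic_one one_bounded).
under eq_bigr do rewrite c1.
by rewrite (sum_kronecker (fun k => (moment mu (n + k))%:C%C)) ?addn0// cm subrr normc0.
Qed.

End HilbertRepresentation.

(** * Estimates of the kernel *)

Section KernelEstimates.
Variable R : realType.
Local Notation C := (R[i]^o).

Lemma kernel_ge_radial (t : R) (z : C) : 0 <= t < 1 -> disk z ->
  1 - t <= normc (1 - t%:C%C * z).
Proof.
move=> /andP[t0 t1] z1; have z1' : normc z < 1 by [].
have := normcBl 1 (t%:C%C * z); rewrite normc1 normcM normcR ger0_norm//.
have := ler_wpM2l t0 (ltW z1'); rewrite mulr1; lra.
Qed.

Lemma kernel_ge_boundary (t : R) (z : C) : 0 <= t < 1 -> disk z ->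
  normc (1 - z) <= 2 * normc (1 - t%:C%C * z).
Proof.
move=> t01 z1; have /andP[t0 t1] := t01; have z1' : normc z < 1 by [].
have h := kernel_ge_radial t01 z1.
have -> : 1 - z = (1 - t%:C%C * z) - (1 - t)%:C%C * z.
  by rewrite rmorphB/= rmorph1; ring.
apply: le_trans (normcBD _ _) _; rewrite normcM normcR ger0_norm; last by lra.
have : (1 - t) * normc z <= (1 - t) * 1 by apply: ler_wpM2l; lra.
lra.
Qed.

(** Here [(1 - t)] times the sum is [1 - t ^ n], while [t ^ n] is at most the
    average of the summands. *)
Lemma truncated_geometric_ge (t : R) n : 0 <= t < 1 -> (0 < n)%N ->
  1 <= ((1 - t) + n%:R^-1) * \sum_(0 <= k < n) t ^+ k.
Proof.
move=> /andP[t0 t1] n0.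
have E : (1 - t) * \sum_(0 <= k < n) t ^+ k = 1 - t ^+ n.
  elim: n {n0} => [|n ih]; first by rewrite big_nil expr0 mulr0 subrr.
  by rewrite big_nat_recr//= mulrDr ih exprS; ring.
rewrite mulrDl E -lerBlDl opprB addrC subrK.
rewrite ler_pdivlMl ?ltr0n//.
have -> : n%:R * t ^+ n = \sum_(0 <= k < n) t ^+ n.
  by rewrite sumr_const_nat subn0 mulr_natl.
rewrite !big_mkord; apply: ler_sum => j _.
by apply: ler_wiXn2l; [|exact: ltW|exact: ltnW].
Qed.

(** At distance at least [1 / n] from 1 the kernel is dominated by a truncated
    geometric series, whose integral is a sum of moments. *)
Lemma kernel_le_geometric (t : R) (z : C) n : 0 <= t < 1 -> disk z -> (0 < n)%N ->
  n%:R^-1 <= normc (1 - z) ->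
  (normc (1 - t%:C%C * z))^-1 <= 3 * \sum_(0 <= k < n) t ^+ k.
Proof.
move=> t01 z1 n0 nz.
have d0 : 0 < normc (1 - t%:C%C * z) by rewrite normc_gt0 one_sub_neq0.
have h1 := kernel_ge_radial t01 z1; have h2 := kernel_ge_boundary t01 z1.
have h3 := truncated_geometric_ge t01 n0.
have S0 : 0 <= \sum_(0 <= k < n) t ^+ k.
  by apply: sumr_ge0 => k _; have /andP[] := power_itv k t01.
rewrite -[leLHS]mul1r ler_pdivrMr// mulrAC.
apply: le_trans h3 _; rewrite -mulrA; move: (\sum_(_ <= _ < _) _) S0 => S S0.
rewrite mulrCA [leRHS]mulrA.
by apply: ler_wpM2r => //; lra.
Qed.

Lemma kernel_le_boundary (t : R) (z : C) n : 0 <= t < 1 -> disk z -> (0 < n)%N ->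
  n%:R^-1 <= normc (1 - z) -> (normc (1 - t%:C%C * z))^-1 <= 2 * n%:R.
Proof.
move=> t01 z1 n0 nz.
have d0 : 0 < normc (1 - t%:C%C * z) by rewrite normc_gt0 one_sub_neq0.
have h2 := kernel_ge_boundary t01 z1.
have n0' : 0 < (n%:R : R) by rewrite ltr0n.
rewrite -[leLHS]mul1r ler_pdivrMr//.
have : 1 <= n%:R * normc (1 - z) by rewrite -ler_pdivrMl// mulr1.
have := ler_wpM2l (ltW n0') h2; lra.
Qed.

Section Density.
Variable mu : {finite_measure set (measurableTypeR R) -> \bar R}.
Local Notation D01 := (`[0%R, 1%R[%classic : set (measurableTypeR R)).
Variables (w : R -> C) (M : R).
Hypothesis mw : cmeasurable D01 w.
Hypothesis wM : forall t, 0 <= t < 1 -> normc (w t) <= M.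

Lemma integrable_wmoment_sum n :
  mu.-integrable D01 (EFin \o (fun t => \sum_(0 <= k < n) t ^+ k * normc (w t))).
Proof.
have M0 : 0 <= M by apply: le_trans (normc_ge0 _) (@wM 0 _); rewrite lexx ltr01.
elim: n => [|n ih].
  rewrite (_ : EFin \o _ = cst 0%E); first exact: integrable0.
  by apply/funext => t; rewrite /= big_nil.
have := integrableD (@mD01 R) ih (integrable_wmoment mu mw wM n).
apply: eq_integrable; first exact: mD01.
by move=> t _ /=; rewrite big_nat_recr//= EFinD.
Qed.

Lemma wmoment_sumE n : (\int[mu]_(t in D01)
    (\sum_(0 <= k < n) t ^+ k * normc (w t)))%R = \sum_(0 <= k < n) wmoment mu w k.
Proof.
elim: n => [|n ih].
  rewrite big_nil /Rintegral integral0_eq// => t _; by rewrite big_nil.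
rewrite big_nat_recr//= -ih -RintegralD; [|exact: mD01|exact: integrable_wmoment_sum
  |exact: (integrable_wmoment mu mw wM)].
by apply: eq_Rintegral => t _; rewrite big_nat_recr.
Qed.

Lemma cauchy_int_le (z : C) n : disk z -> (0 < n)%N -> n%:R^-1 <= normc (1 - z) ->
  normc (cauchy_int mu w z) <= 6 * \sum_(0 <= k < n) wmoment mu w k.
Proof.
move=> z1 n0 nz; rewrite -wmoment_sumE.
have -> : 6 * (\int[mu]_(t in D01) (\sum_(0 <= k < n) t ^+ k * normc (w t)))%R =
    2 * (\int[mu]_(t in D01) (3 * \sum_(0 <= k < n) t ^+ k * normc (w t)))%R.
  by rewrite RintegralZl; [ring|exact: mD01|exact: integrable_wmoment_sum].
apply: normc_Cint_le; [exact: mD01|exact: (cintegrable_cauchy mu mw wM z1)| |].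
  have := integrableZl (@mD01 R) 3 (integrable_wmoment_sum n).
  by apply: eq_integrable => //; exact: mD01.
move=> t /D01_itv t1; rewrite normcM normcV mulrC -mulr_suml mulrA.
apply: ler_wpM2r; first exact: normc_ge0.
exact: kernel_le_geometric.
Qed.

Lemma cauchy_int'_le (z : C) n : disk z -> (0 < n)%N -> n%:R^-1 <= normc (1 - z) ->
  normc (cauchy_int' mu w z) <= 12 * n%:R * \sum_(0 <= k < n) wmoment mu w k.
Proof.
move=> z1 n0 nz; rewrite -wmoment_sumE.
have -> : 12 * n%:R *
    (\int[mu]_(t in D01) (\sum_(0 <= k < n) t ^+ k * normc (w t)))%R =
    2 * (\int[mu]_(t in D01) (6 * n%:R * \sum_(0 <= k < n) t ^+ k * normc (w t)))%R.
  by rewrite RintegralZl; [ring|exact: mD01|exact: integrable_wmoment_sum].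
apply: normc_Cint_le; [exact: mD01|exact: (cintegrable_cauchy' mu mw wM z1)| |].
  have := integrableZl (@mD01 R) (6 * n%:R) (integrable_wmoment_sum n).
  by apply: eq_integrable => //; exact: mD01.
move=> t /D01_itv t1; have /andP[t0 t1'] := t1.
rewrite normcM normcV normcX normcM normcR ger0_norm// -mulr_suml mulrA mulrAC.
apply: ler_wpM2r; first exact: normc_ge0.
have h1 := kernel_le_geometric t1 z1 n0 nz.
have h2 := kernel_le_boundary t1 z1 n0 nz.
have k0 : 0 <= (normc (1 - t%:C%C * z))^-1 by rewrite invr_ge0 normc_ge0.
rewrite -exprVn expr2.
apply: (@le_trans _ _ ((normc (1 - t%:C%C * z))^-1 * (normc (1 - t%:C%C * z))^-1)).
  by rewrite ler_piMl ?mulr_ge0// ltW.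
apply: le_trans (ler_pM k0 k0 h1 h2) _.
by rewrite le_eqVlt; apply/orP; left; apply/eqP; ring.
Qed.

End Density.
End KernelEstimates.

(** * Weighted sums over dyadic blocks *)

Section DyadicSums.
Variable R : realType.
Variables (q : R) (q_ge1 : 1 <= q).
Implicit Types (W : nat -> R).

Let q_gt0 : 0 < q. Proof. exact: lt_le_trans q_ge1. Qed.

Lemma powR_comparable (a b s : R) : 0 < a -> a / 2 <= b -> b <= 2 * a ->
  b `^ s <= 2 `^ `|s| * a `^ s.
Proof.
move=> a0 ab ba; have b0 : 0 < b by apply: lt_le_trans ab; rewrite divr_gt0.
have [s0|s0] := leP 0 s.
  rewrite ger0_norm// -powRM ?(ltW a0)//.
  by apply: ge0_ler_powR => //; rewrite nnegrE ?mulr_ge0 ?(ltW a0) ?(ltW b0).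
rewrite ltr0_norm//.
have -> : b `^ s = (b `^ (- s))^-1 by rewrite powRN invrK.
have -> : a `^ s = (a `^ (- s))^-1 by rewrite powRN invrK.
rewrite -[leLHS]mul1r ler_pdivrMr ?powR_gt0// mulrAC ler_pdivlMr ?powR_gt0// mul1r.
rewrite -powRM ?(ltW b0)//.
apply: ge0_ler_powR; rewrite ?nnegrE ?mulr_ge0 ?(ltW a0) ?(ltW b0)//; first by rewrite oppr_ge0 ltW.
lra.
Qed.

Lemma powR_inv (x s : R) : 0 <= x -> x^-1 `^ s = (x `^ s)^-1.
Proof. by move=> x0; rewrite -powR_inv1// -powRrM mulN1r powRN. Qed.

(** A leading coefficient below 2 is what makes the dyadic induction contract. If
    [b] is small against [a] the factor [3 / 2] absorbs it, and otherwise [a + b]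
    is at most a multiple of [b]. *)
Lemma quasi_triangle_powR : exists2 L : R, 0 <= L &
  forall a b : R, 0 <= a -> 0 <= b -> (a + b) `^ q <= 3 / 2 * a `^ q + L * b `^ q.
Proof.
pose c : R := (3 / 2) `^ q^-1.
have cq : c `^ q = 3 / 2.
  by rewrite -powRrM mulVf ?lt0r_neq0// powRr1//; lra.
have c1 : 1 < c.
  rewrite ltNge; apply/negP => cl.
  have := @ge0_ler_powR _ q (ltW q_gt0) c 1; rewrite !nnegrE powR_ge0 ler01.
  by move=> /(_ isT isT cl); rewrite cq powR1; lra.
exists (((c - 1)^-1 + 1) `^ q) => [|a b a0 b0]; first exact: powR_ge0.
have d0 : 0 < c - 1 by lra.
have [ba|ab] := leP b ((c - 1) * a).
  rewrite -cq -[c `^ q * _]powRM ?(ltW (lt_trans ltr01 c1))//.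
  rewrite -[leLHS]addr0; apply: lerD; last by rewrite mulr_ge0 ?powR_ge0.
  apply: ge0_ler_powR; rewrite ?nnegrE ?(ltW q_gt0) ?addr_ge0 ?mulr_ge0//; lra.
rewrite -[leLHS]add0r; apply: lerD; first by rewrite mulr_ge0 ?powR_ge0//; lra.
have i0 : 0 < (c - 1)^-1 by rewrite invr_gt0.
rewrite -powRM//; last by lra.
apply: ge0_ler_powR; rewrite ?nnegrE ?(ltW q_gt0) ?addr_ge0 ?mulr_ge0 ?(ltW i0)//.
  by apply: addr_ge0 => //; exact: ltW.
rewrite mulrDl mul1r lerD2r.
by rewrite ler_pdivlMl// ltW.
Qed.

Definition weighted_power W n : R := n.+1%:R `^ (q - 2) * W n `^ q.

Definition dyadic_power W m : R := (2 ^+ m) `^ (q - 1) * W (2 ^ m)%N `^ q.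

Lemma weighted_power_ge0 W n : 0 <= weighted_power W n.
Proof. by rewrite mulr_ge0 ?powR_ge0. Qed.

Lemma pow2_gt0 m : 0 < (2 : R) ^+ m.
Proof. by rewrite exprn_gt0. Qed.

Lemma pow2_powR m : (2 ^+ m : R) * (2 ^+ m) `^ (q - 2) = (2 ^+ m) `^ (q - 1).
Proof.
have p := pow2_gt0 m; rewrite -{1}[2 ^+ m]powRr1 ?(ltW p)// -powRD.
  by congr (_ `^ _); ring.
by rewrite lt0r_neq0// implybT.
Qed.

Lemma dyadic_split (u : nat -> R) N :
  \sum_(0 <= n < 2 ^ N) u n =
  u 0%N + \sum_(0 <= m < N) \sum_(2 ^ m <= n < 2 ^ m.+1) u n.
Proof.
elim: N => [|N ih]; first by rewrite expn0 big_nat1 big_nil addr0.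
rewrite (@big_cat_nat _ _ _ (2 ^ N)%N) ?leq_exp2l//=.
by rewrite ih [in RHS]big_nat_recr//= addrA.
Qed.

Section Monotone.
Variable W : nat -> R.
Hypothesis W_ge0 : forall n, 0 <= W n.
Hypothesis W_le : forall m n, (m <= n)%N -> W n <= W m.

Lemma weighted_block_le m : \sum_(2 ^ m <= n < 2 ^ m.+1) weighted_power W n <=
  2 `^ `|q - 2| * dyadic_power W m.
Proof.
have p := pow2_gt0 m.
apply: (@le_trans _ _ (\sum_(2 ^ m <= n < 2 ^ m.+1)
    2 `^ `|q - 2| * (2 ^+ m) `^ (q - 2) * W (2 ^ m)%N `^ q)).
  apply: ler_sum_nat => n /andP[n1 n2].
  apply: ler_pM; rewrite ?powR_ge0//.
    apply: powR_comparable => //.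
      have : (2 ^+ m : R) <= n.+1%:R by rewrite -natrX ler_nat (leq_trans n1).
      lra.
    by rewrite -exprS -natrX ler_nat.
  apply: ge0_ler_powR; rewrite ?nnegrE ?(ltW q_gt0)//.
  exact: W_le.
rewrite sumr_const_nat expnS mul2n -addnn addnK -[leLHS]mulr_natl natrX.
rewrite /dyadic_power -pow2_powR.
by rewrite le_eqVlt; apply/orP; left; apply/eqP; ring.
Qed.

Lemma dyadic_power_le m : dyadic_power W m.+1 <=
  2 `^ `|q - 2| * 2 * \sum_(2 ^ m <= n < 2 ^ m.+1) weighted_power W n.
Proof.
have p := pow2_gt0 m; have p1 := pow2_gt0 m.+1.
rewrite -mulrA mulr_sumr mulr_sumr.
apply: (@le_trans _ _ (\sum_(2 ^ m <= n < 2 ^ m.+1)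
    2 * ((2 ^+ m.+1) `^ (q - 2) * W (2 ^ m.+1)%N `^ q))).
  have e : (2 ^ m.+1 - 2 ^ m = 2 ^ m)%N by rewrite expnS mul2n -addnn addnK.
  rewrite sumr_const_nat e -[leRHS]mulr_natl natrX /dyadic_power -pow2_powR.
  rewrite [X in X * _ `^ _ * _]exprS.
  by rewrite le_eqVlt; apply/orP; left; apply/eqP; ring.
apply: ler_sum_nat => n /andP[n1 n2].
rewrite [leRHS]mulrCA ler_pM2l// /weighted_power mulrA.
apply: ler_pM; rewrite ?powR_ge0//.
  apply: powR_comparable; rewrite ?ltr0n//.
    have : (n.+1%:R : R) <= 2 ^+ m.+1 by rewrite -natrX ler_nat.
    lra.
  rewrite exprS ler_pM2l// -natrX ler_nat; exact: leq_trans n1 _.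
apply: ge0_ler_powR; rewrite ?nnegrE ?(ltW q_gt0)//.
by apply: W_le; exact: ltnW.
Qed.

Lemma weighted_sum_le N : \sum_(0 <= n < 2 ^ N) weighted_power W n <=
  weighted_power W 0 + 2 `^ `|q - 2| * \sum_(0 <= m < N) dyadic_power W m.
Proof.
rewrite dyadic_split lerD2l mulr_sumr; apply: ler_sum => m _.
exact: weighted_block_le.
Qed.

Lemma dyadic_sum_le N : \sum_(0 <= m < N) dyadic_power W m <=
  (2 `^ `|q - 2| * 2 + 1) * \sum_(0 <= n < 2 ^ N) weighted_power W n.
Proof.
have c0 : 0 <= 2 `^ `|q - 2| * 2 :> R by rewrite mulr_ge0 ?powR_ge0.
have S0 : 0 <= \sum_(0 <= n < 2 ^ N) weighted_power W n.
  by apply: sumr_ge0 => n _; exact: weighted_power_ge0.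
case: N S0 => [|N] S0; first by rewrite big_nil mulr_ge0// addr_ge0.
rewrite big_nat_recl// mulrDl mul1r addrC; apply: lerD.
  apply: (@le_trans _ _ (2 `^ `|q - 2| * 2 *
      \sum_(0 <= m < N) \sum_(2 ^ m <= n < 2 ^ m.+1) weighted_power W n)).
    by rewrite mulr_sumr; apply: ler_sum => m _; exact: dyadic_power_le.
  apply: ler_wpM2l => //.
  rewrite dyadic_split big_nat_recr//= addrA addrAC lerDr.
  apply: addr_ge0; first exact: weighted_power_ge0.
  by apply: sumr_ge0 => n _; exact: weighted_power_ge0.
apply: (@le_trans _ _ (weighted_power W 0)).
  rewrite /dyadic_power /weighted_power !powR1 !mul1r.
  apply: ge0_ler_powR; rewrite ?nnegrE ?(ltW q_gt0)//.
  exact: W_le.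
rewrite dyadic_split lerDl; apply: sumr_ge0 => m _; apply: sumr_ge0 => n _.
exact: weighted_power_ge0.
Qed.

Definition dyadic_partial_sum m := \sum_(0 <= k < 2 ^ m) W k.

Lemma dyadic_partial_sum_ge0 m : 0 <= dyadic_partial_sum m.
Proof. by apply: sumr_ge0. Qed.

Lemma dyadic_partial_sumS m :
  dyadic_partial_sum m.+1 <= dyadic_partial_sum m + 2 ^+ m * W (2 ^ m)%N.
Proof.
rewrite /dyadic_partial_sum (@big_cat_nat _ _ _ (2 ^ m)%N) ?leq_exp2l//= lerD2l.
apply: (@le_trans _ _ (\sum_(2 ^ m <= k < 2 ^ m.+1) W (2 ^ m)%N)).
  by apply: ler_sum_nat => k /andP[k1 _]; exact: W_le.
by rewrite sumr_const_nat expnS mul2n -addnn addnK -[leLHS]mulr_natl natrX.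
Qed.

End Monotone.

(** A weighted Hardy inequality, in dyadic form: passing from one dyadic partial
    sum to the next multiplies the summand by at most 3/4, up to an error made of
    a single dyadic term. *)
Lemma dyadic_hardy : exists2 K : R, 0 <= K & forall (W : nat -> R) (E : R),
  (forall n, 0 <= W n) -> (forall m n, (m <= n)%N -> W n <= W m) ->
  (forall n, \sum_(0 <= k < n) weighted_power W k <= E) ->
  forall N, \sum_(0 <= m < N) (2 ^+ m)^-1 * dyadic_partial_sum W m `^ q <= K * E.
Proof.
have [L L0 LP] := quasi_triangle_powR.
pose c : R := 2 `^ `|q - 2| * 2 + 1.
have c0 : 0 <= c by rewrite addr_ge0// mulr_ge0 ?powR_ge0.
exists (4 * (1 + L / 2 * c)) => [|W E W0 Wle WE N].
  by rewrite mulr_ge0// addr_ge0// mulr_ge0// divr_ge0.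
pose x m := (2 ^+ m)^-1 * dyadic_partial_sum W m `^ q.
have x0 m : 0 <= x m by rewrite mulr_ge0 ?powR_ge0// invr_ge0 ltW// pow2_gt0.
have xS m : x m.+1 <= 3 / 4 * x m + L / 2 * dyadic_power W m.
  have A0 := dyadic_partial_sum_ge0 W0 m.
  have p := pow2_gt0 m.
  have h : dyadic_partial_sum W m.+1 `^ q <=
      3 / 2 * dyadic_partial_sum W m `^ q + L * (2 ^+ m * W (2 ^ m)%N) `^ q.
    apply: le_trans (LP _ _ A0 (mulr_ge0 (ltW p) (W0 _))).
    apply: ge0_ler_powR; rewrite ?nnegrE ?(ltW q_gt0) ?dyadic_partial_sum_ge0//.
      by rewrite addr_ge0// mulr_ge0// ltW.
    exact: dyadic_partial_sumS.
  have p1 : 0 <= ((2 : R) ^+ m.+1)^-1 by rewrite invr_ge0 ltW// pow2_gt0.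
  rewrite /x; apply: le_trans (ler_wpM2l p1 h) _.
  have -> : dyadic_power W m = (2 ^+ m)^-1 * (2 ^+ m * W (2 ^ m)%N) `^ q.
    rewrite powRM ?(ltW p)// mulrA /dyadic_power powRB ?lt0r_neq0 ?implybT//.
    by rewrite powRr1 ?(ltW p)// [_^-1 * _]mulrC.
  rewrite le_eqVlt; apply/orP; left; apply/eqP; rewrite exprS.
  by field; rewrite lt0r_neq0.
have x00 : x 0%N <= E.
  apply: le_trans (WE 1%N); rewrite /x /dyadic_partial_sum expn0 !big_nat1 expr0 invr1.
  by rewrite mul1r /weighted_power powR1 mul1r.
have step n : \sum_(0 <= m < n.+1) x m <=
    E + 3 / 4 * \sum_(0 <= m < n) x m + L / 2 * \sum_(0 <= m < n) dyadic_power W m.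
  rewrite big_nat_recl// -addrA; apply: lerD => //.
  by rewrite !mulr_sumr -big_split/=; apply: ler_sum => m _; exact: xS.
have dE n : \sum_(0 <= m < n) dyadic_power W m <= c * E.
  apply: le_trans (dyadic_sum_le W0 Wle n) _.
  by apply: ler_wpM2l.
case: N => [|N].
  have E0 : 0 <= E by apply: le_trans (WE 0%N); rewrite big_nil.
  by rewrite big_nil mulr_ge0// mulr_ge0// addr_ge0// mulr_ge0// divr_ge0.
rewrite -/(x _) in step *.
have h1 := step N; have h2 : L / 2 * \sum_(0 <= m < N) dyadic_power W m <= L / 2 * (c * E).
  by apply: ler_wpM2l; [rewrite divr_ge0|exact: dE].
have h3 : \sum_(0 <= m < N) x m <= \sum_(0 <= m < N.+1) x m.
  by rewrite [leRHS]big_nat_recr//= lerDl.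
change (\sum_(0 <= m < N.+1) x m <= 4 * (1 + L / 2 * c) * E).
move: (\sum_(0 <= m < N.+1) x m) (\sum_(0 <= m < N) x m) h1 h2 h3 => S1 S2 h1 h2 h3.
have -> : 4 * (1 + L / 2 * c) * E = 4 * E + 4 * (L / 2 * (c * E)) by ring.
lra.
Qed.

End DyadicSums.

(** * Integrals over layers, and the distance to the point 1 *)

Section LayerBounds.
Context d (T : measurableType d) (R : realType).
Variable nu : {measure set T -> \bar R}.

(** The integral of a nonnegative function is a supremum over the simple functions
    below it, which makes it monotone on arbitrary nonnegative functions. *)
Lemma ge0_integral_mono (D : set T) (f g : T -> \bar R) :
  (forall x, D x -> 0 <= f x)%E -> (forall x, 0 <= g x)%E ->
  (forall x, D x -> f x <= g x)%E ->
  (\int[nu]_(x in D) f x <= \int[nu]_x g x)%E.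
Proof.
move=> f0 g0 fg; rewrite ge0_integralE// [leRHS]ge0_integralE//.
apply: ereal_sup_le => _ [h hf <-]; exists h => // x.
apply: le_trans (hf x) _; rewrite patch_setT /patch.
by case: ifP => [|_]; [rewrite inE => /fg|exact: g0].
Qed.

Lemma ge0_integral_mono_setT (D : set T) (f g : T -> \bar R) :
  (forall x, D x -> 0 <= f x)%E -> (forall x, 0 <= g x)%E ->
  (forall x, g x <= (f \_ D) x)%E ->
  (\int[nu]_x g x <= \int[nu]_(x in D) f x)%E.
Proof.
move=> f0 g0 gf; rewrite ge0_integralE// [leRHS]ge0_integralE//.
apply: ereal_sup_le => _ [h hg <-]; exists h => // x.
by apply: le_trans (hg x) _; rewrite patch_setT.
Qed.

Lemma integral_scaled_indic (c : R) (J : set T) : 0 <= c -> measurable J ->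
  (\int[nu]_x (c * \1_J x)%:E = c%:E * nu J)%E.
Proof.
move=> c0 mJ.
rewrite (_ : (fun x => (c * \1_J x)%:E) = (fun x => c%:E * (\1_J x)%:E)%E); last first.
  by apply/funext => x; rewrite EFinM.
rewrite ge0_integralZl_EFin//.
  by rewrite integral_indic// setIT.
by apply/measurable_EFinP; exact: measurable_indic.
Qed.

Lemma measurable_scaled_indic (c : R) (J : set T) : measurable J ->
  measurable_fun setT (fun x => (c * \1_J x)%:E).
Proof.
move=> mJ; apply/measurable_EFinP; apply: measurable_funM.
  exact: measurable_cst.
exact: measurable_indic.
Qed.

(** A point is charged with the bounds of all the layers that contain it, so
    overlapping layers are harmless. *)
Lemma layer_upper (D : set T) (F : T -> R) (J : nat -> set T) (c b : nat -> R)
    (B : R) :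
  (forall x, D x -> 0 <= F x) -> (forall m, measurable (J m)) ->
  (forall m, 0 <= c m) -> (forall m, 0 <= b m) ->
  (forall m, (nu (J m) <= (b m)%:E)%E) ->
  (forall x, D x -> exists2 m, J m x & F x <= c m) ->
  (forall n, \sum_(0 <= m < n) c m * b m <= B) ->
  (\int[nu]_(x in D) (F x)%:E <= B%:E)%E.
Proof.
move=> F0 mJ c0 b0 Jb FJ cbB.
pose g x : \bar R := (\sum_(0 <= m <oo) (c m * \1_(J m) x)%:E)%E.
have t0 m x : 0 <= c m * \1_(J m) x by rewrite mulr_ge0.
have g0 x : (0 <= g x)%E by apply: nneseries_ge0 => m _ _; rewrite lee_fin.
apply: (@le_trans _ _ (\int[nu]_x g x)%E).
  apply: ge0_integral_mono => // x /FJ[m Jm Fm].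
  apply: (@le_trans _ _ (c m)%:E); first by rewrite lee_fin.
  apply: le_trans (nneseries_partial m.+1 (fun k => t0 k x)).
  rewrite lee_fin big_nat_recr//= indicE mem_set// mulr1 lerDr.
  by apply: sumr_ge0 => k _.
rewrite /g integral_nneseries//; [|by move=> m; exact: measurable_scaled_indic
  |by move=> m x _; rewrite lee_fin].
under eq_eseriesr do rewrite integral_scaled_indic//.
apply: (@le_trans _ _ (\sum_(0 <= m <oo) (c m * b m)%:E)%E).
  apply: lee_nneseries => [m _ _|m _]; first by rewrite mule_ge0// lee_fin.
  by rewrite EFinM lee_pmul// lee_fin.
by apply: nneseries_bound => // m; rewrite mulr_ge0.
Qed.

Lemma layer_lower (D : set T) (F : T -> R) (J : nat -> set T) (c b : nat -> R) n :
  (forall x, D x -> 0 <= F x) -> (forall m, measurable (J m)) ->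
  (forall m, 0 <= c m) -> (forall m, J m `<=` D) ->
  (forall l m x, J l x -> J m x -> l = m) ->
  (forall m, ((b m)%:E <= nu (J m))%E) ->
  (forall m x, (m < n)%N -> J m x -> c m <= F x) ->
  ((\sum_(0 <= m < n) c m * b m)%:E <= \int[nu]_(x in D) (F x)%:E)%E.
Proof.
move=> F0 mJ c0 JD Jdisj Jb FJ.
have t0 m x : 0 <= c m * \1_(J m) x by rewrite mulr_ge0.
apply: (@le_trans _ _ (\int[nu]_x (\sum_(0 <= m < n) (c m * \1_(J m) x)%:E))%E).
  rewrite ge0_integral_sum//; [|by move=> m; exact: measurable_scaled_indic
    |by move=> m x _; rewrite lee_fin].
  rewrite -sumEFin; apply: lee_sum => m _.
  rewrite integral_scaled_indic// EFinM.
  by apply: lee_wpmul2l; rewrite ?lee_fin.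
apply: ge0_integral_mono_setT => [x /F0|x|x]; first by rewrite lee_fin.
  by apply: sume_ge0 => m _; rewrite lee_fin.
rewrite /patch sumEFin; case: ifPn => [|xD].
  rewrite inE => Dx; rewrite lee_fin.
  have [[m [mn Jm]]|noJ] := pselect (exists m, (m < n)%N /\ J m x).
    rewrite big_mkord (bigD1 (Ordinal mn))//= big1 ?addr0.
      by rewrite indicE mem_set// mulr1; exact: FJ Jm.
    move=> k km; rewrite indicE memNset ?mulr0// => Jk.
    by move/eqP: km; apply; apply: val_inj; exact: Jdisj Jk Jm.
  rewrite big_nat big1; first exact: F0.
  move=> m /andP[_ mn]; rewrite indicE memNset ?mulr0// => Jm.
  by apply: noJ; exists m.
rewrite lee_fin big1// => m _; rewrite indicE memNset ?mulr0// => /JD Dx.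
by move: xD; rewrite notin_setE.
Qed.

End LayerBounds.

Section CircleGeometry.
Variable R : realType.
Local Notation C := (R[i]^o).

Lemma dyadic_scale (z : C) : disk z -> exists m,
  (2 ^+ m)^-1 <= normc (1 - z) /\ normc (1 - z) <= 2 * (2 ^+ m)^-1.
Proof.
move=> z1; have z1' : normc z < 1 by [].
have d0 : 0 < normc (1 - z).
  rewrite normc_gt0 subr_eq0; apply/eqP => h.
  by move: z1'; rewrite -h normc1 ltxx.
have d2 : normc (1 - z) <= 2.
  by apply: le_trans (normcBD _ _) _; rewrite normc1; lra.
have [n nP] : exists n, (2 ^+ n)^-1 <= normc (1 - z).
  have h : 0 <= (2 : R)^-1 < 1.
    by rewrite invr_ge0 ler0n invf_lt1// ltr1n.
  have := geometric_cvg0 1 h => /cvgrPdist_lt/(_ _ d0)[N _ NP]; exists N.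
  have := NP N (leqnn _); rewrite /= sub0r normrN mul1r exprVn ger0_norm ?invr_ge0 ?exprn_ge0//.
  exact: ltW.
have exn : exists n, (2 ^+ n)^-1 <= normc (1 - z) by exists n.
case: (ex_minnP exn) => m mP mmin; exists m; split => //.
case: m mP mmin => [|m] mP mmin; first by rewrite expr0 invr1 mulr1.
rewrite exprS invfM mulrA mulfV// mul1r leNgt; apply/negP => h.
by have := mmin m (ltW h); rewrite ltnn.
Qed.

(** Near 0 the derivative of the sine gives the bound, near [pi] symmetry, and in
    between compactness. *)
Lemma sin_lower : exists2 k : R, 0 < k &
  forall s, 0 <= s <= pi -> k * Num.min s (pi - s) <= sin s.
Proof.
have p0 := pi_gt0 R.
have [r r0 rP] := real_derive (@is_derive_sin R 0) (divr_gt0 ltr01 (ltr0n _ 2)).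
pose a := Num.min r pi / 4.
have mr : 0 < Num.min r pi by rewrite lt_min r0.
have a0 : 0 < a by rewrite /a; lra.
have ar : a < r.
  have : Num.min r pi <= r by rewrite ge_min lexx.
  by rewrite /a; lra.
have ap : a <= pi - a.
  have : Num.min r pi <= pi by rewrite ge_min lexx orbT.
  by rewrite /a; lra.
have near0 s : 0 <= s -> s <= a -> s / 2 <= sin s.
  move=> s0 sa; have := rP s; rewrite !subr0 sin0 cos0 mul1r subr0 ger0_norm//.
  move=> /(_ (le_lt_trans sa ar)); rewrite ler_norml => /andP[h _]; lra.
have sinpi (s : R) : sin (pi - s) = sin s by rewrite addrC sinDpi sinN opprK.
have csin : {within `[a, pi - a], continuous (@sin R)}.
  by apply: continuous_subspaceT; exact: continuous_sin.
have [c cI cmin] := EVT_min ap csin.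
have sc0 : 0 < sin c.
  apply: sin_gt0_pi; move: cI; rewrite in_itv/= => /andP[h1 h2]; lra.
exists (Num.min (1 / 2) (sin c / pi)).
  by rewrite lt_min divr_gt0//= divr_gt0.
move=> s /andP[s0 sp].
have m0 : 0 <= Num.min s (pi - s) by rewrite le_min s0 subr_ge0.
have k1 : Num.min (1 / 2) (sin c / pi) <= 1 / 2 by rewrite ge_min lexx.
have k2 : Num.min (1 / 2) (sin c / pi) <= sin c / pi by rewrite ge_min lexx orbT.
have [sa|sa] := leP s a.
  apply: le_trans (near0 s s0 sa).
  apply: le_trans (ler_wpM2r m0 k1) _.
  have : Num.min s (pi - s) <= s by rewrite ge_min lexx.
  lra.
have [sb|sb] := leP (pi - s) a.
  have h := near0 (pi - s); rewrite sinpi subr_ge0 in h.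
  apply: le_trans (h sp sb).
  apply: le_trans (ler_wpM2r m0 k1) _.
  have : Num.min s (pi - s) <= pi - s by rewrite ge_min lexx orbT.
  lra.
apply: le_trans (ler_wpM2r m0 k2) _.
have h : sin c <= sin s by apply: cmin; rewrite in_itv/=; lra.
apply: le_trans h; rewrite mulrAC ler_pdivrMr//; apply: ler_wpM2l; first exact: ltW.
by rewrite ge_min sp.
Qed.

Lemma chord_sqr (r t : R) :
  normc (1 - circ r t) ^+ 2 = (1 - r) ^+ 2 + 4 * r * sin (t / 2) ^+ 2.
Proof.
have c : cos t = 1 - 2 * sin (t / 2) ^+ 2.
  have := cosD (t / 2) (t / 2); rewrite -splitr => ->.
  have := cos2Dsin2 (t / 2); lra.
rewrite -mul_conjc /circ ReM ?(ReD, ReN, ImD, ImN)/=.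
have := cos2Dsin2 t; rewrite c; nra.
Qed.

Lemma chord_lower (r t : R) : 0 <= r < 1 -> 0 <= t <= 2 * pi ->
  sin (t / 2) <= normc (1 - circ r t).
Proof.
move=> /andP[r0 r1] t2.
have s0 : 0 <= sin (t / 2) by apply: sin_ge0_pi; lra.
have s1 : sin (t / 2) ^+ 2 <= 1.
  by have := cos2Dsin2 (t / 2); have := sqr_ge0 (cos (t / 2)); lra.
rewrite -(@ler_pXn2r _ 2)// ?nnegrE ?normc_ge0// chord_sqr.
have := sqr_ge0 (sin (t / 2)); move: (sin (t / 2) ^+ 2) s1 => x x1 x0.
(* for [r >= 1 / 4] the second term of [chord_sqr] suffices; otherwise the first
   one is at least the missing [1 - 4 * r] *)
have [h|h] := leP (1 / 4) r; nra.
Qed.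

Lemma sin_le_id (x : R) : 0 <= x -> sin x <= x.
Proof.
rewrite le_eqVlt => /orP[/eqP<-|x0]; first by rewrite sin0.
have [|c _] := @MVT R sin cos 0 x x0 (fun y _ => is_derive_sin y).
  by apply: continuous_subspaceT; exact: continuous_sin.
rewrite sin0 !subr0 => ->; rewrite -[leRHS]mul1r; apply: ler_wpM2r.
  exact: ltW.
exact: cos_le1.
Qed.

Lemma chord_upper (r t : R) : 0 <= r < 1 -> 0 <= t <= pi ->
  normc (1 - circ r t) <= (1 - r) + t.
Proof.
move=> /andP[r0 r1] tp; have t0 : 0 <= t by case/andP: tp.
have s0 : 0 <= sin (t / 2) by apply: sin_ge0_pi; have := pi_gt0 R; lra.
have st : sin (t / 2) <= t / 2 by apply: sin_le_id; rewrite divr_ge0.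
rewrite -(@ler_pXn2r _ 2)// ?nnegrE ?normc_ge0//; last by lra.
rewrite chord_sqr; move: (sin (t / 2)) s0 st => x x0 xt.
have : x ^+ 2 <= (t / 2) ^+ 2 by apply: lerXn2r; rewrite ?nnegrE// divr_ge0.
have := sqr_ge0 x; move: (x ^+ 2) => y y0 y1.
have : r * y <= 1 * y by apply: ler_wpM2r => //; exact: ltW.
have : 0 <= (1 - r) * t by apply: mulr_ge0; lra.
have -> : (1 - r + t) ^+ 2 = (1 - r) ^+ 2 + 2 * ((1 - r) * t) + t ^+ 2 by ring.
have -> : 4 * r * y = 4 * (r * y) by ring.
rewrite expr_div_n in y1; lra.
Qed.

End CircleGeometry.

(** * Upper bounds of the three norms *)

Section UpperBounds.
Variable R : realType.
Local Notation C := (R[i]^o).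
Variables (q : R) (q_ge1 : 1 <= q).
Variable mu : {finite_measure set (measurableTypeR R) -> \bar R}.
Local Notation D01 := (`[0%R, 1%R[%classic : set (measurableTypeR R)).

Let q_gt0 : 0 < q. Proof. exact: lt_le_trans q_ge1. Qed.

(** All that the norm estimates use. Boundedness applies them to the density of
    one function, compactness to the difference of two; the bounds are linear in
    [E], which is small in the second case. *)
Definition transform_energy (h : C -> C) (w : R -> C) (M E : R) : Prop :=
  [/\ cmeasurable D01 w, forall t, 0 <= t < 1 -> normc (w t) <= M,
      forall z, disk z -> h z = cauchy_int mu w z
    & forall n, \sum_(0 <= k < n) weighted_power q (wmoment mu w) k <= E].

Section Transform.
Variables (h : C -> C) (w : R -> C) (M E : R).
Hypothesis hwE : transform_energy h w M E.

Let mw : cmeasurable D01 w. Proof. by case: hwE. Qed.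
Let wM t : 0 <= t < 1 -> normc (w t) <= M. Proof. by case: hwE => _ + _ _; apply. Qed.
Let hw z : disk z -> h z = cauchy_int mu w z. Proof. by case: hwE => _ _ + _; apply. Qed.
Let wE n : \sum_(0 <= k < n) weighted_power q (wmoment mu w) k <= E.
Proof. by case: hwE. Qed.

Lemma transform_hardy_littlewood_le :
  (\sum_(0 <= n <oo) (n.+1%:R `^ (q - 2) * normc (taylor_coef h n) `^ q)%:E <=
    (2 `^ q * E)%:E)%E.
Proof.
apply: nneseries_bound => [k|n]; first by rewrite mulr_ge0 ?powR_ge0.
apply: (@le_trans _ _ (2 `^ q * \sum_(0 <= k < n) weighted_power q (wmoment mu w) k)).
  rewrite mulr_sumr; apply: ler_sum => k _.
  rewrite (transform_taylor_coef mw wM hw) mulrCA; apply: ler_wpM2l; first exact: powR_ge0.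
  rewrite -powRM ?wmoment_ge0//.
  apply: ge0_ler_powR; rewrite ?nnegrE ?(ltW q_gt0) ?normc_ge0 ?mulr_ge0 ?wmoment_ge0//.
  exact: (cmoment_le mu mw wM).
by apply: ler_wpM2l; [exact: powR_ge0|exact: wE].
Qed.

Lemma transform_le z m : disk z -> (2 ^+ m)^-1 <= normc (1 - z) ->
  normc (h z) <= 6 * dyadic_partial_sum (wmoment mu w) m.
Proof.
move=> z1 zm; rewrite hw//.
have H := @cauchy_int_le R mu w M mw wM z (2 ^ m)%N z1.
by apply: H; rewrite ?expn_gt0// natrX.
Qed.

Lemma transform_derive1_le z m : disk z -> (2 ^+ m)^-1 <= normc (1 - z) ->
  normc (derive1 h z) <= 12 * 2 ^+ m * dyadic_partial_sum (wmoment mu w) m.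
Proof.
move=> z1 zm; rewrite (transform_derive1 mw wM hw z1) -[in leRHS]natrX.
have H := @cauchy_int'_le R mu w M mw wM z (2 ^ m)%N z1.
by apply: H; rewrite ?expn_gt0// natrX.
Qed.

End Transform.

Lemma dyadic_hardy_transform : exists2 K : R, 0 <= K & forall h w M E,
  transform_energy h w M E -> forall N,
  \sum_(0 <= m < N) (2 ^+ m)^-1 * dyadic_partial_sum (wmoment mu w) m `^ q <= K * E.
Proof.
have [K K0 KP] := dyadic_hardy q_ge1; exists K => // h w M E [mw wM _ wE].
apply: KP => //; first exact: wmoment_ge0.
by move=> m n; exact: (wmoment_nonincreasing mu mw wM).
Qed.

Lemma lebesgue_interval (b1 b2 : bool) (a b : R) : a <= b ->
  @lebesgue_measure R [set` Interval (BSide b1 a) (BSide b2 b)] = (b - a)%:E.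
Proof.
rewrite lebesgue_measure_itv/= lte_fin le_eqVlt => /orP[/eqP->|->].
  by rewrite ltxx subrr.
by rewrite EFinB.
Qed.

Lemma lebesgue_rectangle (b1 b2 b3 b4 : bool) (a b c d : R) : a <= b -> c <= d ->
  (@lebesgue_measure R \x @lebesgue_measure R)%E
    (([set` Interval (BSide b1 a) (BSide b2 b)] : set (measurableTypeR R)) `*`
     ([set` Interval (BSide b3 c) (BSide b4 d)] : set (measurableTypeR R))) =
  ((b - a) * (d - c))%:E.
Proof.
move=> ab cd.
have h := @product_measure1E _ _ (measurableTypeR R) (measurableTypeR R) R
  (@lebesgue_measure R) (@lebesgue_measure R)
  [set` Interval (BSide b1 a) (BSide b2 b)] [set` Interval (BSide b3 c) (BSide b4 d)]
  (measurable_itv _) (measurable_itv _).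
by apply: (eq_trans h); rewrite EFinM; congr (_ * _)%E; exact: lebesgue_interval.
Qed.

(** The parameters of the points at distance about [2^-m] from 1 lie in two
    intervals of length comparable to [2^-m]; summing the bounds over [m] leads to
    the Hardy inequality for dyadic sums. *)
Lemma transform_hardy_le : exists2 K : R, 0 <= K & forall h w M E,
  transform_energy h w M E -> forall r, 0 <= r < 1 ->
  (integral_mean q h r <= (K * E)%:E)%E.
Proof.
have [K K0 KP] := dyadic_hardy_transform.
have [k k0 kP] := sin_lower R.
pose K1 := 6 `^ q * (8 / k) * K.
have K10 : 0 <= K1 by rewrite !mulr_ge0 ?powR_ge0// invr_ge0 ltW.
exists ((2 * pi)^-1 * K1) => [|h w M E hwE r r01].
  by rewrite mulr_ge0// invr_ge0 ltW// pi2_gt0.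
rewrite /integral_mean -mulrA EFinM; apply: lee_wpmul2l.
  by rewrite lee_fin invr_ge0 ltW// pi2_gt0.
pose rho m : R := 4 / k * (2 ^+ m)^-1.
have rho0 m : 0 <= rho m.
  by rewrite /rho mulr_ge0 ?invr_ge0 ?(ltW (pow2_gt0 _ _))// divr_ge0// ltW.
apply: (@layer_upper _ (measurableTypeR R) R lebesgue_measure `[0, 2 * pi]
  (fun t => normc (h (circ r t)) `^ q)
  (fun m => `[0, rho m] `|` `[2 * pi - rho m, 2 * pi])
  (fun m => (6 * dyadic_partial_sum (wmoment mu w) m) `^ q) (fun m => rho m + rho m)).
- by move=> t _; exact: powR_ge0.
- by move=> m; apply: measurableU; exact: measurable_itv.
- by move=> m; exact: powR_ge0.
- by move=> m; exact: addr_ge0.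
- move=> m; apply: le_trans (measureU2 _ _ _) _; rewrite ?EFinD; try exact: measurable_itv.
  have h1 : (@lebesgue_measure R `[0%R, rho m]%classic <= (rho m)%:E)%E.
    by rewrite lebesgue_interval// subr0.
  have h2 : (@lebesgue_measure R `[(2 * pi - rho m)%R, (2 * pi)%R]%classic <= (rho m)%:E)%E.
    by rewrite lebesgue_interval ?gerBl// opprB addrC subrK.
  exact: (leeD h1 h2).
- move=> t /=; rewrite in_itv/= => t2.
  have z1 : disk (circ r t).
    by case/andP: r01 => r0 r1; apply/diskP; rewrite normc_circ ?ger0_norm.
  have [m [m1 m2]] := dyadic_scale z1.
  exists m; last first.
    apply: ge0_ler_powR; rewrite ?nnegrE ?normc_ge0 ?(ltW q_gt0)//.
      rewrite mulr_ge0//; apply: dyadic_partial_sum_ge0 => j; exact: wmoment_ge0.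
    exact: (transform_le hwE).
  have ch := chord_lower r01 t2.
  have t2' : 0 <= t / 2 <= pi by case/andP: t2 => ? ?; apply/andP; split; lra.
  have sl := kP _ t2'.
  have rE : k * (rho m / 2) = 2 * (2 ^+ m)^-1.
    by rewrite /rho; have := pow2_gt0 R m; move: (2 ^+ m) => x x0; field; lra.
  have : Num.min (t / 2) (pi - t / 2) <= rho m / 2.
    by rewrite -(ler_pM2l k0) rE; lra.
  case/andP: t2 => t0 t2.
  rewrite ge_min => /orP[h1|h1]; [left|right]; rewrite /= in_itv/=; lra.
- move=> N; have := KP _ _ _ _ hwE N.
  move=> /(ler_wpM2l (mulr_ge0 (powR_ge0 6 q) (divr_ge0 (ler0n _ 8) (ltW k0)))).
  rewrite [leRHS]mulrA -/K1 => H; apply: le_trans H; rewrite mulr_sumr; apply: ler_sum => m _.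
  rewrite powRM ?dyadic_partial_sum_ge0//; last by move=> j; exact: wmoment_ge0.
  rewrite /rho le_eqVlt; apply/orP; left; apply/eqP; ring.
Qed.

(** In the disk the points at distance about [2^-m] from 1 have area at most a
    multiple of [4^-m], and the derivative and the weight contribute [2^(mq)] and
    [2^(-m(q-1))]: the same dyadic sum as for the means over circles. *)
Lemma transform_dirichlet_le : exists2 K : R, 0 <= K & forall h w M E,
  transform_energy h w M E ->
  ((normc (h 0) `^ q)%:E + \int[lebesgue_measure \x lebesgue_measure]_(p in
      [set p : R * R | disk (p.1 +i* p.2)%C])
    (normc (derive1 h (p.1 +i* p.2)%C) `^ q * (1 - normc (p.1 +i* p.2)%C) `^ (q - 1))%:E <=
   (K * E)%:E)%E.
Proof.
have [K K0 KP] := dyadic_hardy_transform.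
pose K1 := 12 `^ q * 2 `^ (q - 1) * 16 * K.
have K10 : 0 <= K1 by rewrite !mulr_ge0 ?powR_ge0.
exists (6 `^ q + K1) => [|h w M E hwE]; first by rewrite addr_ge0 ?powR_ge0.
have q10 : 0 <= q - 1 by rewrite subr_ge0.
have A0 m : 0 <= dyadic_partial_sum (wmoment mu w) m.
  by apply: dyadic_partial_sum_ge0 => j; exact: wmoment_ge0.
rewrite mulrDl EFinD; apply: leeD.
  rewrite lee_fin.
  have h0 : normc (h 0) <= 6 * dyadic_partial_sum (wmoment mu w) 0.
    by apply: (transform_le hwE); [exact: disk0|rewrite subr0 normc1 expr0 invr1].
  apply: (@le_trans _ _ ((6 * dyadic_partial_sum (wmoment mu w) 0) `^ q)).
    by apply: ge0_ler_powR; rewrite ?nnegrE ?normc_ge0 ?(ltW q_gt0) ?mulr_ge0.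
  rewrite powRM//; apply: ler_wpM2l; first exact: powR_ge0.
  case: hwE => _ _ _ /(_ 1%N); rewrite /dyadic_partial_sum expn0 !big_nat1.
  by rewrite /weighted_power powR1 mul1r.
pose s m : R := 2 * (2 ^+ m)^-1.
have s0 m : 0 < s m by rewrite mulr_gt0// invr_gt0 pow2_gt0.
apply: (@layer_upper _ (measurableTypeR R * measurableTypeR R)%type R
  (lebesgue_measure \x lebesgue_measure)%E [set p | disk (p.1 +i* p.2)%C]
  (fun p => normc (derive1 h (p.1 +i* p.2)%C) `^ q *
    (1 - normc (p.1 +i* p.2)%C) `^ (q - 1))
  (fun m => `[1 - s m, 1 + s m] `*` `[- s m, s m])
  (fun m => (12 * 2 ^+ m * dyadic_partial_sum (wmoment mu w) m) `^ q * s m `^ (q - 1))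
  (fun m => (2 * s m) ^+ 2)).
- by move=> p _; rewrite mulr_ge0 ?powR_ge0.
- by move=> m; apply: measurableX; exact: measurable_itv.
- by move=> m; rewrite mulr_ge0 ?powR_ge0.
- by move=> m; exact: sqr_ge0.
- move=> m; have sm := s0 m.
  have h1 : 1 - s m <= 1 + s m by lra.
  have h2 : - s m <= s m by lra.
  have hr := lebesgue_rectangle true false true false h1 h2.
  have e : (1 + s m - (1 - s m)) * (s m - - s m) = (2 * s m) ^+ 2 by ring.
  by rewrite e in hr; apply: le_trans (lexx _); rewrite le_eqVlt; apply/orP; left; apply/eqP; exact: hr.
- move=> [x y] /= z1.
  have [m [m1 m2]] := dyadic_scale z1; exists m.
    have hx := normRe_le (1 - (x +i* y)%C); have hy := normIm_le (1 - (x +i* y)%C).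
    rewrite /= in hx hy.
    have sm := s0 m; rewrite -/(s m) in m2.
    have := le_trans hx m2; have := le_trans hy m2.
    rewrite !ler_norml => /andP[a1 a2] /andP[a3 a4].
    by split; rewrite /= in_itv/=; lra.
  apply: ler_pM; rewrite ?powR_ge0//.
    apply: ge0_ler_powR; rewrite ?nnegrE ?normc_ge0 ?(ltW q_gt0)//.
      by rewrite !mulr_ge0// ltW// pow2_gt0.
    exact: (transform_derive1_le hwE).
  have z1' : normc (x +i* y)%C < 1 by [].
  apply: ge0_ler_powR; rewrite ?nnegrE ?subr_ge0 ?(ltW z1') ?(ltW (s0 _))//.
  apply: le_trans m2; have := normcBl 1 (x +i* y)%C; rewrite normc1; exact.
- move=> N; have := KP _ _ _ _ hwE N.
  have c0 : 0 <= 12 `^ q * 2 `^ (q - 1) * 16 :> R by rewrite !mulr_ge0 ?powR_ge0.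
  move=> /(ler_wpM2l c0).
  rewrite mulrA -/K1; apply: le_trans; rewrite mulr_sumr; apply: ler_sum => m _.
  have p := pow2_gt0 R m.
  rewrite /s !powRM ?mulr_ge0 ?(ltW p) ?invr_ge0 ?(ltW p)//.
  rewrite (@powR_inv _ (2 ^+ m)) ?(ltW p)//.
  have -> : (2 ^+ m) `^ q = (2 ^+ m) * (2 ^+ m) `^ (q - 1) :> R.
    rewrite -[X in X * _]powRr1 ?(ltW p)// -powRD; last by rewrite lt0r_neq0// implybT.
    by congr (_ `^ _); ring.
  have p' : 0 < (2 ^+ m) `^ (q - 1) :> R by exact: powR_gt0.
  move: (_ `^ (q - 1)) p' => y y0.
  rewrite le_eqVlt; apply/orP; left; apply/eqP; field.
  by rewrite !lt0r_neq0.
Qed.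

Lemma poweR_inv_le (x : \bar R) (B : R) : (0 <= x)%E -> (x <= B%:E)%E ->
  (poweR x q^-1 <= (B `^ q^-1)%:E)%E.
Proof.
move=> x0 xB; rewrite -poweR_EFin; apply: gt0_ler_poweR => //.
  by rewrite invr_ge0 ltW.
all: by rewrite in_itv/= ?x0 ?(le_trans x0 xB) leey.
Qed.

Lemma target_norm_le (Y : target_space) : exists2 K : R, 0 <= K &
  forall h w M E, transform_energy h w M E ->
  (target_norm Y q h <= ((K * E) `^ q^-1)%:E)%E.
Proof.
case: Y.
- have [K K0 KP] := transform_dirichlet_le; exists K => // h w M E hwE.
  apply: poweR_inv_le; last exact: KP hwE.
  apply: adde_ge0; first by rewrite lee_fin powR_ge0.
  by apply: integral_ge0 => p _; rewrite lee_fin mulr_ge0 ?powR_ge0.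
- have [K K0 KP] := transform_hardy_le; exists K => // h w M E hwE.
  apply: ge_ereal_sup => _ [r r1 <-].
  apply: poweR_inv_le; last by apply: KP hwE _ _; move: r1; rewrite /= in_itv.
  apply: mule_ge0; first by rewrite lee_fin invr_ge0 ltW// pi2_gt0.
  by apply: integral_ge0 => p _; rewrite lee_fin powR_ge0.
- exists (2 `^ q); [exact: powR_ge0|move=> h w M E hwE].
  apply: poweR_inv_le; last exact: transform_hardy_littlewood_le hwE.
  by apply: nneseries_ge0 => n _ _; rewrite lee_fin mulr_ge0 ?powR_ge0.
Qed.

End UpperBounds.

(** * Coordinatewise convergent subsequences *)

Section Selection.
Variable R : realType.
Local Notation C := (R[i]^o).

Lemma ultra_limit (U : set_system nat) (v : nat -> R) (B : R) : UltraFilter U ->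
  (forall n, `|v n| <= B) ->
  exists p : R, forall e, 0 < e -> U [set n | `|v n - p| < e].
Proof.
move=> UU vB.
have UP : ProperFilter U by exact: ultra_proper.
have [p [_ pP]] : `[- B, B]%classic `&` cluster (v @ U) !=set0.
  apply: (@segment_compact R (- B) B (v @ U)).
  change (U [set n | `[- B, B]%classic (v n)]).
  by apply: filterE => n /=; rewrite in_itv/= -ler_norml; exact: vB.
exists p => e e0.
have [//|Uc] := in_ultra_setVsetC [set n | `|v n - p| < e] UU.
have [||x [/= h1 h2]] := pP [set x | e <= `|x - p|] (ball p e).
- change (U [set n | e <= `|v n - p|]).
  by apply: filterS Uc => n /= h; rewrite leNgt; apply/negP.
- exact: nbhsx_ballx.
by move: h2; rewrite /ball/= distrC ltNge h1.
Qed.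

(** A bounded sequence of sequences has a subsequence converging coordinatewise;
    the limits are taken along one ultrafilter, which provides all the coordinates
    at the same time. *)
Lemma coordinatewise_subsequence (u : nat -> nat -> C) (B : R) :
  (forall n k, normc (u n k) <= B) ->
  exists phi : nat -> nat, exists a : nat -> C,
    [/\ {homo phi : m n / (m < n)%N}, forall k, normc (a k) <= B
      & forall k, (fun j => u (phi j) k) @ \oo --> a k].
Proof.
move=> uB.
have [U [UU Uoo]] := @ultraFilterLemma _ \oo eventually_filter.
have UP : ProperFilter U by exact: ultra_proper.
have re k : exists p : R, forall e, 0 < e -> U [set n | `|complex.Re (u n k) - p| < e].
  by apply: (@ultra_limit _ _ B) => // n; apply: le_trans (normRe_le _) (uB n k).
have im k : exists p : R, forall e, 0 < e -> U [set n | `|complex.Im (u n k) - p| < e].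
  by apply: (@ultra_limit _ _ B) => // n; apply: le_trans (normIm_le _) (uB n k).
have [a1 a1P] := choice re; have [a2 a2P] := choice im.
pose a k : C := Complex (a1 k) (a2 k).
have aU k e : 0 < e -> U [set n | normc (u n k - a k) < e].
  move=> e0; have e2 : 0 < e / 2 by rewrite divr_gt0.
  apply: filterS (filterI (a1P k _ e2) (a2P k _ e2)) => n [/= h1 h2].
  apply: le_lt_trans (normc_leD _) _.
  by rewrite ReD ReN ImD ImN/=; lra.
have allU e N : 0 < e -> U [set n | forall k, (k < N)%N -> normc (u n k - a k) < e].
  move=> e0; elim: N => [|N ih]; first by apply: filterE => n k; rewrite ltn0.
  apply: filterS (filterI ih (aU N e e0)) => n [/= h1 h2] k.
  by rewrite ltnS leq_eqVlt => /orP[/eqP->//|/h1].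
have sel (mN : nat * nat) : exists n, (mN.1 <= n)%N /\
    forall k, (k < mN.2)%N -> normc (u n k - a k) < mN.2.+1%:R^-1.
  case: mN => m N /=; have e0 : 0 < (N.+1%:R : R)^-1 by rewrite invr_gt0 ltr0n.
  have Um : U [set n | (m <= n)%N] by apply: Uoo; exists m.
  by have [n [/= h1 h2]] := filter_ex (filterI Um (allU _ N e0)); exists n.
have [s sP] := choice sel.
pose phi := fix phi j := if j is i.+1 then s ((phi i).+1, i.+1) else s (0%N, 0%N).
have phiP j k : (k < j)%N -> normc (u (phi j) k - a k) < j.+1%:R^-1.
  by case: j => [//|j] kj; have [_ h] := sP ((phi j).+1, j.+1); exact: h.
have ca k : (fun j => u (phi j) k) @ \oo --> a k.
  apply/cvg_normcP => e e0.
  exists (maxn k.+1 (Num.truncn e^-1)) => j; rewrite geq_max => /andP[kj ej].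
  apply: lt_le_trans (phiP j k kj) _.
  rewrite invf_ple ?posrE ?ltr0n//.
  apply: ltW; apply: lt_le_trans (truncnS_gt _) _.
  by rewrite ler_nat ltnS.
exists phi, a; split => //.
  apply: homo_ltn; first exact: ltn_trans.
  by move=> j /=; have [h _] := sP ((phi j).+1, j.+1).
by move=> k; apply: normc_cvg_le (ca k) _ => j.
Qed.

(** Bounded coefficients that tend to 0 give power series that tend to 0 at each
    point of the disk: the tails are dominated by one geometric series. *)
Lemma psum_coef_cvg0 (d : nat -> nat -> C) (B : R) z :
  (forall j k, normc (d j k) <= B) ->
  (forall k, (fun j => d j k) @ \oo --> (0 : C)) -> disk z ->
  (fun j => psum (d j) z) @ \oo --> (0 : C).
Proof.
move=> dB d0 z1; have z1' : 0 <= normc z < 1 by rewrite normc_ge0.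
have x0 := normc_ge0 z.
have B0 : 0 <= B by apply: le_trans (normc_ge0 _) (dB 0%N 0%N).
apply/cvg_normcP => e e0; have e2 : 0 < e / 2 by rewrite divr_gt0.
have := geometric_cvg0 (B * (1 - normc z)^-1) z1'.
move=> /cvgrPdist_lt/(_ _ e2)[N _ /(_ N (leqnn N))] /=.
rewrite sub0r normrN => /(le_lt_trans (ler_norm _)) tail.
have dn k : (fun j => normc (d j k)) @ \oo --> (0 : R).
  have := cvg_normc (d0 k); rewrite (_ : (fun n => _) = (fun j => normc (d j k)))//.
  by apply/funext => j; rewrite subr0.
have := cvg_finsum0 N dn => /cvgrPdist_lt/(_ _ e2)[J _ JP].
exists J => j jJ; rewrite subr0.
have := JP j jJ; rewrite /= sub0r normrN => /(le_lt_trans (ler_norm _)) front.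
apply: (@le_lt_trans _ _ (\sum_(0 <= k < N) normc (d j k) +
    B * (1 - normc z)^-1 * normc z ^+ N)); last by lra.
have cD := bounded_disk_coefs (dB j).
have h := psum_cvg cD z1; apply: (normc_cvg_le h) => n.
apply: le_trans (normc_sum _ _ _) _.
have term k : normc (d j k * z ^+ k) <= normc (d j k) * normc z ^+ k.
  by rewrite normcM normcX.
have term1 k : normc (d j k * z ^+ k) <= normc (d j k).
  apply: le_trans (term k) _; rewrite ler_piMr ?normc_ge0// exprn_ile1//.
  by case/andP: z1' => _ /ltW.
have tail0 : 0 <= B * (1 - normc z)^-1 * normc z ^+ N.
  rewrite mulr_ge0 ?exprn_ge0// mulr_ge0// invr_ge0.
  by case/andP: z1' => _ /ltW; rewrite subr_ge0.
have [nN|Nn] := leqP n N.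
  apply: (@le_trans _ _ (\sum_(0 <= k < N) normc (d j k))); last by rewrite lerDl.
  rewrite (@big_cat_nat _ _ _ n 0 N)//=.
  apply: (@le_trans _ _ (\sum_(0 <= k < n) normc (d j k))).
    by apply: ler_sum => k _; exact: term1.
  by rewrite lerDl; apply: sumr_ge0 => k _; exact: normc_ge0.
rewrite (@big_cat_nat _ _ _ N 0 n)//=; last exact: ltnW.
apply: lerD; first by apply: ler_sum => k _; exact: term1.
apply: (@le_trans _ _ (\sum_(N <= k < n) B * normc z ^+ k)).
  by apply: ler_sum => k _; apply: le_trans (term k) _; rewrite ler_wpM2r ?exprn_ge0.
rewrite -{1}[N]add0n big_addn -mulr_sumr -mulrA ler_wpM2l//.
under eq_bigr do rewrite exprD.
by rewrite -mulr_suml ler_wpM2r ?exprn_ge0// geometric_sum_le.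
Qed.

Lemma summable_tail (v : nat -> R) (B : R) : (forall k, 0 <= v k) ->
  (forall n, \sum_(0 <= k < n) v k <= B) ->
  forall e, 0 < e -> exists N, forall n, \sum_(N <= k < n) v k <= e.
Proof.
move=> v0 vB e e0.
pose S n := \sum_(0 <= k < n) v k.
have Sle : {homo S : n m / (n <= m)%N >-> n <= m}.
  move=> m n mn; rewrite /S (@big_cat_nat _ _ _ m 0 n)//= lerDl.
  by apply: sumr_ge0.
have Sc : cvgn S.
  apply: nondecreasing_is_cvgn => //; exists B => _ [n _ <-]; exact: vB.
have Sl := nondecreasing_cvgn_le Sle Sc.
have := Sc => /cvgrPdist_lt/(_ _ e0)[N _ /(_ N (leqnn N))] /= h.
exists N => n; have [nN|Nn] := leqP n N; first by rewrite big_geq// ltW.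
have -> : \sum_(N <= k < n) v k = S n - S N.
  rewrite /S (@big_cat_nat _ _ _ N 0 n)//=; last exact: ltnW.
  by rewrite addrAC subrr add0r.
by have := Sl n; have := le_lt_trans (ler_norm _) h; lra.
Qed.

End Selection.

(** * Summable moments imply boundedness and compactness *)

Section Sufficiency.
Variable R : realType.
Local Notation C := (R[i]^o).
Variables (q : R) (q_ge1 : 1 <= q).
Variable mu : {finite_measure set (measurableTypeR R) -> \bar R}.
Local Notation D01 := (`[0%R, 1%R[%classic : set (measurableTypeR R)).

Let q_gt0 : 0 < q. Proof. exact: lt_le_trans q_ge1. Qed.

Lemma in_ell_moment :
  in_ell q (fun n => n.+1%:R `^ (1 - 2 / q) * moment mu n) <->
  exists E, forall n, \sum_(0 <= k < n) weighted_power q (moment mu) k <= E.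
Proof.
rewrite /in_ell.
have E n : `|n.+1%:R `^ (1 - 2 / q) * moment mu n| `^ q = weighted_power q (moment mu) n.
  rewrite ger0_norm ?mulr_ge0 ?powR_ge0 ?moment_ge0// powRM ?powR_ge0 ?moment_ge0//.
  rewrite -powRrM; congr (_ `^ _ * _); field; exact: lt0r_neq0.
under eq_eseriesr do rewrite E.
by apply: nneseries_lty => k; exact: weighted_power_ge0.
Qed.

(** A moment larger than [1/(k+1)] only increases when raised to the power
    [q >= 1], after scaling by [k+1]; the others contribute a convergent sum. *)
Lemma harmonic_moment_bound (E : R) :
  (forall n, \sum_(0 <= k < n) weighted_power q (moment mu) k <= E) ->
  forall n, \sum_(0 <= k < n) moment mu k / k.+1%:R <= 2 + E.
Proof.
move=> wE n.
apply: (@le_trans _ _ (\sum_(0 <= k < n)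
    ((k.+1%:R ^+ 2)^-1 + weighted_power q (moment mu) k))).
  apply: ler_sum => k _; rewrite /weighted_power.
  have k0 : 0 < (k.+1%:R : R) by rewrite ltr0n.
  have m0 := moment_ge0 mu k.
  set x := moment mu k in m0 *; set a : R := k.+1%:R in k0 *.
  have -> : a `^ (q - 2) * x `^ q = (a ^+ 2)^-1 * (a * x) `^ q.
    rewrite powRM ?(ltW k0)// mulrA; congr (_ * _).
    rewrite powRB ?lt0r_neq0 ?implybT// [RHS]mulrC; congr (_ * _).
    by rewrite powR_mulrn ?(ltW k0).
  have -> : x / a = (a ^+ 2)^-1 * (a * x) by field; rewrite lt0r_neq0.
  rewrite -[X in _ <= X + _]mulr1 -mulrDr; apply: ler_wpM2l.
    by rewrite invr_ge0 exprn_ge0// ltW.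
  have [h|h] := leP (a * x) 1.
    by apply: le_trans h _; rewrite lerDl powR_ge0.
  apply: (@le_trans _ _ ((a * x) `^ q)); last by rewrite lerDr.
  have ax0 : 0 < a * x by exact: lt_trans h.
  by rewrite -[leLHS]powRr1 ?(ltW ax0)// ler_powR// ltW.
rewrite big_split/=; apply: lerD => //.
case: n => [|n]; first by rewrite big_nil.
apply: (@le_trans _ _ (2 - n.+1%:R^-1)); last first.
  by rewrite gerBl invr_ge0 ler0n.
elim: n => [|n ih]; first by rewrite big_nat1 expr1n invr1; lra.
rewrite big_nat_recr//=; have := ih.
have a0 : 0 < (n.+1%:R : R) by rewrite ltr0n.
have -> : n.+2%:R = n.+1%:R + 1 :> R by rewrite -natr1.
move: (\sum_(_ <= _ < _) _) (n.+1%:R : R) a0 => S a a0 h.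
apply: le_trans (lerD h (lexx _)) _.
suff : ((a + 1) ^+ 2)^-1 <= a^-1 - (a + 1)^-1 by lra.
have -> : a^-1 - (a + 1)^-1 = (a * (a + 1))^-1 by field; rewrite !lt0r_neq0//; lra.
rewrite lef_pV2 ?posrE ?exprn_gt0 ?mulr_gt0//; nra.
Qed.

Lemma hinfty_norm_bound (f : C -> C) : in_hinfty f ->
  exists2 M : R, hinfty_norm f = M%:E & forall z, disk z -> normc (f z) <= M.
Proof.
move=> [fa ffin].
have le z : disk z -> ((normc (f z))%:E <= hinfty_norm f)%E.
  by move=> z1; apply: ereal_sup_ubound; exists z.
have f0 : (0 <= hinfty_norm f)%E.
  by apply: le_trans (le 0 (disk0 R)); rewrite lee_fin normc_ge0.
exists (fine (hinfty_norm f)) => [|z /le]; first by rewrite fineK// ge0_fin_numE.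
by rewrite -{1}[hinfty_norm f]fineK ?ge0_fin_numE// lee_fin.
Qed.

Lemma target_norm_ge0 (Y : target_space) (h : C -> C) : (0 <= target_norm Y q h)%E.
Proof.
case: Y; [exact: poweR_ge0| |exact: poweR_ge0].
apply: le_trans (ereal_sup_ubound _); last first.
  by exists 0 => //=; rewrite in_itv/= lexx ltr01.
exact: poweR_ge0.
Qed.

Section Energy.
Variable E : R.
Hypothesis muE : forall n, \sum_(0 <= k < n) weighted_power q (moment mu) k <= E.

Lemma energy_ge0 : 0 <= E.
Proof. by apply: le_trans (muE 0%N); rewrite big_nil. Qed.

Let inner (f : C -> C) M n : analytic f ->
  (forall z, disk z -> normc (f z) <= M) ->
  hilbert_inner mu f n @ \oo --> cmoment mu (radial f) n.
Proof.
move=> fa fM.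
have h := @hilbert_inner_cvg R mu f M fa fM (2 + E) n (harmonic_moment_bound muE).
exact: h.
Qed.

Lemma weighted_power_wmoment_le (w : R -> C) M k : cmeasurable D01 w ->
  (forall t, 0 <= t < 1 -> normc (w t) <= M) ->
  weighted_power q (wmoment mu w) k <= M `^ q * weighted_power q (moment mu) k.
Proof.
move=> mw wM; have M0 : 0 <= M.
  by apply: le_trans (normc_ge0 _) (wM 0 _); rewrite lexx ltr01.
rewrite [leRHS]mulrCA; apply: ler_wpM2l; first exact: powR_ge0.
rewrite -powRM ?moment_ge0//.
apply: ge0_ler_powR; rewrite ?nnegrE ?(ltW q_gt0) ?wmoment_ge0 ?mulr_ge0 ?moment_ge0//.
exact: wmoment_le.
Qed.

Lemma hilbert_energy (f : C -> C) M : analytic f ->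
  (forall z, disk z -> normc (f z) <= M) ->
  transform_energy q mu (hilbert mu f) (radial f) M (M `^ q * E).
Proof.
move=> fa fM; split.
- exact: cmeasurable_radial fa fM.
- by move=> t t1; exact: radial_bounded fM _ t1.
- by move=> z z1; apply: (hilbertE fa fM) => // n; exact: inner fM.
move=> n; apply: le_trans (ler_wpM2l (powR_ge0 M q) (muE n)).
rewrite mulr_sumr; apply: ler_sum => k _; apply: weighted_power_wmoment_le.
  exact: cmeasurable_radial fa fM.
by move=> t t1; exact: radial_bounded fM _ t1.
Qed.

Lemma hilbert_maps_into_of_energy Y : hilbert_maps_into mu Y q.
Proof.
move=> f fH; have [M _ fM] := hinfty_norm_bound fH; have [fa _] := fH.
have hE := hilbert_energy fa fM; have [K K0 KP] := target_norm_le q_ge1 mu Y.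
have def : hilbert_defined mu f.
  by apply: (hilbert_is_defined fa fM) => n; exact: inner fM.
have [_ _ an] := def; split; first exact: def.
split; first exact: an.
by apply: le_lt_trans (KP _ _ _ _ hE) _; rewrite ltry.
Qed.

Lemma hilbert_bounded_of_energy Y : hilbert_bounded mu Y q.
Proof.
split; first exact: hilbert_maps_into_of_energy.
have [K K0 KP] := target_norm_le q_ge1 mu Y.
exists ((K * E) `^ q^-1) => f fH.
have [M -> fM] := hinfty_norm_bound fH; have [fa _] := fH.
have M0 := bound_ge0 fM; have E0 := energy_ge0.
apply: le_trans (KP _ _ _ _ (hilbert_energy fa fM)) _.
rewrite -EFinM lee_fin (_ : K * (M `^ q * E) = K * E * M `^ q); last by ring.
have B0 : 0 <= K * E by exact: mulr_ge0.
rewrite powRM ?powR_ge0//.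
by rewrite -powRrM mulfV ?lt0r_neq0// powRr1.
Qed.

(** If bounded densities tend to 0 pointwise, then so do their moments, and these
    are dominated by multiples of the moments of [mu]: the energy tends to 0. *)
Lemma energy_vanishes (w : nat -> R -> C) M :
  (forall j, cmeasurable D01 (w j)) ->
  (forall j t, 0 <= t < 1 -> normc (w j t) <= M) ->
  (forall t, 0 <= t < 1 -> (fun j => w j t) @ \oo --> (0 : C)) ->
  forall e, 0 < e -> exists J, forall j, (J <= j)%N ->
  forall n, \sum_(0 <= k < n) weighted_power q (wmoment mu (w j)) k <= e.
Proof.
move=> mw wM w0 e e0; have e2 : 0 < e / 2 by rewrite divr_gt0.
have W0 : (fun j => wmoment mu (w j) 0) @ \oo --> (0 : R).
  have h : (fun j => Cint mu D01 (fun t => (normc (w j t))%:C%C : C)) @ \oo -->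
      Cint mu D01 (fun=> 0).
    apply: (@Cint_dominated_cvg _ (measurableTypeR R) R mu D01 _ _ (fun=> `|M|)).
    - exact: mD01.
    - by move=> j; apply: cmeasurable_real; exact: cmeasurable_normc.
    - move=> t /D01_itv t1; apply: normc_cvg.
      have := cvg_normc (w0 t t1).
      rewrite (_ : (fun n => _) = (fun n => normc ((normc (w n t))%:C%C - 0 : C)))//.
      by apply/funext => n; rewrite !subr0 normcR ger0_norm// normc_ge0.
    - apply: (@bounded_integrable _ _ _ _ _ _ `|M|); [exact: mD01|exact: mu_D01_fin| |].
        exact: measurable_cst.
      by move=> t _; rewrite normr_id.
    - move=> j t /D01_itv t1; rewrite normcR ger0_norm ?normc_ge0//.
      exact: le_trans (wM j t t1) (ler_norm _).
  have := cvgc_Re h; rewrite Cint0.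
  rewrite (_ : (fun n => _) = (fun j => wmoment mu (w j) 0))//.
  by apply/funext => j; rewrite /= /wmoment; apply: eq_Rintegral => t _; rewrite mul1r.
have term k : (fun j => weighted_power q (wmoment mu (w j)) k) @ \oo --> (0 : R).
  apply: (@squeeze_cvgr _ _ _ _ (fun=> 0)
    (fun j => k.+1%:R `^ (q - 2) * wmoment mu (w j) 0 `^ q)).
  - apply: nearW => j; rewrite weighted_power_ge0/=.
    apply: ler_wpM2l; first exact: powR_ge0.
    apply: ge0_ler_powR; rewrite ?nnegrE ?(ltW q_gt0) ?wmoment_ge0//.
    exact: (wmoment_nonincreasing mu (mw j) (wM j)).
  - exact: cvg_cst.
  - rewrite -[X in _ --> X](mulr0 (k.+1%:R `^ (q - 2))); apply: cvgMr.
    apply/cvgrPdist_lt => d d0.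
    have d1 : 0 < d `^ q^-1 by exact: powR_gt0.
    have := W0 => /cvgrPdist_lt/(_ _ d1); apply: filterS => j.
    rewrite !sub0r !normrN !ger0_norm ?wmoment_ge0 ?powR_ge0// => h.
    have := @gt0_ltr_powR _ q q_gt0 (wmoment mu (w j) 0) (d `^ q^-1).
    rewrite !nnegrE wmoment_ge0 powR_ge0 => /(_ isT isT h).
    by rewrite -powRrM mulVf ?lt0r_neq0// powRr1// ltW.
have tailB n : \sum_(0 <= k < n) M `^ q * weighted_power q (moment mu) k <= M `^ q * E.
  by rewrite -mulr_sumr ler_wpM2l ?powR_ge0.
have tail0 k : 0 <= M `^ q * weighted_power q (moment mu) k.
  by rewrite mulr_ge0 ?powR_ge0 ?weighted_power_ge0.
have [N NP] := summable_tail tail0 tailB e2.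
have := cvg_finsum0 N term => /cvgrPdist_lt/(_ _ e2)[J _ JP].
exists J => j jJ n.
have := JP j jJ; rewrite /= sub0r normrN => /(le_lt_trans (ler_norm _)) front.
have wp0 k := weighted_power_ge0 q (wmoment mu (w j)) k.
apply: (@le_trans _ _ (\sum_(0 <= k < N) weighted_power q (wmoment mu (w j)) k +
    \sum_(N <= k < n) M `^ q * weighted_power q (moment mu) k)); last first.
  by have := NP n; lra.
have [nN|Nn] := leqP n N.
  rewrite (@big_cat_nat _ _ _ n 0 N _ _ (leq0n n) nN)/= -addrA lerDl.
  by apply: addr_ge0; apply: sumr_ge0 => k _.
rewrite (@big_cat_nat _ _ _ N 0 n)//=; last exact: ltnW.
rewrite lerD2l; apply: ler_sum => k _.
exact: weighted_power_wmoment_le (mw j) (wM j).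
Qed.

(** A subsequence converges coefficientwise, hence at each point of the disk, to a
    bounded analytic [F]; the differences then have vanishing energy. *)
Lemma hilbert_compact_of_energy Y : hilbert_compact mu Y q.
Proof.
have maps := hilbert_maps_into_of_energy Y.
split => // f M fM.
have fa n : analytic (f n) by have [[]] := fM n.
have fb n z : disk z -> normc (f n z) <= M.
  move=> z1; rewrite -lee_fin; have [_ h] := fM n; apply: le_trans h.
  by apply: ereal_sup_ubound; exists z.
have M0 : 0 <= M := bound_ge0 (fb 0%N).
have cb n k : normc (cauchy_coef (f n) k) <= 2 * M.
  exact: (cauchy_coef_bound (fa n) (fb n) k).
have [phi [a [phiH ab ca]]] := coordinatewise_subsequence cb.
have aD := bounded_disk_coefs ab.
pose F := psum a; have Fa : analytic F by exact: (psum_analytic aD).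
have fF z : disk z -> (fun j => f (phi j) z - F z) @ \oo --> (0 : C).
  move=> z1.
  have db j k : normc (cauchy_coef (f (phi j)) k - a k) <= 4 * M.
    by apply: le_trans (normcBD _ _) _; have := cb (phi j) k; have := ab k; lra.
  have d0 k : (fun j => cauchy_coef (f (phi j)) k - a k) @ \oo --> (0 : C).
    apply: normc_cvg; have := cvg_normc (ca k).
    rewrite (_ : (fun n => _) = (fun n => normc (cauchy_coef (f (phi n)) k - a k - 0)))//.
    by apply/funext => n; rewrite subr0.
  have := psum_coef_cvg0 db d0 z1.
  rewrite (_ : (fun j => _) = (fun j => f (phi j) z - F z))//.
  apply/funext => j; have [cD fE] := hinfty_expansion (fa (phi j)) (fb (phi j)).
  rewrite fE//; apply: (@cvgc_unique _ _ _ _ (psum_cvg (bounded_disk_coefs (db j)) z1)).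
  have := cvgcB (psum_cvg cD z1) (psum_cvg aD z1).
  rewrite (_ : (fun n => _) =
    series (fun k => (cauchy_coef (f (phi j)) k - a k) * z ^+ k))//.
  by apply/funext => n; rewrite /series/= -sumrB; apply: eq_bigr => k _; rewrite mulrBl.
have Fb z : disk z -> normc (F z) <= M.
  move=> z1; have h := fF z z1; apply/ler_addgt0Pr => e e0.
  have /cvg_normcP/(_ e e0)[N /(_ N (leqnn N))] := h.
  rewrite subr0 => h1; have := normcD (F z - f (phi N) z) (f (phi N) z).
  by have := fb (phi N) z z1; rewrite normcB in h1; rewrite subrK; lra.
have FH : in_hinfty F.
  split => //; apply: (@le_lt_trans _ _ M%:E); last by rewrite ltry.
  by apply: ge_ereal_sup => _ [z z1 <-]; rewrite lee_fin Fb.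
have [_ FT] := maps F FH; clearbody F.
exists phi, (hilbert mu F); split; [exact: phiH|exact: FT|].
have [K K0 KP] := target_norm_le q_ge1 mu Y.
pose w j := radial (fun z => f (phi j) z - F z).
have wa j : analytic (fun z => f (phi j) z - F z).
  by move=> z z1; apply: cderivableB; [exact: fa|exact: Fa].
have wb j z : disk z -> normc (f (phi j) z - F z) <= 2 * M.
  by move=> z1; apply: le_trans (normcBD _ _) _; have := fb (phi j) z z1;
    have := Fb z z1; lra.
have mw j : cmeasurable D01 (w j) by exact: cmeasurable_radial (wa j) (wb j).
have wM j t : 0 <= t < 1 -> normc (w j t) <= 2 * M.
  by move=> t1; exact: radial_bounded (wb j) _ t1.
have w0 t : 0 <= t < 1 -> (fun j => w j t) @ \oo --> (0 : C).
  by move=> t1; apply: fF; exact: disk_real.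
have hw j z : disk z -> hilbert mu (f (phi j)) z - hilbert mu F z = cauchy_int mu (w j) z.
  move=> z1.
  have [m1 b1 e1 _] := hilbert_energy (fa (phi j)) (fb (phi j)).
  have [m2 b2 e2 _] := hilbert_energy Fa Fb.
  rewrite (e1 z z1) (e2 z z1) /cauchy_int -CintB; [|exact: mD01|exact: (cintegrable_cauchy mu m1 b1)
    |exact: (cintegrable_cauchy mu m2 b2)].
  by apply: eq_Cint => t _; rewrite /w /radial mulrBl.
pose x j := target_norm Y q (fun z => hilbert mu (f (phi j)) z - hilbert mu F z).
have small (e : R) : 0 < e -> exists J, forall j, (J <= j)%N -> (x j <= e%:E)%E.
  move=> e0; pose d := e `^ q / (K + 1).
  have d0 : 0 < d by rewrite /d divr_gt0 ?powR_gt0//; lra.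
  have [J JP] := energy_vanishes mw wM w0 d0; exists J => j /JP jE.
  have tE : transform_energy q mu
    (fun z => hilbert mu (f (phi j)) z - hilbert mu F z) (w j) (2 * M) d.
    by split => //; [exact: wM|exact: hw].
  apply: le_trans (KP _ _ _ _ tE) _; rewrite lee_fin.
  have -> : e = (e `^ q) `^ q^-1.
    by rewrite -powRrM mulfV ?lt0r_neq0// powRr1// ltW.
  have Kd0 : 0 <= K * d := mulr_ge0 K0 (ltW d0).
  have qi0 : 0 <= q^-1 by rewrite invr_ge0 ltW.
  have := @ge0_ler_powR _ _ qi0 (K * d) (e `^ q); rewrite !nnegrE powR_ge0.
  apply => //.
  rewrite /d mulrA ler_pdivrMr; last by lra.
  by rewrite mulrC ler_wpM2l ?powR_ge0//; lra.
have x0 j : (0 <= x j)%E by exact: target_norm_ge0.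
have xfin e j : 0 < e -> (x j <= e%:E)%E -> x j \is a fin_num.
  by move=> e0 xe; rewrite ge0_fin_numE//; apply: le_lt_trans xe _; rewrite ltry.
apply/fine_cvgP; split.
  by have [J JP] := small 1 ltr01; exists J => // j /JP; exact: xfin.
apply/cvgrPdist_le => e e0; have [J JP] := small e e0; exists J => // j jJ.
have xe := JP j jJ.
rewrite /= sub0r normrN ger0_norm; last by rewrite fine_ge0// x0.
by rewrite -lee_fin fineK// (xfin e j e0 xe).
Qed.

End Energy.
End Sufficiency.

(** * The image of the constant function 1 *)

Section Necessity.
Variable R : realType.
Local Notation C := (R[i]^o).
Variables (q : R) (q_ge1 : 1 <= q).
Variable mu : {finite_measure set (measurableTypeR R) -> \bar R}.
Local Notation D01 := (`[0%R, 1%R[%classic : set (measurableTypeR R)).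

Let q_gt0 : 0 < q. Proof. exact: lt_le_trans q_ge1. Qed.

Let one : R -> C := radial (fun=> 1).
Let g : C -> C := hilbert mu (fun=> 1).

Let mone : cmeasurable D01 one. Proof. exact: cmeasurable_cst. Qed.

Let oneM t : 0 <= t < 1 -> normc (one t) <= 1. Proof. by rewrite normc1. Qed.

Lemma hilbert_one_cauchy z : disk z -> g z = cauchy_int mu one z.
Proof.
by apply: (hilbertE (@analytic_one R) (@one_bounded R)); exact: hilbert_inner_one.
Qed.

Lemma hilbert_one_derive1 z : disk z -> derive1 g z = cauchy_int' mu one z.
Proof. exact: (transform_derive1 mone oneM hilbert_one_cauchy). Qed.

Lemma hilbert_one_taylor_coef n : taylor_coef g n = (moment mu n)%:C%C.
Proof.
rewrite (transform_taylor_coef mone oneM hilbert_one_cauchy) -Cint_power.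
by apply: eq_Cint => t _; rewrite /one /radial mulr1.
Qed.

Lemma in_hinfty_one : in_hinfty (fun=> 1 : C).
Proof.
split; first exact: analytic_one.
apply: (@le_lt_trans _ _ 1%:E); last by rewrite ltry.
by apply: ge_ereal_sup => _ [z _ <-]; rewrite lee_fin normc1.
Qed.

(** The test function 1 has a transform with positive moments as coefficients; a
    pointwise lower bound of the kernel by a power of [t] turns into a lower bound
    by a moment. *)
Lemma moment_le_Cint (u : R -> C) (c : R) n : cintegrable mu D01 u ->
  (forall t, 0 <= t < 1 -> c * t ^+ n <= complex.Re (u t)) ->
  c * moment mu n <= normc (Cint mu D01 u).
Proof.
move=> ui cu; apply: le_trans (le_trans (ler_norm _) (normRe_le (Cint mu D01 u))).
rewrite /= /moment -RintegralZl; [|exact: mD01|exact: integrable_power].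
apply: le_Rintegral; [exact: mD01| |by case: ui|].
  have := integrableZl (@mD01 R) c (integrable_power mu n).
  by apply: eq_integrable => //; exact: mD01.
by move=> t /D01_itv; exact: cu.
Qed.

Lemma power_times_linear_le (t : R) n : 0 <= t < 1 ->
  t ^+ n * (n%:R * (1 - t) + 1) <= 1.
Proof.
move=> /andP[t0 t1]; elim: n => [|n ih]; first by rewrite mul0r add0r mulr1.
have p1 : t ^+ n.+1 <= 1 by rewrite exprn_ile1// ltW.
have -> : t ^+ n.+1 * (n.+1%:R * (1 - t) + 1) =
    t * (t ^+ n * (n%:R * (1 - t) + 1)) + t ^+ n.+1 * (1 - t).
  by rewrite exprS -natr1; ring.
have h1 := ler_wpM2l t0 ih.
have h2 : t ^+ n.+1 * (1 - t) <= 1 * (1 - t) by apply: ler_wpM2r; lra.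
lra.
Qed.

Lemma dyadic_index_unique (y : R) l m :
  (2 ^+ l.+1)^-1 < y -> y <= (2 ^+ l)^-1 ->
  (2 ^+ m.+1)^-1 < y -> y <= (2 ^+ m)^-1 -> l = m.
Proof.
move=> l1 l2 m1 m2.
have key i j : (2 ^+ i.+1)^-1 < y -> y <= (2 ^+ j)^-1 -> (j <= i)%N.
  move=> h1 h2; have := lt_le_trans h1 h2.
  rewrite ltf_pV2 ?posrE ?pow2_gt0// -ltnS => h.
  by move: h; rewrite -!natrX ltr_nat ltn_exp2l.
by apply/eqP; rewrite eqn_leq (key _ _ m1 l2) (key _ _ l1 m2).
Qed.

Lemma energy_of_dyadic (s : nat) (B : R) :
  (forall N, \sum_(0 <= m < N) dyadic_power q (moment mu) (m + s) <= B) ->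
  exists E, forall n, \sum_(0 <= k < n) weighted_power q (moment mu) k <= E.
Proof.
move=> dB.
pose c : R := 2 `^ `|q - 2|.
pose d := \sum_(0 <= m < s) dyadic_power q (moment mu) m.
exists (weighted_power q (moment mu) 0 + c * (d + B)) => n.
apply: (@le_trans _ _ (\sum_(0 <= k < 2 ^ (s + n)) weighted_power q (moment mu) k)).
  have le : (n <= 2 ^ (s + n))%N.
    by apply: leq_trans (ltnW (ltn_expl n (ltnSn 1))) _; rewrite leq_exp2l// leq_addl.
  rewrite (@big_cat_nat _ _ _ n 0 _ _ _ (leq0n n) le)/= lerDl.
  by apply: sumr_ge0 => k _; exact: weighted_power_ge0.
apply: le_trans (weighted_sum_le q_ge1 (moment_ge0 mu)
  (@moment_nonincreasing R mu) (s + n)%N) _.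
rewrite lerD2l; apply: ler_wpM2l; first exact: powR_ge0.
rewrite (@big_cat_nat _ _ _ s 0 (s + n)%N _ _ (leq0n s) (leq_addr n s))/= lerD2l.
by rewrite -{1}[s]add0n big_addn addKn; exact: dB.
Qed.

Lemma hardy_littlewood_necessary :
  (hardy_littlewood_norm q g < +oo)%E ->
  exists E, forall n, \sum_(0 <= k < n) weighted_power q (moment mu) k <= E.
Proof.
have qi : q^-1 != 0 by rewrite invr_neq0// lt0r_neq0.
move=> /(lty_poweRy qi) h; apply/nneseries_lty.
  by move=> k; exact: weighted_power_ge0.
apply: le_lt_trans h; apply: lee_nneseries => [n _ _|n _].
  by rewrite lee_fin weighted_power_ge0.
by rewrite hilbert_one_taylor_coef normcR ger0_norm ?moment_ge0.
Qed.

(** For [z = r e^(i theta)] with [0 < theta < pi] the real and the imaginary part of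
    [1/(1-tz)] are both nonnegative, so nothing cancels in the integral. *)
Lemma hilbert_one_lower (r theta : R) (m : nat) :
  0 <= r < 1 -> 1 - r <= (2 ^+ m)^-1 -> 0 < theta -> theta <= (2 ^+ m)^-1 ->
  2 ^+ m / 4 * moment mu (2 ^ m) <= normc (g (circ r theta)).
Proof.
move=> /andP[r0 r1] rm th0 thm.
have z1 : disk (circ r theta) by apply/diskP; rewrite normc_circ ger0_norm.
have p := pow2_gt0 R m.
rewrite hilbert_one_cauchy//.
have ui := cintegrable_cauchy mu mone oneM z1.
pose k : C := Complex 1 (-1).
have nk : normc k <= 2.
  by apply: le_trans (normc_leD _) _; rewrite /= normrN normr1; lra.
have thpi : theta <= pi.
  have h1 : (2 ^+ m)^-1 <= 1 :> R by rewrite invf_le1// exprn_ege1// ler1n.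
  by have := pi_ge2 R; lra.
suff : 2 ^+ m / 2 * moment mu (2 ^ m) <= normc (Cint mu D01
    (fun t => k * (one t / (1 - t%:C%C * circ r theta)))).
  have h := CintZ k (@mD01 R) ui; rewrite h normcM => h1.
  have h2 := le_trans h1 (ler_wpM2r (normc_ge0 (cauchy_int mu one (circ r theta))) nk).
  move: (normc (cauchy_int _ _ _)) (moment mu _) h2 => a b; lra.
apply: moment_le_Cint; first exact: cintegrableZ (@mD01 R) ui.
move=> t t01; have /andP[t0 t1] := t01.
have nz := one_sub_neq0 t01 z1.
set v := 1 - t%:C%C * circ r theta in nz *.
have v0 : 0 < normc v by rewrite normc_gt0.
have Rev : complex.Re v = 1 - t * r * cos theta.
  by rewrite /v ReD ReN ReM /= mul0r subr0 mulrA.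
have Imv : complex.Im v = - (t * r * sin theta).
  by rewrite /v ImD ImN ImM /= mul0r addr0 add0r mulrA.
have tr0 : 0 <= t * r by exact: mulr_ge0.
have sin0 : 0 <= sin theta by apply: sin_ge0_pi; rewrite (ltW th0).
have cos1 := cos_le1 theta.
have -> : complex.Re (k * (one t / v)) =
    (normc v ^+ 2)^-1 * (complex.Re v - complex.Im v).
  by rewrite /one /radial div1r ReM ReV ImV /=; ring.
have ab : normc v <= complex.Re v - complex.Im v.
  apply: le_trans (normc_leD _) _; rewrite Rev Imv normrN !ger0_norm; first by lra.
    exact: mulr_ge0.
  rewrite subr_ge0; apply: le_trans (ler_wpM2l tr0 cos1) _.
  rewrite mulr1; apply: le_trans (ler_wpM2l t0 (ltW r1)) _; lra.
apply: (@le_trans _ _ ((normc v)^-1)); last first.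
  have -> : (normc v)^-1 = (normc v ^+ 2)^-1 * normc v.
    by field; exact: lt0r_neq0.
  by apply: ler_wpM2l => //; rewrite invr_ge0 exprn_ge0// ltW.
have vle : normc v <= (1 - t) + 2 * (2 ^+ m)^-1.
  have -> : v = (1 - t)%:C%C + t%:C%C * (1 - circ r theta).
    by rewrite /v rmorphB/= rmorph1; ring.
  apply: le_trans (normcD _ _) _.
  rewrite normcM !normcR !ger0_norm//; last by rewrite subr_ge0 ltW.
  rewrite lerD2l; apply: le_trans (ler_piMl (normc_ge0 _) (ltW t1)) _.
  apply: le_trans (@chord_upper R r theta _ _) _; rewrite ?r0 ?(ltW th0)//; lra.
have n0 : 0 < (2 ^ m)%:R :> R by rewrite ltr0n expn_gt0.
have := power_times_linear_le (2 ^ m) t01.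
rewrite natrX; have /andP[] := power_itv (2 ^ m) t01.
move: (t ^+ (2 ^ m)) => T T0 T1 hT.
rewrite -[leRHS]mul1r ler_pdivlMr//.
apply: (@le_trans _ _ (2 ^+ m / 2 * T * ((1 - t) + 2 * (2 ^+ m)^-1))).
  by apply: ler_wpM2l => //; rewrite mulr_ge0// divr_ge0// ltW.
move: (2 ^+ m : R) p hT => x x0 hT.
have -> : x / 2 * T * (1 - t + 2 * x^-1) = T * (x * (1 - t) + 2) / 2.
  by field; exact: lt0r_neq0.
nra.
Qed.

(** On the circle of radius [1 - 2^-N] the lower bound holds on the disjoint
    intervals of angles between [2^-(m+1)] and [2^-m] for [m < N], uniformly in
    [N]. *)
Lemma hardy_necessary :
  (hardy_norm q g < +oo)%E ->
  exists E, forall n, \sum_(0 <= k < n) weighted_power q (moment mu) k <= E.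
Proof.
move=> hfin.
have [B BP] : exists B : R, forall r, 0 <= r < 1 -> (integral_mean q g r <= B%:E)%E.
  have h0 : (0 <= hardy_norm q g)%E := target_norm_ge0 q Hardy g.
  exists (fine (hardy_norm q g) `^ q) => r r01.
  have im0 : (0 <= integral_mean q g r)%E.
    apply: mule_ge0; first by rewrite lee_fin invr_ge0 ltW// pi2_gt0.
    by apply: integral_ge0 => p _; rewrite lee_fin powR_ge0.
  have le : (poweR (integral_mean q g r) q^-1 <= hardy_norm q g)%E.
    by apply: ereal_sup_ubound; exists r => //=; rewrite in_itv/=.
  have -> : integral_mean q g r = poweR (poweR (integral_mean q g r) q^-1) q.
    by rewrite -poweRrM mulVf ?lt0r_neq0// poweRe1.
  rewrite -poweR_EFin fineK ?ge0_fin_numE//.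
  apply: gt0_ler_poweR => //; first exact: ltW.
    by rewrite in_itv/= poweR_ge0 leey.
  by rewrite in_itv/= h0 leey.
pose c : R := (4 `^ q)^-1 / 2.
have c0 : 0 < c by rewrite /c divr_gt0// invr_gt0 powR_gt0.
apply: (@energy_of_dyadic 0 (c^-1 * (2 * pi * B))) => N.
rewrite ler_pdivlMl// mulr_sumr.
pose r : R := 1 - (2 ^+ N)^-1.
have pN := pow2_gt0 R N.
have r01 : 0 <= r < 1.
  rewrite /r subr_ge0 invf_le1// exprn_ege1 ?ler1n//=.
have := BP r r01; rewrite /integral_mean lee_pdivrMl ?pi2_gt0// -EFinM -lee_fin.
apply: le_trans.
have L := @layer_lower _ (measurableTypeR R) R lebesgue_measure `[0, 2 * pi]
  (fun t => normc (g (circ r t)) `^ q)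
  (fun m => `](2 ^+ m.+1)^-1, (2 ^+ m)^-1]%classic)
  (fun m => (2 ^+ m / 4 * moment mu (2 ^ m)) `^ q) (fun m => (2 ^+ m.+1)^-1) N.
have i1 m : (2 ^+ m)^-1 <= 1 :> R.
  by rewrite invf_le1 ?pow2_gt0// exprn_ege1// ler1n.
have i0 m : 0 < (2 ^+ m)^-1 :> R by rewrite invr_gt0 pow2_gt0.
have half m : (2 ^+ m.+1)^-1 = (2 ^+ m)^-1 / 2 :> R by rewrite exprS invfM mulrC.
apply: le_trans (L _ _ _ _ _ _ _).
- rewrite lee_fin; apply: ler_sum => m _; rewrite addn0 /dyadic_power.
  have p := pow2_gt0 R m.
  rewrite mulrAC powRM ?mulr_ge0 ?moment_ge0 ?(ltW p)//.
  rewrite powRM ?moment_ge0 ?(ltW p)// powRB ?lt0r_neq0 ?implybT// powRr1 ?(ltW p)//.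
  rewrite powR_inv// /c exprS; have p4 : 0 < 4 `^ q :> R by exact: powR_gt0.
  rewrite le_eqVlt; apply/orP; left; apply/eqP; field.
  by rewrite !lt0r_neq0.
- by move=> t _; exact: powR_ge0.
- by move=> m; exact: measurable_itv.
- by move=> m; exact: powR_ge0.
- move=> m t; rewrite /= !in_itv/= => /andP[t0 t1].
  have := i1 m; have := i0 m.+1; have := pi_ge2 R; lra.
- move=> l m t; rewrite /= !in_itv/= => /andP[l1 l2] /andP[m1 m2].
  exact: dyadic_index_unique l1 l2 m1 m2.
- move=> m; have le : (2 ^+ m.+1)^-1 <= (2 ^+ m)^-1 :> R.
    by have := i0 m; rewrite half; lra.
  have e : (2 ^+ m.+1)^-1 = (2 ^+ m)^-1 - (2 ^+ m.+1)^-1 :> R.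
    by rewrite half; field; rewrite lt0r_neq0// pow2_gt0.
  have h := lebesgue_interval false false le; rewrite -e in h.
  by rewrite le_eqVlt; apply/orP; left; apply/eqP; exact: esym h.
- move=> m t mN; rewrite /= in_itv/= => /andP[t0 t1].
  apply: ge0_ler_powR; rewrite ?nnegrE ?normc_ge0 ?(ltW q_gt0)//.
    by rewrite mulr_ge0 ?moment_ge0// divr_ge0// ltW// pow2_gt0.
  apply: hilbert_one_lower => //; last exact: lt_trans t0.
  rewrite /r opprB addrC subrK lef_pV2 ?posrE ?pow2_gt0//.
  by rewrite -!natrX ler_nat leq_exp2l// ltnW.
Qed.

(** In a box of width small compared to its distance [2^-m] from 1, the numbers
    [1 - t z] stay in a narrow sector around the positive axis, so the real part of
    [1/(1-tz)^2] is comparable to its modulus. *)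
Lemma hilbert_one_derive1_lower (x y : R) (m : nat) :
  1 - (2 ^+ m)^-1 <= x -> x < 1 - (2 ^+ m)^-1 / 2 -> `|y| <= (2 ^+ m)^-1 / 8 ->
  [/\ disk (x +i* y)%C, (2 ^+ m)^-1 / 4 <= 1 - normc (x +i* y)%C
    & (2 ^+ m) ^+ 2 / 2 * moment mu (2 ^ m.+2) <= normc (derive1 g (x +i* y)%C)].
Proof.
have p := pow2_gt0 R m.
have i0 : 0 < (2 ^+ m)^-1 :> R by rewrite invr_gt0.
have i1 : (2 ^+ m)^-1 <= 1 :> R.
  by rewrite invf_le1// exprn_ege1// ler1n.
move=> x1 x2 ys; have x0 : 0 <= x by lra.
have [xs xs0] : 1 - x <= (2 ^+ m)^-1 /\ 0 <= 1 - x by split; lra.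
have nz : normc (x +i* y)%C <= 1 - (2 ^+ m)^-1 / 4.
  by apply: le_trans (normc_leD _) _; rewrite /= (ger0_norm x0); lra.
have z1 : disk (x +i* y)%C by apply/diskP; lra.
split => //; first by lra.
rewrite hilbert_one_derive1//.
have ui := cintegrable_cauchy' mu mone oneM z1; apply: (moment_le_Cint ui).
move=> t t01; have /andP[t0 t1] := t01.
have vz := one_sub_neq0 t01 z1.
set v := 1 - t%:C%C * (x +i* y)%C in vz *.
have Rev : complex.Re v = 1 - t * x.
  by rewrite /v ReD ReN ReM /= mul0r subr0.
have Imv : complex.Im v = - (t * y).
  by rewrite /v ImD ImN ImM /= mul0r addr0 add0r.
have -> : t%:C%C * one t / v ^+ 2 = t%:C%C * (v^-1 * v^-1).
  by rewrite /one /radial mulr1 -expr2 exprVn.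
have e1 := @ReM R t%:C%C (v^-1 * v^-1); have e2 := @ReM R v^-1 v^-1.
rewrite [complex.Re _]e1 Re_real Im_real mul0r subr0 [complex.Re (_ * _)]e2.
rewrite ReV ImV normc_sqr Rev Imv.
set a := 1 - t * x; set b := t * y.
have a0 : (2 ^+ m)^-1 / 2 <= a.
  by have := ler_wpM2r x0 (ltW t1); rewrite /a mul1r; lra.
have ba : b ^+ 2 <= a ^+ 2 / 16.
  have : `|b| <= a / 4.
    rewrite /b normrM ger0_norm//.
    have := ler_pM t0 (normr_ge0 y) (ltW t1) ys; rewrite mul1r; lra.
  move=> h; rewrite -real_normK ?num_real//.
  have -> : a ^+ 2 / 16 = (a / 4) ^+ 2 by rewrite expr_div_n -natrX.
  by apply: lerXn2r; rewrite ?nnegrE//; lra.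
have aL : 2 ^+ m * a <= 2 ^+ m * (1 - t) + 1.
  have -> : 2 ^+ m * (1 - t) + 1 = 2 ^+ m * ((1 - t) + (2 ^+ m)^-1).
    by field; exact: lt0r_neq0.
  rewrite ler_pM2l// /a; have := le_trans (ler_piMl xs0 (ltW t1)) xs.
  by rewrite mulrBr mulr1; lra.
have T4 : t ^+ (2 ^ m.+2) <= t * (t ^+ (2 ^ m)) ^+ 2.
  rewrite -exprM -exprS ler_wiXn2l ?(ltW t1)//.
  by rewrite mulnC -expnS ltn_exp2l.
have LT := power_times_linear_le (2 ^ m) t01; rewrite natrX in LT.
have /andP[T0 T1] := power_itv (2 ^ m) t01.
move: (t ^+ (2 ^ m.+2)) (t ^+ (2 ^ m)) (2 ^+ m : R) T4 LT T0 T1 p i0 i1 a0 aL {x1 x2 ys nz}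
  => T' T n T4 LT T0 T1 n0 i0 i1 a0 aL.
have a0' : 0 < a by lra.
have P : T ^+ 2 * (n ^+ 2 * a ^+ 2) <= 1.
  rewrite -!exprMn; apply: exprn_ile1; first by rewrite !mulr_ge0 ?(ltW n0) ?(ltW a0').
  by apply: le_trans LT; exact: ler_wpM2l.
have b0 : 0 <= b ^+ 2 := sqr_ge0 b.
rewrite sqrrN.
have A0 : 0 < a ^+ 2 by rewrite exprn_gt0.
have -> : t * (a / (a ^+ 2 + b ^+ 2) * (a / (a ^+ 2 + b ^+ 2)) -
    - (- b / (a ^+ 2 + b ^+ 2)) * - (- b / (a ^+ 2 + b ^+ 2))) =
    t * (a ^+ 2 - b ^+ 2) / (a ^+ 2 + b ^+ 2) ^+ 2.
  by field; rewrite lt0r_neq0// ltr_wpDr.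
move: (a ^+ 2) (b ^+ 2) A0 b0 ba P {a0 aL a0'} => A B A0 B0 BA P.
have D0 : 0 < (A + B) ^+ 2 by rewrite exprn_gt0// ltr_wpDr.
rewrite ler_pdivlMr//.
have n2 : 0 <= n ^+ 2 / 2 by rewrite divr_ge0// sqr_ge0.
apply: (@le_trans _ _ (n ^+ 2 / 2 * (t * T ^+ 2) * (A + B) ^+ 2)).
  by apply: ler_wpM2r; [exact: ltW|exact: ler_wpM2l].
have AB : (A + B) ^+ 2 <= 3 / 2 * A ^+ 2 by nra.
have c0 : 0 <= n ^+ 2 / 2 * (t * T ^+ 2) by rewrite mulr_ge0// mulr_ge0// sqr_ge0.
apply: le_trans (ler_wpM2l c0 AB) _.
have -> : n ^+ 2 / 2 * (t * T ^+ 2) * (3 / 2 * A ^+ 2) =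
    t * (3 / 4 * A * (T ^+ 2 * (n ^+ 2 * A))) by field.
apply: ler_wpM2l; first exact: t0.
have A1 : 0 <= 3 / 4 * A by lra.
have := ler_wpM2l A1 P; rewrite mulr1; move: (3 / 4 * A * _) => X h.
lra.
Qed.

Lemma dyadic_height_unique (x : R) l m :
  1 - (2 ^+ l)^-1 <= x -> x < 1 - (2 ^+ l)^-1 / 2 ->
  1 - (2 ^+ m)^-1 <= x -> x < 1 - (2 ^+ m)^-1 / 2 -> l = m.
Proof.
have half k : (2 ^+ k.+1)^-1 = (2 ^+ k)^-1 / 2 :> R by rewrite exprS invfM mulrC.
by move=> l1 l2 m1 m2; apply: (@dyadic_index_unique (1 - x)); rewrite ?half; lra.
Qed.

Lemma box_area (s : R) : 0 < s ->
  (@lebesgue_measure R \x @lebesgue_measure R)%E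
    ((`[1 - s, 1 - s / 2[%classic : set (measurableTypeR R)) `*`
     (`[- (s / 8), s / 8]%classic : set (measurableTypeR R))) = (s ^+ 2 / 8)%:E.
Proof.
move=> s0; have h1 : 1 - s <= 1 - s / 2 by lra.
have h2 : - (s / 8) <= s / 8 by lra.
have h := lebesgue_rectangle true true true false h1 h2.
have e : (1 - s / 2 - (1 - s)) * (s / 8 - - (s / 8)) = s ^+ 2 / 8 by field.
by rewrite e in h; exact: h.
Qed.

(** The boxes of [hilbert_one_derive1_lower] have area comparable to [4^-m]; each
    contributes a term of the dyadic sum of the moments of index [2^(m+2)]. *)
Lemma dirichlet_necessary :
  (dirichlet_norm q g < +oo)%E ->
  exists E, forall n, \sum_(0 <= k < n) weighted_power q (moment mu) k <= E.
Proof.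
have qi : q^-1 != 0 by rewrite invr_neq0// lt0r_neq0.
move=> /(lty_poweRy qi); set I := (X in (_ + X)%E) => hfin.
have I0 : (0 <= I)%E.
  by apply: integral_ge0 => p _; rewrite lee_fin mulr_ge0 ?powR_ge0.
have IB : (I < +oo)%E.
  by apply: le_lt_trans hfin; rewrite leeDr// lee_fin powR_ge0.
have [B BP] : exists B : R, (I <= B%:E)%E.
  by exists (fine I); rewrite fineK// ge0_fin_numE.
pose c : R := 2 `^ q * 4 `^ (q - 1) * 8 * 4 `^ (q - 1).
have c0 : 0 < c by rewrite /c !mulr_gt0 ?powR_gt0.
apply: (@energy_of_dyadic 2 (c * B)) => N.
rewrite -ler_pdivrMl// mulr_sumr -lee_fin; apply: le_trans BP.
have L := @layer_lower _ (measurableTypeR R * measurableTypeR R)%type R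
  (lebesgue_measure \x lebesgue_measure)%E [set p | disk (p.1 +i* p.2)%C]
  (fun p => normc (derive1 g (p.1 +i* p.2)%C) `^ q *
    (1 - normc (p.1 +i* p.2)%C) `^ (q - 1))
  (fun m => `[1 - (2 ^+ m)^-1, 1 - (2 ^+ m)^-1 / 2[ `*`
    `[- ((2 ^+ m)^-1 / 8), (2 ^+ m)^-1 / 8])
  (fun m => ((2 ^+ m) ^+ 2 / 2 * moment mu (2 ^ m.+2)) `^ q *
    ((2 ^+ m)^-1 / 4) `^ (q - 1))
  (fun m => ((2 ^+ m)^-1) ^+ 2 / 8) N.
have i0 m : 0 < (2 ^+ m)^-1 :> R by rewrite invr_gt0 pow2_gt0.
have box m (p : R * R) : (`[1 - (2 ^+ m)^-1, 1 - (2 ^+ m)^-1 / 2[ `*`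
    `[- ((2 ^+ m)^-1 / 8), (2 ^+ m)^-1 / 8])%classic p ->
  [/\ 1 - (2 ^+ m)^-1 <= p.1, p.1 < 1 - (2 ^+ m)^-1 / 2 & `|p.2| <= (2 ^+ m)^-1 / 8].
  by case=> /=; rewrite !in_itv/= ler_norml => /andP[-> ->] ->.
apply: le_trans (L _ _ _ _ _ _ _).
- rewrite lee_fin; apply: ler_sum => m _; rewrite /dyadic_power.
  rewrite addn2; have X0 := pow2_gt0 R m.
  have m0 := moment_ge0 mu (2 ^ m.+2).
  have -> : (2 ^+ m.+2 : R) = 4 * 2 ^+ m by rewrite !exprS; ring.
  move: (moment _ _) (2 ^+ m : R) X0 m0 => v X X0 v0.
  rewrite !powRM ?mulr_ge0 ?sqr_ge0 ?invr_ge0 ?(ltW X0)//.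
  rewrite !powR_inv ?(ltW X0)//.
  have -> : X `^ q = X * X `^ (q - 1).
    rewrite -[X in X * _]powRr1 ?(ltW X0)// -powRD; last by rewrite lt0r_neq0// implybT.
    by congr (_ `^ _); ring.
  have Y0 : 0 < X `^ (q - 1) by exact: powR_gt0.
  have Z0 : 0 < 4 `^ (q - 1) :> R by exact: powR_gt0.
  have W0 : 0 < 2 `^ q :> R by exact: powR_gt0.
  rewrite /c; move: (X `^ _) (4 `^ _) (2 `^ q) Y0 Z0 W0 => Y Z W Y0 Z0 W0.
  rewrite le_eqVlt; apply/orP; left; apply/eqP; field.
  by rewrite !lt0r_neq0.
- by move=> p _; rewrite mulr_ge0 ?powR_ge0.
- by move=> m; apply: measurableX; exact: measurable_itv.
- by move=> m; rewrite mulr_ge0 ?powR_ge0.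
- by move=> m p /box[h1 h2 h3]; have [] := hilbert_one_derive1_lower h1 h2 h3.
- move=> l m p /box[l1 l2 _] /box[m1 m2 _].
  exact: dyadic_height_unique l1 l2 m1 m2.
- move=> m; have h := box_area (i0 m).
  by rewrite le_eqVlt; apply/orP; left; apply/eqP; exact: esym h.
- move=> m p _ /box[h1 h2 h3]; have [z1 d1 g1] := hilbert_one_derive1_lower h1 h2 h3.
  have s0 := i0 m.
  apply: ler_pM; rewrite ?powR_ge0//.
    apply: ge0_ler_powR; rewrite ?nnegrE ?normc_ge0 ?(ltW q_gt0)//.
    by rewrite mulr_ge0 ?moment_ge0// divr_ge0// sqr_ge0.
  have d0 : 0 <= (2 ^+ m)^-1 / 4 :> R by rewrite divr_ge0// ltW.
  by apply: ge0_ler_powR; rewrite ?nnegrE ?subr_ge0//; exact: ltW z1.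
Qed.

Lemma energy_of_maps_into (Y : target_space) : hilbert_maps_into mu Y q ->
  exists E, forall n, \sum_(0 <= k < n) weighted_power q (moment mu) k <= E.
Proof.
move=> maps; have [_ [_]] := maps _ in_hinfty_one.
case: Y {maps}; [exact: dirichlet_necessary|exact: hardy_necessary
  |exact: hardy_littlewood_necessary].
Qed.

End Necessity.

(** * The equivalence *)

Theorem theorem1p4 (R : realType) (q : R)
    (mu : {finite_measure set (measurableTypeR R) -> \bar R})
    (Y : target_space) (hq : 1 <= q)
    (hmu : mu (~` `[0%R, 1%R[) = 0%E) :
  (hilbert_bounded mu Y q <-> hilbert_compact mu Y q) /\
  (hilbert_compact mu Y q <->
     in_ell q (fun n => (n.+1%:R `^ (1 - 2 / q)) * moment mu n)).
Proof.
have ofE E := @hilbert_bounded_of_energy R q hq mu E.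
have cptE E := @hilbert_compact_of_energy R q hq mu E.
have necessary := @energy_of_maps_into R q hq mu Y.
split; split.
- by move=> [/necessary[E /cptE]].
- by move=> [/necessary[E /ofE]].
- by move=> [/necessary h _]; apply/(in_ell_moment hq).
- by move=> /(in_ell_moment hq)[E /cptE].
Qed.
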